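(* Let $M$ be an 8-manifold. For a Cayley form $\Phi$ and a 3-form $C$ on $M$ consider the functional $$S_{\kappa=0}[\Phi,C]=\int_M \Phi\wedge\left(dC-6\,C\wedge_\Phi C\right)+\frac{\lambda}{6}v_\Phi ,\qquad \lambda\in\mathbb{R}.$$ The Euler-Lagrange equation obtained by extremising $S_{\kappa=0}[\Phi,C]$ with respect to $C$ (at fixed $\Phi$) is $C=T$, where $T$ is the torsion 3-form of $\Phi$.
   Context: A Cayley form ($\mathrm{Spin}(7)$-structure) on an 8-manifold $M$ is a 4-form $\Phi$ which at each point lies in a fixed $\mathrm{GL}(8,\mathbb{R})$-orbit of 4-forms with stabiliser $\mathrm{Spin}(7)$. It determines a Riemannian metric $g$ and an orientation. The conventions are fixed by the identity (all contractions and index raisings with $g$) $$\Phi_{ijkp}\Phi_{abc}{}^{p}= g_{ia}g_{jb}g_{kc}+g_{ib}g_{jc}g_{ka}+g_{ic}g_{ja}g_{kb}-g_{ia}g_{jc}g_{kb}-g_{ic}g_{jb}g_{ka}-g_{ib}g_{ja}g_{kc}$$ $$-g_{ia}\Phi_{jkbc}-g_{ja}\Phi_{kibc}-g_{ka}\Phi_{ijbc}-g_{ib}\Phi_{jkca}-g_{jb}\Phi_{kica}-g_{kb}\Phi_{ijca}-g_{ic}\Phi_{jkab}-g_{jc}\Phi_{kiab}-g_{kc}\Phi_{ijab},$$ and $\Phi$ is self-dual: $\frac1{4!}\epsilon_{ijkl}{}^{abcd}\Phi_{abcd}=\Phi_{ijkl}$, with $\epsilon$ the volume form of $g$. Square brackets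 denote antisymmetrisation with weight one; indices between vertical bars are excluded from it. $k$-forms have components $\omega=\frac1{k!}\omega_{a_1\dots a_k}dx^{a_1}\wedge\dots\wedge dx^{a_k}$. $C\wedge_\Phi C$ is the 4-form with components $(C\wedge_\Phi C)_{abcd}=C_{[ab|p|}C_{cd]q}g^{pq}$, and $v_\Phi=\frac1{14}\Phi\wedge\Phi$ is the volume form of $g$. The torsion 3-form $T$ of $\Phi$ is the 3-form with $\nabla_i\Phi_{abcd}=4\,T_{i[a}{}^{p}\Phi_{|p|bcd]}$, $\nabla$ being the Levi-Civita connection of $g$. In the original action additional constraint terms, depending only on $\Phi$ and Lagrange multipliers, force $\Phi$ to be a Cayley form; they do not contribute to the variation in $C$. Euler-Lagrange equations are taken with respect to compactly supported variations. *)

(* Defs.v *)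
From HB Require Import structures.
From mathcomp Require Import all_boot all_order all_algebra all_fingroup.
From mathcomp Require Import all_classical all_reals all_analysis.
From mathcomp Require Import measurable_realfun.

Set Implicit Arguments.
Unset Strict Implicit.
Unset Printing Implicit Defensive.

Import Order.TTheory GRing.Theory Num.Theory.
Import numFieldNormedType.Exports.

Local Open Scope classical_set_scope.
Local Open Scope ring_scope.

(* Components T_{a_1 ... a_k} of a covariant tensor at a point of an
   8-dimensional space; indices run over {0, ..., 7}. *)
Definition tensor (R : realType) (k : nat) := k.-tuple 'I_8 -> R.

Definition permute_idx (k : nat) (s : 'S_k) (a : k.-tuple 'I_8) :
    k.-tuple 'I_8 :=
  [tuple tnth a (s m) | m < k].

Definition alternating (R : realType) (k : nat) (t : tensor R k) : Prop :=
  forall (s : 'S_k) (a : k.-tuple 'I_8),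
    t (permute_idx s a) = (-1) ^+ s * t a.

(* Antisymmetrisation of weight one: t_{[a_1 ... a_k]}. *)
Definition alt (R : realType) (k : nat) (t : tensor R k) : tensor R k :=
  fun a => k`!%:R^-1 * \sum_(s : 'S_k) (-1) ^+ s * t (permute_idx s a).

(* With w = (1/k!) w_{a_1...a_k} dx^{a_1} /\ ... /\ dx^{a_k}, the wedge product
   has components ((p+q)!/(p! q!)) u_{[a_1...a_p} v_{a_{p+1}...a_{p+q}]}. *)
Definition wedge (R : realType) (p q : nat) (u : tensor R p) (v : tensor R q) :
    tensor R (p + q) :=
  fun a => 'C(p + q, p)%:R *
    alt (fun b => u [tuple tnth b (lshift q m) | m < p] *
                  v [tuple tnth b (rshift p m) | m < q]) a.

(* The covector A^b_a dx^a has its components in row b of A. *)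
Definition pullback (R : realType) (k : nat) (A : 'M[R]_8) (t : tensor R k) :
    tensor R k :=
  fun a => \sum_(b : k.-tuple 'I_8) (\prod_(m < k) A (tnth b m) (tnth a m)) * t b.

(* (true, [:: i; j; k; l]) stands for - e^{ijkl}. *)
Definition Phi0_terms : seq (bool * seq nat) :=
  [:: (true,  [:: 0; 1; 2; 3]); (true,  [:: 0; 1; 4; 5]);
      (true,  [:: 0; 1; 6; 7]); (true,  [:: 0; 2; 4; 6]);
      (false, [:: 0; 2; 5; 7]); (false, [:: 0; 3; 4; 7]);
      (false, [:: 0; 3; 5; 6]); (true,  [:: 4; 5; 6; 7]);
      (true,  [:: 2; 3; 6; 7]); (true,  [:: 2; 3; 4; 5]);
      (true,  [:: 1; 3; 5; 7]); (false, [:: 1; 3; 4; 6]);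
      (false, [:: 1; 2; 5; 6]); (false, [:: 1; 2; 4; 7])]%N.

(* The model Cayley form on R^8.  The overall sign and the orientation are fixed
   by the two conventions: for the Euclidean metric
     Phi0_{ijkp} Phi0_{abcp} = (delta^3 terms) - delta_{ia} Phi0_{jkbc} - ...
   (with minus signs on the terms linear in Phi0), and Phi0 is self-dual, with
   (1/14) Phi0 /\ Phi0 = + e^{01234567}.  The form e^{ijkl} has components
   det (delta^{i_m}_{a_n}). *)
Definition Phi0 (R : realType) : tensor R 4 :=
  fun a => \sum_(t <- Phi0_terms)
    (-1) ^+ t.1 *
    \det (\matrix_(m < 4, n < 4) ((nth 0%N t.2 m == tnth a n :> nat)%:R : R)).

Definition basis_vec (R : realType) (a : 'I_8) : 'rV[R]_8 := delta_mx 0 a.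

Fixpoint Cn_on (R : realType) (n : nat) (U : set 'rV[R]_8) (f : 'rV[R]_8 -> R) :
    Prop :=
  (forall x, U x -> {for x, continuous f}) /\
  if n is m.+1 then
    forall a : 'I_8,
      (forall x, U x -> derivable f x (basis_vec R a)) /\
      Cn_on m U (fun x => 'D_(basis_vec R a) f x)
  else True.

Definition smooth_on (R : realType) (U : set 'rV[R]_8) (f : 'rV[R]_8 -> R) :
    Prop :=
  forall n, Cn_on n U f.

Record manifold (R : realType) := Manifold {
  carrier :> ptopologicalType;
  chart_index : Type;
  chart_dom : chart_index -> set carrier;
  chart : chart_index -> carrier -> 'rV[R]_8;
  chart_inv : chart_index -> 'rV[R]_8 -> carrier;
  chart_at : carrier -> chart_index;
  point_hausdorff : hausdorff_space carrier;
  point_second_countable : @second_countable carrier;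
  dom_open : forall i, open (chart_dom i);
  dom_chart_at : forall p, chart_dom (chart_at p) p;
  chart_image_open : forall i, open (chart i @` chart_dom i);
  chart_continuous : forall i, {within chart_dom i, continuous (chart i)};
  chart_inv_continuous :
    forall i, {within chart i @` chart_dom i, continuous (chart_inv i)};
  chartK : forall i p, chart_dom i p -> chart_inv i (chart i p) = p;
  transition_smooth : forall i j (b : 'I_8),
    smooth_on (chart i @` (chart_dom i `&` chart_dom j))
              (fun x => chart j (chart_inv i x) 0 b)
}.

Section Fields.
Variables (R : realType) (M : manifold R).

(* A tensor field is given by its components in every chart; only the values at
   points of the domain of the chart are meaningful. *)
Definition tensor_field (k : nat) := chart_index M -> M -> tensor R k.
Definition matrix_field := chart_index M -> M -> 'M[R]_8.

(* d f / d x_i^a at p, for the coordinates x_i of the chart i. *)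
Definition partial (i : chart_index M) (a : 'I_8) (f : M -> R) (p : M) : R :=
  'D_(basis_vec R a) (f \o chart_inv i) (chart i p).

(* Row a, column b: d x_j^b / d x_i^a at p. *)
Definition transition_jacobian (i j : chart_index M) (p : M) : 'M[R]_8 :=
  \matrix_(a, b) partial i a (fun q => chart j q 0 b) p.

Definition smooth_comp (i : chart_index M) (f : M -> R) : Prop :=
  smooth_on (chart i @` chart_dom i) (f \o chart_inv i).

Definition is_form (k : nat) (w : tensor_field k) : Prop :=
  [/\ forall i a, smooth_comp i (fun p => w i p a),
      forall i p, chart_dom i p -> alternating (w i p)
    & forall i j p a, chart_dom i p -> chart_dom j p ->
        w i p a = pullback (transition_jacobian i j p)^T (w j p) a].

Definition is_riemannian_metric (g : matrix_field) : Prop :=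
  [/\ forall i a b, smooth_comp i (fun p => g i p a b),
      forall i p, chart_dom i p -> (g i p)^T = g i p,
      forall i p (v : 'rV[R]_8), chart_dom i p -> v != 0 ->
        0 < (v *m g i p *m v^T) 0 0
    & forall i j p, chart_dom i p -> chart_dom j p ->
        g i p = transition_jacobian i j p *m g j p *m
                (transition_jacobian i j p)^T].

(* Phi is a Cayley form: it is pointwise in the GL(8, R)-orbit of Phi0. *)
Definition is_cayley_form (Phi : tensor_field 4) : Prop :=
  is_form Phi /\
  forall i p, chart_dom i p ->
    exists2 A : 'M[R]_8, A \in unitmx & Phi i p =1 pullback A (@Phi0 R).

(* g is the metric determined by Phi: the one for which a coframe A in which Phi
   is Phi0 is orthonormal (the stabiliser Spin(7) of Phi0 lies in SO(8), so the
   choice of A does not matter). *)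
Definition is_metric_of (Phi : tensor_field 4) (g : matrix_field) : Prop :=
  is_riemannian_metric g /\
  forall i p, chart_dom i p ->
    exists A : 'M[R]_8,
      [/\ A \in unitmx, Phi i p =1 pullback A (@Phi0 R) & g i p = A^T *m A].

Definition ext_d (k : nat) (w : tensor_field k) : tensor_field k.+1 :=
  fun i p a => \sum_(m < k.+1)
    (-1) ^+ m *
    partial i (tnth a m) (fun q => w i q [tuple tnth a (lift m n) | n < k]) p.

(* Gamma^c_{ab}. *)
Definition christoffel (g : matrix_field) (i : chart_index M) (p : M)
    (c a b : 'I_8) : R :=
  2^-1 * \sum_(e < 8) invmx (g i p) c e *
    (partial i a (fun q => g i q e b) p + partial i b (fun q => g i q e a) p
     - partial i e (fun q => g i q a b) p).

(* nabla_b w_{a_1 ... a_k}. *)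
Definition nabla (g : matrix_field) (k : nat) (w : tensor_field k)
    (i : chart_index M) (p : M) (b : 'I_8) (a : k.-tuple 'I_8) : R :=
  partial i b (fun q => w i q a) p
  - \sum_(m < k) \sum_(c < 8)
      christoffel g i p c b (tnth a m) *
      w i p [tuple if n == m then c else tnth a n | n < k].

Definition is_torsion (Phi : tensor_field 4) (g : matrix_field)
    (T : tensor_field 3) : Prop :=
  is_form T /\
  forall i p (b : 'I_8) (a : 4.-tuple 'I_8), chart_dom i p ->
    nabla g Phi i p b a =
    4 * alt (fun c : 4.-tuple 'I_8 =>
               \sum_(r < 8) \sum_(q < 8)
                 T i p [tuple b; c`_0; q] * invmx (g i p) q r *
                 Phi i p [tuple r; c`_1; c`_2; c`_3]) a.

(* C /\_Phi C. *)
Definition wedge_Phi (g : matrix_field) (C : tensor_field 3) : tensor_field 4 :=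
  fun i p =>
    alt (fun a : 4.-tuple 'I_8 =>
           \sum_(r < 8) \sum_(q < 8)
             C i p [tuple a`_0; a`_1; r] * C i p [tuple a`_2; a`_3; q] *
             invmx (g i p) r q).

Definition vol_form (Phi : tensor_field 4) : tensor_field 8 :=
  fun i p a => 14^-1 * wedge (Phi i p) (Phi i p) a.

Definition lagrangian (Phi : tensor_field 4) (g : matrix_field) (lambda : R)
    (C : tensor_field 3) : tensor_field 8 :=
  fun i p a =>
    wedge (Phi i p)
      (fun b => ext_d C i p b - 6 * wedge_Phi g C i p b) a
    + lambda / 6 * vol_form Phi i p a.

End Fields.

(* Lebesgue integral over R^n of a non-negative Borel function, as an iterated
   integral. *)
Fixpoint integral_rV (R : realType) (n : nat) :
    ('rV[R]_n -> \bar R) -> \bar R :=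
  match n with
  | 0 => fun f => f 0
  | m.+1 => fun f =>
      (\int[@lebesgue_measure R]_t
         integral_rV (fun v : 'rV[R]_m => f (row_mx (t%:M : 'rV[R]_1) v)))%E
  end.

Notation borel T := (g_sigma_algebraType (@open T)).

Section Action.
Variables (R : realType) (M : manifold R).
Variable mu : {measure set (borel M) -> \bar R}.

(* mu is the Riemannian volume measure: d mu = sqrt (det g) dx in each chart
   (F \_ D is F extended by 0, the default point of \bar R, outside D). *)
Definition is_riemannian_measure (g : matrix_field M) : Prop :=
  forall (i : chart_index M) (f : borel M -> \bar R),
    measurable_fun setT f -> (forall p, (0 <= f p)%E) ->
    (\int[mu]_(p in chart_dom i) f p)%E =
    integral_rV ((fun x => f (chart_inv i x) *
                           (Num.sqrt (\det (g i (chart_inv i x))))%:E)%E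
                 \_ (chart i @` chart_dom i)).

(* The index of the component w_{01234567}. *)
Definition top_idx : 8.-tuple 'I_8 := [tuple m | m < 8].

(* Integral over K of an 8-form w = f v_Phi, i.e. of f against the volume
   measure.  M is oriented by Phi, so that v_Phi is its Riemannian volume form;
   f p is independent of the chart at p. *)
Definition integral_form (Phi : tensor_field M 4) (K : set M)
    (w : tensor_field M 8) : R :=
  \int[mu]_(p in (K : set (borel M)))
    (w (chart_at p) p top_idx / vol_form Phi (chart_at p) p top_idx).

Definition cayley_action (Phi : tensor_field M 4) (g : matrix_field M) (lambda : R)
    (K : set M) (C : tensor_field M 3) : R :=
  integral_form Phi K (lagrangian Phi g lambda C).

(* Criticality in C for compactly supported variations.  On a non-compact M the
   action may diverge, so it is integrated over a compact set containing the
   support of the variation (if M is compact, K = M is allowed). *)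
Definition euler_lagrange_C (Phi : tensor_field M 4) (g : matrix_field M)
    (lambda : R) (C : tensor_field M 3) : Prop :=
  forall (c : tensor_field M 3) (K : set M),
    is_form c -> compact K ->
    (forall i p a, chart_dom i p -> ~ K p -> c i p a = 0) ->
    is_derive (0 : R) (1 : R)
      (fun t : R =>
         cayley_action Phi g lambda K (fun i p a => C i p a + t * c i p a))
      (0 : R).

End Action.

(* Main.v *)
(* The Lagrangian is quadratic in C, so the derivative of the action at C in the
   direction c is the integral of Phi /\ (dc - 12 C.c), where
   (C.c)_{abcd} = C_{[ab|p|} c_{cd]}^p.  Write Phi /\ dc = d(Phi /\ c) - dPhi /\ c
   and insert nabla_i Phi_{abcd} = 4 T_{i[a}^p Phi_{|p|bcd]}: because the forms have
   top degree and T is totally antisymmetric, hence traceless,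
   dPhi /\ c = -12 Phi /\ T.c.  So Phi /\ (dc - 12 T.c) is exact and integrates to 0
   by Stokes' theorem (through a partition of unity and the translation invariance
   of the integral in a chart), and the derivative is -12 times the integral of
   Phi /\ (C - T).c.  The pointwise bilinear form Phi /\ E.c is non-degenerate, by
   an explicit computation with the model form Phi0, so testing with forms c
   supported near a point gives C = T. *)
From HB Require Import structures.
From mathcomp Require Import all_boot all_order all_algebra all_fingroup.
From mathcomp Require Import all_classical all_reals all_analysis.
From mathcomp Require Import measurable_realfun.
From mathcomp Require Import ring lra.
Require Import Defs.

Set Implicit Arguments.
Unset Strict Implicit.
Unset Printing Implicit Defensive.

Import Order.TTheory GRing.Theory Num.Theory.
Import numFieldNormedType.Exports.

Local Open Scope classical_set_scope.
Local Open Scope ring_scope.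

(** * Sums over the components of a top-degree form *)

(** Every 8-form is handled through one scalar, the alternating sum of its components in a chart.
    Divided by the same sum for Phi /\ Phi it becomes a function on [M], because both acquire the
    determinant of the Jacobian, whatever its sign. In a chart Phi /\ Phi is locally a constant
    times sqrt (det g), so these functions integrate against [mu] as Lebesgue integrals. The measure
    is known only through integrals of nonnegative Borel functions over chart domains. Its
    finiteness on compact sets and positivity on open sets are extracted by testing with tent
    functions. In a chart, Stokes' theorem says that the integral of a translate is constant, and
    this constant is differentiated under the integral sign. The passage from dPhi to T.c is the
    infinitesimal form of the determinant law: a traceless matrix acting on all slots in turn gives
    zero. The 4 in the torsion equation is absorbed by the four slots of Phi, the three slots of c
    leave a 3, and the four terms of dc turn it into 12. Further constants: 576 = 4! 4! for the
    wedge of two 4-forms, and 14 from the volume form. *)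

Section TopSum.
Variable R : realType.
Implicit Types F G : tensor R 8.

(** This is 8! F_{[0 1 ... 7]}, the contraction of [F] with the Levi-Civita symbol. [F] may be any
    function of eight indices, so products of components enter without prior antisymmetrisation. *)
Definition top_sum F : R := \sum_(s : 'S_8) (-1) ^+ s * F [tuple s m | m < 8].

(** The Levi-Civita symbol, zero on tuples with a repeated index. Written as a determinant, it can
    be combined with other determinants by multiplicativity. *)
Definition top_sign (a : 8.-tuple 'I_8) : R :=
  \det (\matrix_(m < 8, n < 8) (tnth a m == n)%:R).

Lemma eq_top_sum F G : F =1 G -> top_sum F = top_sum G.
Proof. by move=> FG; apply: eq_bigr => s _; rewrite FG. Qed.

Lemma top_sumD F G : top_sum (fun a => F a + G a) = top_sum F + top_sum G.
Proof. by rewrite -big_split; apply: eq_bigr => s _; rewrite mulrDr. Qed.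

Lemma top_sumZ k F : top_sum (fun a => k * F a) = k * top_sum F.
Proof. by rewrite mulr_sumr; apply: eq_bigr => s _; rewrite mulrCA. Qed.

Lemma top_sum_sum (I : Type) (r : seq I) (P : pred I) (F : I -> tensor R 8) :
  top_sum (fun a => \sum_(i <- r | P i) F i a) =
  \sum_(i <- r | P i) top_sum (F i).
Proof.
rewrite exchange_big /=; apply: eq_bigr => s _.
by rewrite mulr_sumr.
Qed.

Lemma sum_tuple_delta (k : nat) (f : 'I_k -> 'I_8) (F : tensor R k) :
  \sum_(a : k.-tuple 'I_8) (\prod_(m < k) (tnth a m == f m)%:R) * F a =
  F [tuple f m | m < k].
Proof.
rewrite (bigD1 [tuple f m | m < k]) //= [X in _ + X]big1 => [|a].
  by rewrite addr0 big1 ?mul1r // => m _; rewrite tnth_mktuple eqxx.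
apply: contraNeq; rewrite mulf_eq0 negb_or => /andP[/prodf_neq0 P0 _].
apply/eqP/eq_from_tnth => m; rewrite tnth_mktuple; apply/eqP.
by have := P0 m isT; case: (_ == f m) => //; rewrite mulr0n eqxx.
Qed.

(** Passage from permutations to arbitrary tuples: pullbacks and substitutions produce sums over all
    tuples, where repeated indices get weight zero. *)
Lemma top_sumE F : top_sum F = \sum_a top_sign a * F a.
Proof.
transitivity (\sum_(s : 'S_8) \sum_(a : 8.-tuple 'I_8)
    (-1) ^+ s * ((\prod_(m < 8) (tnth a m == s m)%:R) * F a)).
  apply: eq_bigr => s _; rewrite -mulr_sumr; congr (_ * _).
  by rewrite sum_tuple_delta.
rewrite exchange_big /=; apply: eq_bigr => a _.
rewrite /top_sign /determinant mulr_suml. 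
apply: eq_bigr => s _; rewrite mulrA; congr (_ * _ * _).
by apply: eq_bigr => m _; rewrite mxE.
Qed.

Lemma top_sum_pullback (A : 'M[R]_8) F :
  top_sum (pullback A F) = \det A * top_sum F.
Proof.
rewrite [in RHS]top_sumE mulr_sumr.
transitivity (\sum_(b : 8.-tuple 'I_8) \sum_(s : 'S_8)
   (-1) ^+ s * ((\prod_(m < 8) A (tnth b m) (s m)) * F b)).
  rewrite exchange_big /=; apply: eq_bigr => s _.
  rewrite -mulr_sumr; congr (_ * _); apply: eq_bigr => b _; congr (_ * _).
  by apply: eq_bigr => m _; rewrite tnth_mktuple.
(* For fixed [b] the sum over permutations is the determinant of the rows of [A] selected by [b],
   and that matrix is the 0/1 matrix of [b] times [A]. *)
apply: eq_bigr => b _; rewrite mulrA [_ * top_sign b]mulrC -det_mulmx.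
rewrite /determinant mulr_suml; apply: eq_bigr => s _; rewrite mulrA.
congr (_ * _ * _); apply: eq_bigr => m _.
rewrite !mxE (bigD1 (tnth b m)) //= mxE eqxx mul1r.
rewrite big1 ?addr0 // => j /negPf jb.
by rewrite mxE eq_sym jb mul0r.
Qed.

Lemma top_sum_permute (s : 'S_8) F :
  top_sum (fun a => F (permute_idx s a)) = (-1) ^+ s * top_sum F.
Proof.
rewrite /top_sum (reindex_inj (mulgI s^-1%g)) mulr_sumr /=.
apply: eq_bigr => t _; rewrite mulrA odd_permM odd_permV signr_addb.
congr (_ * F _); apply: eq_from_tnth => m.
by rewrite !tnth_mktuple permM permK.
Qed.

Lemma top_sum_swap (i j : 'I_8) F G : i != j ->
  (forall a, G a = F (permute_idx (tperm i j) a)) -> top_sum G = - top_sum F.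
Proof.
move=> ij /eq_top_sum ->; rewrite top_sum_permute odd_tperm ij.
by rewrite expr1 mulN1r.
Qed.

(** Swapping the two slots makes the sum its own negative. This is what removes the Christoffel
    symbols and the second derivatives of transition maps. *)
Lemma top_sum_sym (i j : 'I_8) F : i != j ->
  (forall a, F a = F (permute_idx (tperm i j) a)) -> top_sum F = 0.
Proof.
move=> ij /(top_sum_swap ij) /eqP.
by rewrite -addr_eq0 -mulr2n mulrn_eq0 /= => /eqP.
Qed.

Definition subst_idx k (m : 'I_k) (r : 'I_8) (a : k.-tuple 'I_8) :
    k.-tuple 'I_8 := [tuple if n == m then r else tnth a n | n < k].

(** Jacobi's formula for the derivative of det (B (1 + t X)) at t = 0. Phrased with the adjugate it
    covers singular [B], which arises from tuples with repeated indices. *)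
Lemma sum_det_row (n : nat) (B X : 'M[R]_n) :
  \sum_m \det (\matrix_(i, j) (if i == m then (B *m X) i j else B i j)) =
  \tr X * \det B.
Proof.
transitivity (\tr ((B *m X) *m \adj B)); last first.
  rewrite -mulmxA mxtrace_mulC -mulmxA mul_adj_mx mul_mx_scalar mxtraceZ.
  by rewrite mulrC.
apply: eq_bigr => m _; rewrite (expand_det_row _ m) mxE.
apply: eq_bigr => j _; rewrite !mxE eqxx; congr (_ * _).
rewrite /cofactor; congr (_ * \det _); apply/matrixP => i k; rewrite !mxE.
by rewrite eq_sym (negPf (neq_lift _ _)).
Qed.

(* The derivative at 1 of [top_sum (pullback A F) = \det A * top_sum F]. *)
Lemma top_sum_derivation (X : 'M[R]_8) F :
  \sum_(m < 8) \sum_(r < 8)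
    top_sum (fun a => X r (tnth a m) * F (subst_idx m r a)) =
  \tr X * top_sum F.
Proof.
rewrite [in RHS]top_sumE [RHS]mulr_sumr.
transitivity (\sum_(m < 8) \sum_(b : 8.-tuple 'I_8) \det (\matrix_(i, j)
    (if i == m then ((\matrix_(k, n) (tnth b k == n)%:R) *m X) i j
     else (\matrix_(k, n) (tnth b k == n)%:R : 'M[R]_8) i j)) * F b); last first.
  rewrite exchange_big /=; apply: eq_bigr => b _.
  by rewrite mulrA -mulr_suml sum_det_row.
apply: eq_bigr => m _.
transitivity (\sum_(s : 'S_8) (-1) ^+ s * \sum_(r < 8)
    (X r (s m) * F (subst_idx m r [tuple s i | i < 8]))).
  rewrite exchange_big /=; apply: eq_bigr => s _; rewrite mulr_sumr.
  by apply: eq_bigr => r _; rewrite tnth_mktuple.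
under [RHS]eq_bigr => b _ do rewrite /determinant mulr_suml.
rewrite [RHS]exchange_big /=; apply: eq_bigr => s _.
under [RHS]eq_bigr => b _ do rewrite -mulrA.
rewrite -[RHS]mulr_sumr; congr (_ * _).
transitivity (\sum_r \sum_(b : 8.-tuple 'I_8)
   (\prod_i (tnth b i == (if i == m then r else s i))%:R) * (X r (s m) * F b)).
  apply: eq_bigr => r _; rewrite (sum_tuple_delta _ (fun b => X r (s m) * F b)).
  congr (X _ _ * F _).
  by apply: eq_from_tnth => i; rewrite !tnth_mktuple.
rewrite exchange_big /=; apply: eq_bigr => b _ /=.
rewrite (bigD1 (tnth b m)) //= [X in _ + X]big1 => [|r rb]; last first.
  by rewrite (bigD1 m) //= eqxx eq_sym (negPf rb) !mul0r.
rewrite addr0 mulrA; congr (_ * _).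
rewrite (bigD1 m) //= [in RHS](bigD1 m) //= !mxE !eqxx mul1r mulrC.
congr (_ * _).
  rewrite (bigD1 (tnth b m)) //= mxE eqxx mul1r big1 ?addr0 // => j jb.
  by rewrite mxE eq_sym (negPf jb) mul0r.
by apply: eq_bigr => i im; rewrite !mxE (negPf im).
Qed.

Definition first4 (a : 8.-tuple 'I_8) : 4.-tuple 'I_8 :=
  [tuple tnth a (lshift 4 m) | m < 4].
Definition last4 (a : 8.-tuple 'I_8) : 4.-tuple 'I_8 :=
  [tuple tnth a (rshift 4 m) | m < 4].

Lemma alt_top n (F : tensor R n) a :
  alt F a = n`!%:R^-1 * \sum_(s : 'S_n) (-1) ^+ s * F (permute_idx s a).
Proof. by []. Qed.

(** The binomial coefficient 70 divided by 8! leaves 1/(4! 4!) = 1/576. *)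
Lemma wedge_top (u v : tensor R 4) :
  wedge u v top_idx =
  576^-1 * top_sum (fun a => u (first4 a) * v (last4 a)).
Proof.
rewrite /wedge [alt _ _]alt_top mulrA; congr (_ * _).
  have -> : 'C(4 + 4, 4) = 70%N by [].
  have -> : ((4 + 4)%N`! = 70 * 576)%N by [].
  by rewrite natrM invfM mulrA divff ?mul1r // pnatr_eq0.
apply: eq_bigr => s _; congr (_ * _); congr (u _ * v _);
 by apply: eq_from_tnth => m; rewrite !tnth_mktuple.
Qed.

(** Embeds ['S_4] into ['S_8] as the permutations fixing 0, ..., 3: each [lift0_perm] puts one more
    fixed point in front and keeps the parity. *)
Let lift0_4 (s : 'S_4) : 'S_8 :=
  lift0_perm (lift0_perm (lift0_perm (lift0_perm s))).

Let lift0_4_odd s : odd_perm (lift0_4 s) = odd_perm s.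
Proof. by rewrite /lift0_4 !odd_lift_perm. Qed.

Let lift0_4_first s (a : 8.-tuple 'I_8) :
  first4 (permute_idx (lift0_4 s) a) = first4 a.
Proof.
apply: eq_from_tnth => m; rewrite !tnth_mktuple; congr tnth.
case: m => -[|[|[|[|//]]]] mlt; rewrite /lift0_4 /lift0_perm.
- have -> : (lshift 4 (Ordinal mlt) : 'I_8) = ord0 :> 'I_8 by exact: val_inj.
  by rewrite ?lift_perm_lift ?lift_perm_id.
- have -> : (lshift 4 (Ordinal mlt) : 'I_8) = lift ord0 ord0 :> 'I_8 by exact: val_inj.
  by rewrite ?lift_perm_lift ?lift_perm_id.
- have -> : (lshift 4 (Ordinal mlt) : 'I_8) = lift ord0 (lift ord0 ord0) :> 'I_8 by exact: val_inj.
  by rewrite ?lift_perm_lift ?lift_perm_id.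
- have -> : (lshift 4 (Ordinal mlt) : 'I_8) =
      lift ord0 (lift ord0 (lift ord0 ord0)) :> 'I_8
    by exact: val_inj.
  by rewrite ?lift_perm_lift ?lift_perm_id.
Qed.

Let lift0_4_last s (a : 8.-tuple 'I_8) :
  last4 (permute_idx (lift0_4 s) a) = permute_idx s (last4 a).
Proof.
apply: eq_from_tnth => m; rewrite !tnth_mktuple; congr tnth.
have E (k : 'I_4) : rshift 4 k = lift ord0 (lift ord0 (lift ord0 (lift ord0 k))).
  exact: val_inj.
by rewrite !E /lift0_4 !lift_perm_lift.
Qed.

(** The other copy of ['S_4] in ['S_8]: fixed points are appended at the end, so that the first four
    slots are permuted. *)
Let liftm_4 (s : 'S_4) : 'S_8 := lift_perm ord_max ord_max
  (lift_perm ord_max ord_max (lift_perm ord_max ord_max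
  (lift_perm ord_max ord_max s))).

Let liftm_4_odd s : odd_perm (liftm_4 s) = odd_perm s.
Proof. by rewrite /liftm_4 !odd_lift_perm. Qed.

Let lift_max_val n (k : 'I_n) : lift ord_max k = k :> nat.
Proof. by rewrite /= /bump leqNgt ltn_ord. Qed.

Let liftm_4_first s (a : 8.-tuple 'I_8) :
  first4 (permute_idx (liftm_4 s) a) = permute_idx s (first4 a).
Proof.
apply: eq_from_tnth => m; rewrite !tnth_mktuple; congr tnth.
have E (k : 'I_4) : lshift 4 k =
    lift ord_max (lift ord_max (lift ord_max (lift ord_max k))).
  by apply: val_inj; rewrite [RHS]lift_max_val; do 3 rewrite lift_max_val.
by rewrite !E /liftm_4 !lift_perm_lift.
Qed.

Let liftm_4_last s (a : 8.-tuple 'I_8) :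
  last4 (permute_idx (liftm_4 s) a) = last4 a.
Proof.
apply: eq_from_tnth => m; rewrite !tnth_mktuple; congr tnth.
case: m => -[|[|[|[|//]]]] mlt; rewrite /liftm_4.
- have -> : (rshift 4 (Ordinal mlt) : 'I_8) =
      lift ord_max (lift ord_max (lift ord_max ord_max)) :> 'I_8
    by exact: val_inj.
  by rewrite ?lift_perm_lift ?lift_perm_id.
- have -> : (rshift 4 (Ordinal mlt) : 'I_8) =
      lift ord_max (lift ord_max ord_max) :> 'I_8
    by exact: val_inj.
  by rewrite ?lift_perm_lift ?lift_perm_id.
- have -> : (rshift 4 (Ordinal mlt) : 'I_8) = lift ord_max ord_max :> 'I_8 by exact: val_inj.
  by rewrite ?lift_perm_lift ?lift_perm_id.
- have -> : (rshift 4 (Ordinal mlt) : 'I_8) = ord_max :> 'I_8 by exact: val_inj.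
  by rewrite ?lift_perm_lift ?lift_perm_id.
Qed.

(** Each of the 24 permutations of the last four slots contributes the same value, since its sign
    appears twice: once in [alt] and once from reordering [top_sum]. *)
Lemma top_sum_alt_last (u v : tensor R 4) :
  top_sum (fun a => u (first4 a) * alt v (last4 a)) =
  top_sum (fun a => u (first4 a) * v (last4 a)).
Proof.
pose F a := u (first4 a) * v (last4 a).
transitivity (top_sum (fun a => 4`!%:R^-1 * \sum_(s : 'S_4)
    (-1) ^+ s * F (permute_idx (lift0_4 s) a))).
  apply: eq_top_sum => a; rewrite /alt mulrCA; congr (_ * _).
  rewrite mulr_sumr; apply: eq_bigr => s _.
  by rewrite /F lift0_4_first lift0_4_last mulrCA.
rewrite top_sumZ top_sum_sum.
rewrite (eq_bigr (fun=> top_sum F)) => [|s _]; last first.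
  rewrite top_sumZ (top_sum_permute (lift0_4 s) F) lift0_4_odd.
  by rewrite mulrA -signr_addb addbb mul1r.
by rewrite sumr_const card_Sn -(mulr_natl (top_sum F)) mulrA mulVf ?mul1r.
Qed.

(** Here [u] may depend on the last four indices, which the permutations fix. This leaves room for
    the index of a derivative of the first factor. *)
Lemma top_sum_alt_first (u : 4.-tuple 'I_8 -> tensor R 4) (v : tensor R 4) :
  top_sum (fun a => alt (u (last4 a)) (first4 a) * v (last4 a)) =
  top_sum (fun a => u (last4 a) (first4 a) * v (last4 a)).
Proof.
pose F a := u (last4 a) (first4 a) * v (last4 a).
transitivity (top_sum (fun a => 4`!%:R^-1 * \sum_(s : 'S_4)
    (-1) ^+ s * F (permute_idx (liftm_4 s) a))).
  apply: eq_top_sum => a; rewrite /alt -mulrA; congr (_ * _).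
  rewrite mulr_suml; apply: eq_bigr => s _.
  by rewrite /F liftm_4_first liftm_4_last mulrA.
rewrite top_sumZ top_sum_sum.
rewrite (eq_bigr (fun=> top_sum F)) => [|s _]; last first.
  rewrite top_sumZ (top_sum_permute (liftm_4 s) F) liftm_4_odd.
  by rewrite mulrA -signr_addb addbb mul1r.
by rewrite sumr_const card_Sn -(mulr_natl (top_sum F)) mulrA mulVf ?mul1r.
Qed.

End TopSum.

(** * Contraction of two 3-forms, and the identity for traceless families *)

Section Contraction.
Variable R : realType.

(** The tensor underlying C.c before antisymmetrisation; for [G] the inverse metric and equal
    arguments, [alt] of it is [wedge_Phi]. *)
Definition contract (G : 'M[R]_8) (u v : tensor R 3) : tensor R 4 :=
  fun a => \sum_(r < 8) \sum_(q < 8)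
    u [tuple a`_0; a`_1; r] * v [tuple a`_2; a`_3; q] * G r q.

(** Slots are addressed by numerals, so that for concrete transpositions the conditionals compute
    away. *)
Lemma nth_permute_tperm k (i j : 'I_k) (a : k.-tuple 'I_8) (m : nat) :
  (m < k)%N -> (permute_idx (tperm i j) a)`_m =
  a`_(if m == i :> nat then (j : nat) else if m == j :> nat then (i : nat) else m).
Proof.
move=> mk; rewrite -[m in LHS]/(nat_of_ord (Ordinal mk)) -tnth_nth tnth_mktuple.
rewrite (tnth_nth 0) permE /= -(inj_eq val_inj) -[_ == j](inj_eq val_inj) /=.
by case: ifP => // _; case: ifP.
Qed.

Lemma tuple4E (a : 4.-tuple 'I_8) : a = [tuple a`_0; a`_1; a`_2; a`_3].
Proof.
by case: a => -[|x [|y [|z [|t [|? ?]]]]] //= i; apply: val_inj.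
Qed.

Lemma tuple3E (a : 3.-tuple 'I_8) : a = [tuple a`_0; a`_1; a`_2].
Proof. by case: a => -[|x [|y [|z [|? ?]]]] //= i; apply: val_inj. Qed.

Lemma nth_first4 (a : 8.-tuple 'I_8) k : (k < 4)%N -> (first4 a)`_k = a`_k.
Proof.
move=> k4; rewrite -[k in LHS]/(nat_of_ord (Ordinal k4)) -tnth_nth tnth_mktuple.
by rewrite (tnth_nth 0).
Qed.

Lemma nth_last4 (a : 8.-tuple 'I_8) k :
  (k < 4)%N -> (last4 a)`_k = a`_(4 + k)%N.
Proof.
move=> k4; rewrite -[k in LHS]/(nat_of_ord (Ordinal k4)) -tnth_nth tnth_mktuple.
by rewrite (tnth_nth 0).
Qed.

Lemma first4E (a : 8.-tuple 'I_8) : first4 a = [tuple a`_0; a`_1; a`_2; a`_3].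
Proof. by rewrite [LHS]tuple4E !nth_first4. Qed.

Lemma last4E (a : 8.-tuple 'I_8) : last4 a = [tuple a`_4; a`_5; a`_6; a`_7].
Proof. by rewrite [LHS]tuple4E !nth_last4. Qed.

Lemma nth_subst_idx k (m : 'I_k) r (a : k.-tuple 'I_8) (n : nat) :
  (n < k)%N -> (subst_idx m r a)`_n = if n == m then r else a`_n.
Proof.
move=> nk; rewrite -[n in LHS]/(nat_of_ord (Ordinal nk)) -tnth_nth tnth_mktuple.
by rewrite -(inj_eq val_inj) (tnth_nth 0).
Qed.

Lemma alternating_swap k (t : tensor R k) (i j : 'I_k) a : i != j ->
  alternating t -> t (permute_idx (tperm i j) a) = - t a.
Proof. by move=> ij ->; rewrite odd_tperm ij expr1 mulN1r. Qed.

Lemma alternating3_021 (t : tensor R 3) x y z : alternating t ->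
  t [tuple x; z; y] = - t [tuple x; y; z].
Proof.
move=> /(alternating_swap [tuple x; y; z]
  (isT : Ordinal (isT : 1 < 3)%N != Ordinal (isT : 2 < 3)%N)) <-.
by congr t; rewrite [RHS]tuple3E !nth_permute_tperm.
Qed.

Lemma alternating3_102 (t : tensor R 3) x y z : alternating t ->
  t [tuple y; x; z] = - t [tuple x; y; z].
Proof.
move=> /(alternating_swap [tuple x; y; z]
  (isT : Ordinal (isT : 0 < 3)%N != Ordinal (isT : 1 < 3)%N)) <-.
by congr t; rewrite [RHS]tuple3E !nth_permute_tperm.
Qed.

Lemma antisym_sym_trace (S G : 'I_8 -> 'I_8 -> R) :
  (forall i j, S i j = - S j i) -> (forall i j, G i j = G j i) ->
  \sum_i \sum_j S i j * G i j = 0.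
Proof.
move=> AS SG; set x := (LHS).
have : x = - x.
  rewrite {1}/x exchange_big /x -sumrN; apply: eq_bigr => i _.
  by rewrite -sumrN; apply: eq_bigr => j _; rewrite AS SG mulNr.
by move/eqP; rewrite -addr_eq0 -mulr2n mulrn_eq0 /= => /eqP.
Qed.

(* The Schouten-type identity "T^p /\ (e_p _| w) = 0" for a traceless family
   T_b and w = Phi /\ c. *)
Lemma top_sum_traceless (X : 'I_8 -> 'M[R]_8) (F : tensor R 8) :
  (forall b, \tr (X b) = 0) -> (forall a, \sum_b X b b a = 0) ->
  (forall r a, F (subst_idx (Ordinal (isT : 4 < 8)%N) r a) = F a) ->
  \sum_(m < 8 | (m != 4 :> nat)%N) \sum_(r < 8)
    top_sum (fun a => X a`_4 r (tnth a m) * F (subst_idx m r a)) = 0.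
Proof.
move=> X0 X0' F4; set m4 := Ordinal (isT : 4 < 8)%N.
(* The derivation identity concerns a fixed matrix, while here the matrix depends on the index in
   slot 4. [Fb b] freezes that index at [b]; summing over [b] restores it. *)
pose Fb b : tensor R 8 := fun a => (a`_4 == b)%:R * F a.
have D b : \sum_(m < 8) \sum_(r < 8)
    top_sum (fun a => X b r (tnth a m) * Fb b (subst_idx m r a)) = 0.
  by rewrite top_sum_derivation X0 mul0r.
have : \sum_b \sum_(m < 8) \sum_(r < 8)
    top_sum (fun a => X b r (tnth a m) * Fb b (subst_idx m r a)) = 0.
  by apply: big1 => b _; exact: D.
rewrite exchange_big /= (bigD1 m4) //= => /eqP.
rewrite [X in X + _ == _](_ : _ = 0) ?add0r => [/eqP S0|].
  rewrite -[RHS]S0; apply: eq_big => [m|m m4'].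
    by rewrite -(inj_eq val_inj).
  rewrite [RHS]exchange_big /=; apply: eq_bigr => r _; rewrite -top_sum_sum.
  apply: eq_top_sum => a; rewrite (bigD1 a`_4) //= big1 => [|b ba].
    by rewrite addr0 /Fb nth_subst_idx // [4%N == _]eq_sym (negPf m4') eqxx mul1r.
  by rewrite /Fb nth_subst_idx // [4%N == _]eq_sym (negPf m4')
    [a`_4 == b]eq_sym (negPf ba) mul0r mulr0.
transitivity (top_sum (fun a => (\sum_b X b b (tnth a m4)) * F a)).
  transitivity (\sum_b top_sum (fun a => X b b (tnth a m4) * F a)).
    apply: eq_bigr => b _; rewrite (bigD1 b) //= [X in _ + X]big1 => [|r rb].
      rewrite addr0; apply: eq_top_sum => a.
      by rewrite /Fb nth_subst_idx //= eqxx mul1r F4.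
    rewrite /top_sum big1 // => s _.
    by rewrite /Fb nth_subst_idx //= (negPf rb) mul0r !mulr0.
  by rewrite -top_sum_sum; apply: eq_top_sum => a; rewrite mulr_suml.
by rewrite /top_sum big1 // => s _; rewrite X0' mul0r mulr0.
Qed.

End Contraction.

(** * The torsion identity for dPhi /\ c *)

Section TorsionIdentity.
Variable R : realType.

Let sum_ord8 (F : 'I_8 -> R) : \sum_(m < 8 | (m != 4 :> nat)%N) F m =
  F (Ordinal (isT : 0 < 8)%N) + F (Ordinal (isT : 1 < 8)%N) +
  F (Ordinal (isT : 2 < 8)%N) + F (Ordinal (isT : 3 < 8)%N) +
  F (Ordinal (isT : 5 < 8)%N) + F (Ordinal (isT : 6 < 8)%N) +
  F (Ordinal (isT : 7 < 8)%N).
Proof.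
rewrite big_mkcond !big_ord_recl big_ord0 /= addr0 add0r !addrA.
by congr (F _ + F _ + F _ + F _ + F _ + F _ + F _); exact: val_inj.
Qed.

(** [Phi] occupies slots 0 to 3 and [c] slots 5 to 7. By antisymmetry the four slots of [Phi]
    contribute equally to the traceless identity, and so do the three slots of [c]: what is left is
    4 Y + 3 Z = 0. *)
Lemma top_sum_traceless_product (X : 'I_8 -> 'M[R]_8)
    (Phi : tensor R 4) (c : tensor R 3) :
  alternating Phi -> alternating c ->
  (forall b, \tr (X b) = 0) -> (forall a, \sum_b X b b a = 0) ->
  4 * top_sum (fun a => \sum_r X a`_4 r a`_0 *
        (Phi [tuple r; a`_1; a`_2; a`_3] * c [tuple a`_5; a`_6; a`_7])) =
  - 3 * top_sum (fun a => \sum_r X a`_4 r a`_5 *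
        (Phi (first4 a) * c [tuple r; a`_6; a`_7])).
Proof.
move=> aPhi ac X0 X0'.
pose F : tensor R 8 := fun a => Phi (first4 a) * c [tuple a`_5; a`_6; a`_7].
have F4 r a : F (subst_idx (Ordinal (isT : 4 < 8)%N) r a) = F a.
  by rewrite /F !first4E !nth_subst_idx.
have := top_sum_traceless X0 X0' F4; rewrite sum_ord8.
set Y := top_sum (fun a => \sum_r X a`_4 r a`_0 * _).
set Z := top_sum (fun a => \sum_r X a`_4 r a`_5 * _).
have E (m : 'I_8) : \sum_(r < 8)
    top_sum (fun a => X a`_4 r (tnth a m) * F (subst_idx m r a)) =
    top_sum (fun a => \sum_r X a`_4 r a`_m * F (subst_idx m r a)).
  rewrite -top_sum_sum; apply: eq_top_sum => a; apply: eq_bigr => r _.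
  by rewrite (tnth_nth 0).
rewrite !E.
have Y0 : top_sum (fun a => \sum_r X a`_4 r a`_(Ordinal (isT : 0 < 8)%N) *
    F (subst_idx (Ordinal (isT : 0 < 8)%N) r a)) = Y.
  apply: eq_top_sum => a; apply: eq_bigr => r _; congr (_ * _).
  by rewrite /F first4E !nth_subst_idx.
have Z5 : top_sum (fun a => \sum_r X a`_4 r a`_(Ordinal (isT : 5 < 8)%N) *
    F (subst_idx (Ordinal (isT : 5 < 8)%N) r a)) = Z.
  apply: eq_top_sum => a; apply: eq_bigr => r _; congr (_ * _).
  by rewrite /F !first4E !nth_subst_idx.
(* Under the transposition of slots [i] and [j] the sign from [top_sum] cancels the sign from [Phi]
   or [c], so both slots give the same value. *)
have swapE (i j : 'I_8) (W : R) (P : 'I_8 -> tensor R 8) : i != j ->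
    i != 4 :> nat -> j != 4 :> nat ->
    W = top_sum (fun a => \sum_r X a`_4 r a`_i * F (subst_idx i r a)) ->
    (forall r a, F (subst_idx j r (permute_idx (tperm i j) a)) =
                 - F (subst_idx i r a)) ->
    top_sum (fun a => \sum_r X a`_4 r a`_j * F (subst_idx j r a)) = W.
  move=> ij i4 j4 -> FF; apply: oppr_inj; rewrite -[LHS](top_sum_swap ij (G :=
    fun a => - \sum_r X a`_4 r a`_i * F (subst_idx i r a))).
    by rewrite -mulN1r -top_sumZ; apply: eq_top_sum => a; rewrite mulN1r.
  move=> a; rewrite -sumrN; apply: eq_bigr => r _; rewrite -mulrN -FF.
  rewrite !nth_permute_tperm // eqxx [4%N == _]eq_sym (negPf i4).
  rewrite [4%N == _]eq_sym (negPf j4) [_ == nat_of_ord i]eq_sym.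
  by rewrite (inj_eq val_inj) (negPf ij).
have Y1 : top_sum (fun a => \sum_r X a`_4 r a`_(Ordinal (isT : 1 < 8)%N) *
    F (subst_idx (Ordinal (isT : 1 < 8)%N) r a)) = Y.
  apply: (swapE (Ordinal (isT : 0 < 8)%N)) => // r a.
  rewrite /F !first4E !nth_subst_idx //= !nth_permute_tperm //= -mulNr.
  congr (_ * _).
  rewrite -(alternating_swap [tuple r; a`_1; a`_2; a`_3]
    (isT : Ordinal (isT : 0 < 4)%N != Ordinal (isT : 1 < 4)%N) aPhi).
  by congr Phi; rewrite [RHS]tuple4E !nth_permute_tperm.
have Y2 : top_sum (fun a => \sum_r X a`_4 r a`_(Ordinal (isT : 2 < 8)%N) *
    F (subst_idx (Ordinal (isT : 2 < 8)%N) r a)) = Y.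
  apply: (swapE (Ordinal (isT : 0 < 8)%N)) => // r a.
  rewrite /F !first4E !nth_subst_idx //= !nth_permute_tperm //= -mulNr.
  congr (_ * _).
  rewrite -(alternating_swap [tuple r; a`_1; a`_2; a`_3]
    (isT : Ordinal (isT : 0 < 4)%N != Ordinal (isT : 2 < 4)%N) aPhi).
  by congr Phi; rewrite [RHS]tuple4E !nth_permute_tperm.
have Y3 : top_sum (fun a => \sum_r X a`_4 r a`_(Ordinal (isT : 3 < 8)%N) *
    F (subst_idx (Ordinal (isT : 3 < 8)%N) r a)) = Y.
  apply: (swapE (Ordinal (isT : 0 < 8)%N)) => // r a.
  rewrite /F !first4E !nth_subst_idx //= !nth_permute_tperm //= -mulNr.
  congr (_ * _).
  rewrite -(alternating_swap [tuple r; a`_1; a`_2; a`_3]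
    (isT : Ordinal (isT : 0 < 4)%N != Ordinal (isT : 3 < 4)%N) aPhi).
  by congr Phi; rewrite [RHS]tuple4E !nth_permute_tperm.
have Z6 : top_sum (fun a => \sum_r X a`_4 r a`_(Ordinal (isT : 6 < 8)%N) *
    F (subst_idx (Ordinal (isT : 6 < 8)%N) r a)) = Z.
  apply: (swapE (Ordinal (isT : 5 < 8)%N)) => // r a.
  rewrite /F !first4E !nth_subst_idx //= !nth_permute_tperm //= -mulrN.
  by congr (_ * _); rewrite alternating3_102.
have Z7 : top_sum (fun a => \sum_r X a`_4 r a`_(Ordinal (isT : 7 < 8)%N) *
    F (subst_idx (Ordinal (isT : 7 < 8)%N) r a)) = Z.
  apply: (swapE (Ordinal (isT : 5 < 8)%N)) => // r a.
  rewrite /F !first4E !nth_subst_idx //= !nth_permute_tperm //= -mulrN.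
  congr (_ * _).
  by rewrite alternating3_102 // alternating3_021 // alternating3_102 // opprK.
rewrite Y0 Y1 Y2 Y3 Z5 Z6 Z7; lra.
Qed.

(** The torsion equation at one point, with [dPhi] for the coordinate derivatives and [Gam] for the
    Christoffel symbols. Its factor 4 matches the 4 Y of the previous identity, whence the
    coefficient - 3. *)
Lemma top_sum_torsion (Phi : tensor R 4) (dPhi : 'I_8 -> tensor R 4)
    (T c : tensor R 3) (G : 'M[R]_8) (Gam : 'I_8 -> 'I_8 -> 'I_8 -> R) :
  alternating Phi -> alternating T -> alternating c ->
  (forall i j, G i j = G j i) -> (forall e i j, Gam e i j = Gam e j i) ->
  (forall b a, dPhi b a - \sum_(m < 4) \sum_(e < 8)
      Gam e b (tnth a m) * Phi [tuple if n == m then e else tnth a n | n < 4] =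
    4 * alt (fun c : 4.-tuple 'I_8 => \sum_(r < 8) \sum_(q < 8)
      T [tuple b; c`_0; q] * G q r * Phi [tuple r; c`_1; c`_2; c`_3]) a) ->
  top_sum (fun a => dPhi a`_4 (first4 a) * c [tuple a`_5; a`_6; a`_7]) =
  - 3 * top_sum (fun a => Phi (first4 a) * contract G T c (last4 a)).
Proof.
move=> aPhi aT ac sG sGam nPhi.
pose X b : 'M[R]_8 := \matrix_(r, a) \sum_q T [tuple b; a; q] * G q r.
pose u b : tensor R 4 := fun d => \sum_r X b r d`_0 * Phi [tuple r; d`_1; d`_2; d`_3].
pose w : tensor R 4 := fun l => c [tuple l`_1; l`_2; l`_3].
transitivity (4 * top_sum (fun a => alt (u (last4 a)`_0) (first4 a) * w (last4 a))).
  pose H (m : 'I_4) (e : 'I_8) : tensor R 8 := fun a =>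
    Gam e a`_4 (tnth (first4 a) m) * Phi (subst_idx m e (first4 a)) *
    c [tuple a`_5; a`_6; a`_7].
  transitivity (4 * top_sum (fun a => alt (u (last4 a)`_0) (first4 a) * w (last4 a))
     + top_sum (fun a => \sum_(m < 4) \sum_(e < 8) H m e a)).
    rewrite -top_sumZ -top_sumD; apply: eq_top_sum => a.
    have := nPhi a`_4 (first4 a) => /eqP; rewrite subr_eq => /eqP ->.
    rewrite mulrDl mulrA; congr (_ * _ + _).
    - rewrite nth_last4 //; congr (_ * (_ * _)); apply: eq_bigr => s _ /=.
      congr (_ * _); apply: eq_bigr => r _; rewrite mxE mulr_suml.
      by apply: eq_bigr.
    - by rewrite /w !nth_last4.
    - rewrite mulr_suml; apply: eq_bigr => m _; rewrite mulr_suml.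
      by apply: eq_bigr.
  rewrite [X in _ + X](_ : _ = 0) ?addr0 // top_sum_sum big1 // => m _.
  rewrite top_sum_sum big1 // => e _.
  have m4 : lshift 4 m != Ordinal (isT : 4 < 8)%N.
    by rewrite -(inj_eq val_inj) /= neq_ltn ltn_ord.
  (* The lower indices of the Christoffel symbol sit in slots [m] and 4, in which it is
     symmetric. *)
  apply: (top_sum_sym m4) => a; rewrite /H.
  have nm4 : (4 == m :> nat)%N = false.
    by apply/eqP => m4'; have := ltn_ord m; rewrite -m4'.
  rewrite !nth_permute_tperm //= nm4 (_ : 5 == m = false)%N; last first.
    by apply/eqP => m5; have := ltn_ord m; rewrite -m5.
  rewrite (_ : 6 == m = false)%N; last first.
    by apply/eqP => m5; have := ltn_ord m; rewrite -m5.
  rewrite (_ : 7 == m = false)%N; last first.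
    by apply/eqP => m5; have := ltn_ord m; rewrite -m5.
  congr (_ * _ * _).
    rewrite sGam; congr Gam; rewrite !(tnth_nth 0) !nth_first4 //.
    by rewrite nth_permute_tperm ?eqxx // (leq_trans (ltn_ord m)).
  congr Phi; apply: eq_from_tnth => n; rewrite !tnth_mktuple.
  case: (eqVneq n m) => // nm; congr tnth.
  rewrite tpermD // -(inj_eq val_inj) /= eq_sym //.
    by rewrite neq_ltn ltn_ord.
rewrite (top_sum_alt_first (fun l => u l`_0)).
transitivity (4 * top_sum (fun a => \sum_r X a`_4 r a`_0 *
        (Phi [tuple r; a`_1; a`_2; a`_3] * c [tuple a`_5; a`_6; a`_7]))).
  congr (4 * _); apply: eq_top_sum => a; rewrite !nth_last4 // /u /w mulr_suml.
  by apply: eq_bigr => r _; rewrite !nth_first4 // mulrA !nth_last4.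
(* Both traces contract two antisymmetric indices of [T] with the symmetric [G]. *)
rewrite top_sum_traceless_product //; last 2 first.
- move=> b; rewrite /mxtrace.
  transitivity (\sum_r \sum_q T [tuple b; r; q] * G q r).
    by apply: eq_bigr => r _; rewrite mxE.
  apply: (antisym_sym_trace (S := fun r q => T [tuple b; r; q])
    (G := fun r q => G q r)) => // i j.
  exact: alternating3_021.
- move=> a; transitivity (\sum_b \sum_q T [tuple b; a; q] * G q b).
    by apply: eq_bigr => r _; rewrite mxE.
  apply: (antisym_sym_trace (S := fun r q => T [tuple r; a; q])
    (G := fun r q => G q r)) => // i j.
  by rewrite alternating3_102 // alternating3_021 // alternating3_102 // opprK.
congr (_ * _); apply: eq_top_sum => a; rewrite /contract.
under [in RHS]eq_bigr => r _ do under eq_bigr => q _ do rewrite !nth_last4 //.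
rewrite exchange_big /= mulr_sumr; apply: eq_bigr => r _.
rewrite mxE mulrCA; congr (_ * _); rewrite mulr_suml; apply: eq_bigr => q _.
rewrite mulrAC; congr (_ * _ * _).
(* The contracted index of [c] moves from the first place to the last, an even permutation. *)
by rewrite alternating3_102 // alternating3_021 // opprK.
Qed.

End TorsionIdentity.

(** * Naturality of contraction and exterior derivative under pullback *)

Section PullbackNaturality.
Variable R : realType.
Implicit Types A : 'M[R]_8.

Lemma sum_tuple_cons k (F : k.+1.-tuple 'I_8 -> R) :
  \sum_a F a = \sum_(x < 8) \sum_(b : k.-tuple 'I_8) F [tuple of x :: b].
Proof.
rewrite pair_big /=.
rewrite (reindex (fun p : 'I_8 * k.-tuple 'I_8 => [tuple of p.1 :: p.2])) //.
exists (fun a => (thead a, [tuple of behead a])) => [[x b]|a] _ /=.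
  by congr pair; apply: val_inj.
by rewrite [RHS]tuple_eta.
Qed.

(** Peels off one index, so that explicit formulas in low degree and functoriality follow by
    recursion on the degree. *)
Lemma pullback_cons k A (t : tensor R k.+1) x (a : k.-tuple 'I_8) :
  pullback A t [tuple of x :: a] =
  \sum_(y < 8) A y x * pullback A (fun b => t [tuple of y :: b]) a.
Proof.
rewrite /pullback sum_tuple_cons; apply: eq_bigr => y _.
rewrite mulr_sumr; apply: eq_bigr => b _; rewrite mulrA; congr (_ * _).
rewrite big_ord_recl; congr (A _ _ * _); apply: eq_bigr => m _.
by rewrite !tnthS.
Qed.

Lemma pullback_nil A (t : tensor R 0) a : pullback A t a = t a.
Proof.
rewrite /pullback (bigD1 a) //= big_ord0 mul1r big1 ?addr0 // => b.
by rewrite [b]tuple0 [a]tuple0 eqxx.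
Qed.

Lemma pullback3E A (t : tensor R 3) x y z :
  pullback A t [tuple x; y; z] = \sum_(b < 8) \sum_(c < 8) \sum_(d < 8)
    A b x * A c y * A d z * t [tuple b; c; d].
Proof.
rewrite (_ : [tuple x; y; z] = [tuple of x :: [tuple of y :: [tuple of z :: [tuple]]]]);
  last exact: val_inj.
rewrite pullback_cons; apply: eq_bigr => b _.
rewrite pullback_cons mulr_sumr; apply: eq_bigr => c _.
rewrite pullback_cons !mulr_sumr; apply: eq_bigr => d _.
rewrite pullback_nil !mulrA; congr (_ * t _); exact: val_inj.
Qed.

Lemma pullback4E A (t : tensor R 4) x y z w :
  pullback A t [tuple x; y; z; w] =
  \sum_(b < 8) \sum_(c < 8) \sum_(d < 8) \sum_(e < 8)
    A b x * A c y * A d z * A e w * t [tuple b; c; d; e].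
Proof.
rewrite (_ : [tuple x; y; z; w] = [tuple of x :: [tuple of y ::
  [tuple of z :: [tuple of w :: [tuple]]]]]); last exact: val_inj.
rewrite pullback_cons; apply: eq_bigr => b _.
rewrite pullback_cons mulr_sumr; apply: eq_bigr => c _.
rewrite pullback_cons !mulr_sumr; apply: eq_bigr => d _.
rewrite pullback_cons !mulr_sumr; apply: eq_bigr => e _.
rewrite pullback_nil !mulrA; congr (_ * t _); exact: val_inj.
Qed.

Let cat8 (b c : 4.-tuple 'I_8) : 8.-tuple 'I_8 := [tuple of b ++ c].

Let first4_cat b c : first4 (cat8 b c) = b.
Proof.
apply: eq_from_tnth => m; rewrite tnth_mktuple (tnth_nth 0) /= nth_cat.
by rewrite size_tuple ltn_ord -tnth_nth.
Qed.

Let last4_cat b c : last4 (cat8 b c) = c.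
Proof.
apply: eq_from_tnth => m; rewrite tnth_mktuple (tnth_nth 0) /= nth_cat.
by rewrite size_tuple ltnNge leq_addr addKn -tnth_nth.
Qed.

Lemma sum_first4_last4 (F : 4.-tuple 'I_8 -> 4.-tuple 'I_8 -> R) :
  \sum_(a : 8.-tuple 'I_8) F (first4 a) (last4 a) = \sum_b \sum_c F b c.
Proof.
rewrite pair_big /= (reindex (fun p : 4.-tuple 'I_8 * 4.-tuple 'I_8 =>
  cat8 p.1 p.2)) /=.
  by apply: eq_bigr => -[b c] _ /=; rewrite first4_cat last4_cat.
exists (fun a => (first4 a, last4 a)) => [[b c]|a] _ /=.
  by rewrite first4_cat last4_cat.
rewrite first4E last4E; apply: val_inj.
by case: a => -[|? [|? [|? [|? [|? [|? [|? [|? [|? ?]]]]]]]]] //.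
Qed.

Lemma top_sum_pullback2 A (u v : tensor R 4) :
  top_sum (fun a => pullback A u (first4 a) * pullback A v (last4 a)) =
  \det A * top_sum (fun a => u (first4 a) * v (last4 a)).
Proof.
rewrite -top_sum_pullback; apply: eq_top_sum => a.
transitivity (\sum_b \sum_c (\prod_(m < 4) A (tnth b m) (tnth (first4 a) m) *
    \prod_(m < 4) A (tnth c m) (tnth (last4 a) m)) * (u b * v c)).
  rewrite mulr_suml; apply: eq_bigr => b _; rewrite mulr_sumr.
  by apply: eq_bigr => c _; rewrite mulrACA.
rewrite -(sum_first4_last4 (fun b c => (\prod_(m < 4) A (tnth b m) (tnth (first4 a) m) *
    \prod_(m < 4) A (tnth c m) (tnth (last4 a) m)) * (u b * v c))).
apply: eq_bigr => b _; congr (_ * _).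
rewrite -[RHS]/(\prod_(m < 4 + 4) A (tnth b m) (tnth a m)) big_split_ord /=.
by congr (_ * _); apply: eq_bigr => m _; rewrite !tnth_mktuple.
Qed.

Let exchange_big4 (F : 'I_8 -> 'I_8 -> 'I_8 -> 'I_8 -> 'I_8 -> R) :
  \sum_r \sum_b \sum_c \sum_d \sum_e F r b c d e =
  \sum_b \sum_c \sum_d \sum_e \sum_r F r b c d e.
Proof.
rewrite exchange_big; apply: eq_bigr => b _ /=.
rewrite exchange_big; apply: eq_bigr => c _ /=.
rewrite exchange_big; apply: eq_bigr => d _ /=.
by rewrite exchange_big.
Qed.

Let exchange_big3 (F : 'I_8 -> 'I_8 -> 'I_8 -> 'I_8 -> R) :
  \sum_r \sum_b \sum_c \sum_d F r b c d =
  \sum_b \sum_c \sum_d \sum_r F r b c d.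
Proof.
rewrite exchange_big; apply: eq_bigr => b _ /=.
rewrite exchange_big; apply: eq_bigr => c _ /=.
by rewrite exchange_big.
Qed.

(** [G] has upper indices and is pushed forward by [A] while forms are pulled back; the two copies
    of [A] on the contracted indices are exactly those in [A *m G *m A^T]. *)
Lemma contract_pullback A (G G' : 'M[R]_8) (u v : tensor R 3) :
  G' = A *m G *m A^T ->
  pullback A (contract G' u v) =1 contract G (pullback A u) (pullback A v).
Proof.
move=> G'E a; rewrite [a]tuple4E pullback4E /contract /=.
set a0 := a`_0; set a1 := a`_1; set a2 := a`_2; set a3 := a`_3.
(* Only the contracted index is pulled back in [w]; the two free indices keep explicit factors of
   [A] that can be moved outside. *)
pose w (t : tensor R 3) b c r := \sum_(s < 8) A s r * t [tuple b; c; s].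
have wE t x y z : pullback A t [tuple x; y; z] =
    \sum_(b < 8) \sum_(c < 8) A b x * A c y * w t b c z.
  rewrite pullback3E; apply: eq_bigr => b _; apply: eq_bigr => c _.
  by rewrite mulr_sumr; apply: eq_bigr => s _; rewrite !mulrA.
transitivity (\sum_(b < 8) \sum_(c < 8) \sum_(d < 8) \sum_(e < 8)
   \sum_(r < 8) \sum_(q < 8)
   (A b a0 * A c a1 * w u b c r) * (A d a2 * A e a3 * w v d e q) * G r q).
  apply: eq_bigr => b _; apply: eq_bigr => c _; apply: eq_bigr => d _.
  apply: eq_bigr => e _.
  transitivity (A b a0 * A c a1 * A d a2 * A e a3 *
     \sum_r \sum_q w u b c r * w v d e q * G r q).
    congr (_ * _).
    transitivity (\sum_s \sum_t \sum_r \sum_q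
        A s r * u [tuple b; c; s] * (A t q * v [tuple d; e; t]) * G r q).
      apply: eq_bigr => s _; apply: eq_bigr => t _.
      rewrite G'E mxE mulr_sumr exchange_big /=; apply: eq_bigr => q _.
      rewrite !mxE mulr_suml mulr_sumr; apply: eq_bigr => r _; ring.
    under eq_bigr => s _ do rewrite exchange_big /=.
    rewrite exchange_big /=; apply: eq_bigr => r _.
    under eq_bigr => s _ do rewrite exchange_big /=.
    rewrite exchange_big /=; apply: eq_bigr => q _.
    rewrite /w !mulr_suml; apply: eq_bigr => s _.
    by rewrite mulr_sumr mulr_suml.
  rewrite mulr_sumr; apply: eq_bigr => r _; rewrite mulr_sumr.
  by apply: eq_bigr => q _; ring.
transitivity (\sum_(r < 8) \sum_(q < 8) \sum_(b < 8) \sum_(c < 8)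
   \sum_(d < 8) \sum_(e < 8)
   (A b a0 * A c a1 * w u b c r) * (A d a2 * A e a3 * w v d e q) * G r q).
  symmetry; under eq_bigr => r _ do rewrite exchange_big4.
  by rewrite exchange_big4.
apply: eq_bigr => r _; apply: eq_bigr => q _; rewrite !wE.
rewrite [in RHS]mulr_suml [RHS]mulr_suml; apply: eq_bigr => b _.
rewrite [in RHS]mulr_suml [RHS]mulr_suml; apply: eq_bigr => c _.
rewrite [in RHS]mulr_sumr [RHS]mulr_suml; apply: eq_bigr => d _.
by rewrite [in RHS]mulr_sumr [RHS]mulr_suml.
Qed.

(** Naturality of d at one point. [A] plays the Jacobian and [H] its derivative, a second derivative
    of the transition map; [DE] is the product rule. The three terms with [H] are symmetric in slot
    4 and another slot, so they vanish in the alternating sum. *)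
Lemma top_sum_pullback_derivative A (Phi : tensor R 4) (c : tensor R 3)
    (H : 'I_8 -> 'I_8 -> 'I_8 -> R) (D D' : 'I_8 -> tensor R 3) :
  (forall b e x, H b e x = H b x e) ->
  (forall e x y z, D e [tuple x; y; z] = \sum_(b < 8) \sum_(k < 8) \sum_(d < 8)
    ((H b e x * A k y * A d z + A b x * H k e y * A d z + A b x * A k y * H d e z)
       * c [tuple b; k; d] +
     A b x * A k y * A d z * \sum_(f < 8) A f e * D' f [tuple b; k; d])) ->
  top_sum (fun a => pullback A Phi (first4 a) * D a`_4 [tuple a`_5; a`_6; a`_7]) =
  \det A * top_sum (fun a => Phi (first4 a) * D' a`_4 [tuple a`_5; a`_6; a`_7]).
Proof.
move=> sH DE.
pose X1 : tensor R 8 := fun a => pullback A Phi (first4 a) *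
  \sum_(b < 8) \sum_(k < 8) \sum_(d < 8)
    H b a`_4 a`_5 * A k a`_6 * A d a`_7 * c [tuple b; k; d].
pose X2 : tensor R 8 := fun a => pullback A Phi (first4 a) *
  \sum_(b < 8) \sum_(k < 8) \sum_(d < 8)
    A b a`_5 * H k a`_4 a`_6 * A d a`_7 * c [tuple b; k; d].
pose X3 : tensor R 8 := fun a => pullback A Phi (first4 a) *
  \sum_(b < 8) \sum_(k < 8) \sum_(d < 8)
    A b a`_5 * A k a`_6 * H d a`_4 a`_7 * c [tuple b; k; d].
pose w : tensor R 4 := fun l => D' l`_0 [tuple l`_1; l`_2; l`_3].
transitivity (top_sum (fun a => X1 a + (X2 a + (X3 a +
    pullback A Phi (first4 a) * pullback A w (last4 a))))).
  apply: eq_top_sum => a; rewrite /X1 /X2 /X3 -!mulrDr; congr (_ * _).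
  rewrite last4E DE pullback4E exchange_big3.
  do 3 (rewrite -!big_split; apply: eq_bigr => ? _ /=).
  rewrite !mulrDl -!addrA; do 3 congr (_ + _).
  by rewrite mulr_sumr; apply: eq_bigr => f _; rewrite /w /=; ring.
have Fperm (i : 'I_8) a : (4 < i)%N ->
    first4 (permute_idx (tperm (Ordinal (isT : 4 < 8)%N) i) a) = first4 a.
  move=> i4; rewrite [LHS]first4E [RHS]first4E !nth_permute_tperm //=.
  by case: i i4 => -[|[|[|[|?]]]].
have X10 : top_sum X1 = 0.
  apply: (@top_sum_sym _ (Ordinal (isT : 4 < 8)%N) (Ordinal (isT : 5 < 8)%N)) => //.
  move=> a; rewrite /X1 Fperm //= !nth_permute_tperm //=; congr (_ * _).
  by do 3 (apply: eq_bigr => ? _ /=); rewrite sH.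
have X20 : top_sum X2 = 0.
  apply: (@top_sum_sym _ (Ordinal (isT : 4 < 8)%N) (Ordinal (isT : 6 < 8)%N)) => //.
  move=> a; rewrite /X2 Fperm //= !nth_permute_tperm //=; congr (_ * _).
  by do 3 (apply: eq_bigr => ? _ /=); rewrite sH.
have X30 : top_sum X3 = 0.
  apply: (@top_sum_sym _ (Ordinal (isT : 4 < 8)%N) (Ordinal (isT : 7 < 8)%N)) => //.
  move=> a; rewrite /X3 Fperm //= !nth_permute_tperm //=; congr (_ * _).
  by do 3 (apply: eq_bigr => ? _ /=); rewrite sH.
rewrite !top_sumD X10 X20 X30 !add0r top_sum_pullback2; congr (_ * _).
by apply: eq_top_sum => a; rewrite /w !nth_last4.
Qed.

End PullbackNaturality.

(** * The model Cayley form *)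

(** The sign of [s] as a rearrangement of [L], zero if an entry is missing or repeated: Laplace
    expansion of a 0/1 determinant, over [int] and [seq] so that it can be evaluated. *)
Fixpoint sgn_in (L s : seq nat) : int :=
  if s is x :: s' then
    if x \in L then (-1) ^+ index x L * sgn_in (rem x L) s' else 0
  else 1.

(** Components of the Euclidean Hodge dual of [Phi0]: each term e^{ijkl} contributes the Levi-Civita
    symbol of ijkl followed by [b]. *)
Definition Phi0_dual (b : seq nat) : int :=
  foldr (fun t acc => (-1) ^+ (t.1 : bool) * sgn_in (iota 0 8) (t.2 ++ b) + acc)
    0 Phi0_terms.

Definition alt3 (I : Type) (V : zmodType) (F : I -> I -> I -> V) (x y z : I) : V :=
  F x y z + F y z x + F z x y - F y x z - F x z y - F z y x.

(** Tabulated once, so that building the bilinear form is a matter of lookups instead of repeated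
    sign computations. *)
Definition dual_table : seq (seq (seq (seq int))) :=
  [seq [seq [seq [seq Phi0_dual [:: a; b; c; d] | d <- iota 0 8]
    | c <- iota 0 8] | b <- iota 0 8] | a <- iota 0 8].

Definition look4 (D : seq (seq (seq (seq int)))) (a b c d : nat) : int :=
  nth 0 (nth [::] (nth [::] (nth [::] D a) b) c) d.

(* The bilinear form l2(E, c) = top (Phi0 /\ contract 1 E c), antisymmetrised in
   both triples of indices. *)
Definition form_coef D (t : nat * nat * nat) (a b c : nat) : int :=
  alt3 (alt3 (fun x y z a b c => look4 D a b x y *+ (c == z)) t.1.1 t.1.2 t.2) a b c.

(** The 56 increasing triples, which index a basis of the 3-forms on R^8. *)
Definition triples : seq (nat * nat * nat) :=
  [seq p | p <- [seq (q, z) | q <- [seq (x, y) | x <- iota 0 8, y <- iota 0 8],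
    z <- iota 0 8] & (p.1.1 < p.1.2)%N && (p.1.2 < p.2)%N].

Definition form_table : seq (seq (seq (seq int))) :=
  let D := dual_table in
  [seq [seq [seq [seq form_coef D t a b c | c <- iota 0 8] | b <- iota 0 8]
    | a <- iota 0 8] | t <- triples].

(* As an operator on 3-forms the bilinear form has eigenvalues 4 and -24, so it
   satisfies (J + 20) J = 96 and is non-degenerate. *)
Definition inverse_entry (F : seq (seq (seq (seq int)))) (T : seq (nat * nat * nat))
    (i a b c : nat) : bool :=
  let v := nth (0, 0, 0)%N T i in
  foldr (fun j acc => let t := nth (0, 0, 0)%N T j in
    (look4 F i t.1.1 t.1.2 t.2 + 20 *+ (i == j)) * look4 F j a b c + acc)
    0 (iota 0 (size T)) ==
  96 * alt3 (fun x y z => ((x, y, z) == v)%:R) a b c.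

Definition all4 (n : nat) (P : nat -> nat -> nat -> nat -> bool) : bool :=
  all (fun i => all (fun a => all (fun b => all (fun c => P i a b c)
    (iota 0 8)) (iota 0 8)) (iota 0 8)) (iota 0 n).

Lemma all4P n P : all4 n P -> forall i a b c,
  (i < n)%N -> (a < 8)%N -> (b < 8)%N -> (c < 8)%N -> P i a b c.
Proof.
move=> H i a b c i8 a8 b8 c8.
have S k j : (j < k)%N -> j \in iota 0 k by rewrite mem_iota add0n.
move: H => /allP /(_ i (S _ _ i8)) /allP /(_ a (S _ _ a8)).
by move=> /allP /(_ b (S _ _ b8)) /allP /(_ c (S _ _ c8)).
Qed.

Lemma inverse_check :
  let F := form_table in let T := triples in all4 (size T) (inverse_entry F T).
Proof. by vm_compute. Qed.

(** Phi0 /\ Phi0 has top component 14: each of the fourteen terms is paired with the dual. *)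
Definition volume_check : bool :=
  foldr (fun t acc => (-1) ^+ (t.1 : bool) * Phi0_dual t.2 + acc) 0 Phi0_terms
    == 14.

Lemma volume_checkT : volume_check = true.
Proof. by vm_compute. Qed.

Section Phi0.
Variable R : realType.

Lemma eq_foldr_sum (V : zmodType) (I : Type) (r : seq I) (F : I -> V) :
  foldr (fun i acc => F i + acc) 0 r = \sum_(i <- r) F i.
Proof. by elim: r => [|i r IH]; rewrite ?big_nil // big_cons -IH. Qed.

(** In the first row only the column of [x] in [L] carries a one, and deleting it leaves [rem x L];
    [uniq L] makes that column unique. *)
Lemma det_sgn_in n (L s : seq nat) : size L = n -> size s = n -> uniq L ->
  \det (\matrix_(m < n, j < n) (nth 0%N s m == nth 0%N L j)%:R : 'M[R]_n) =
  (sgn_in L s)%:~R.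
Proof.
elim: n L s => [|n IH] L [|x s] //= sL.
  by move=> _ _; rewrite det_mx00.
move=> [] ss uL; rewrite (expand_det_row _ ord0).
case: ifPn => xL; last first.
  rewrite big1 // => j _; rewrite !mxE /= (_ : _ == _ = false) ?mul0r //.
  by apply: contraNF xL => /eqP ->; apply: mem_nth; rewrite sL.
have iL : (index x L < n.+1)%N by rewrite -sL index_mem.
rewrite (bigD1 (Ordinal iL)) //= big1 => [|j jL]; last first.
  rewrite !mxE /= (_ : _ == _ = false) ?mul0r //.
  apply: contraNF jL => /eqP E; apply/eqP/val_inj => /=.
  by rewrite E index_uniq ?sL.
rewrite addr0 !mxE /= nth_index // eqxx mul1r /cofactor add0n.
rewrite rmorphM rmorphXn rmorphN1 /=; congr (_ * _).
rewrite -IH ?rem_uniq //; last by rewrite size_rem // sL.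
congr (\det _); apply/matrixP => i j; rewrite !mxE /=; congr (_ == _)%:R.
rewrite remE nth_cat size_takel ?index_size //.
rewrite /bump; case: ltnP => ji.
  by rewrite add0n nth_take.
by rewrite add1n nth_drop addSn subnKC.
Qed.

Lemma top_signE (a : 8.-tuple 'I_8) :
  top_sign R a = (sgn_in (iota 0 8) (map val a))%:~R.
Proof.
rewrite -(@det_sgn_in 8) ?size_map ?size_tuple ?iota_uniq //; congr (\det _).
apply/matrixP => m j; rewrite !mxE (nth_map 0) ?size_tuple // nth_iota //.
by rewrite (tnth_nth 0).
Qed.

Let det_delta_alt (t : seq nat) (c : 4.-tuple 'I_8) :
  \det (\matrix_(m < 4, n < 4) ((nth 0%N t m == tnth c n :> nat)%:R : R)) =
  24 * alt (fun d => \prod_(m < 4) (nth 0%N t m == tnth d m :> nat)%:R) c.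
Proof.
rewrite /alt mulrA (_ : 4`!%:R = 24 :> R) // divff ?mul1r ?pnatr_eq0 //.
apply: eq_bigr => s _; congr (_ * _); apply: eq_bigr => m _.
by rewrite !mxE tnth_mktuple.
Qed.

(** Each term of [Phi0] is 24 times an antisymmetrised product of deltas. [top_sum] drops the
    antisymmetrisation, the deltas fix the first four indices, and the sign that remains is the
    corresponding entry of the dual. *)
Lemma top_sum_Phi0 (X : tensor R 4) :
  top_sum (fun a => Phi0 R (first4 a) * X (last4 a)) =
  24 * \sum_(b : 4.-tuple 'I_8) (Phi0_dual (map val b))%:~R * X b.
Proof.
transitivity (\sum_(t <- Phi0_terms) (-1) ^+ (t.1 : bool) * (24 *
    \sum_(b : 4.-tuple 'I_8) (sgn_in (iota 0 8) (t.2 ++ map val b))%:~R * X b)).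
  transitivity (\sum_(t <- Phi0_terms) top_sum (fun a => (-1) ^+ (t.1 : bool) * 24 *
     (alt (fun d => \prod_(m < 4) (nth 0%N t.2 m == tnth d m :> nat)%:R) (first4 a)
        * X (last4 a)))).
    rewrite -top_sum_sum; apply: eq_top_sum => a; rewrite mulr_suml.
    by apply: eq_bigr => t _; rewrite det_delta_alt !mulrA.
  have tP : all (fun t => (size t.2 == 4) && all (fun x => x < 8)%N t.2) Phi0_terms.
    by [].
  apply: eq_big_seq => t /(allP tP) /andP[/eqP st /allP t8].
  rewrite top_sumZ -mulrA; congr (_ * (_ * _)).
  rewrite (top_sum_alt_first (fun=> fun d =>
    \prod_(m < 4) (nth 0%N t.2 m == tnth d m :> nat)%:R)).
  have nt8 (m : 'I_4) : (nth 0%N t.2 m < 8)%N by rewrite t8 // mem_nth ?st.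
  pose f (m : 'I_4) : 'I_8 := Ordinal (nt8 m).
  transitivity (\sum_(b : 4.-tuple 'I_8) \sum_(c : 4.-tuple 'I_8)
    (\prod_(m < 4) (tnth b m == f m)%:R) *
    ((sgn_in (iota 0 8) (map val b ++ map val c))%:~R * X c)).
    rewrite top_sumE -(sum_first4_last4 (fun b c =>
      (\prod_(m < 4) (tnth b m == f m)%:R) *
      ((sgn_in (iota 0 8) (map val b ++ map val c))%:~R * X c))).
    apply: eq_bigr => a _; rewrite top_signE mulrCA; congr (_ * (_%:~R * _)).
      by apply: eq_bigr => m _; rewrite -[in RHS](inj_eq val_inj) eq_sym.
    congr sgn_in; rewrite -map_cat; congr map; rewrite first4E last4E.
    by case: a => -[|? [|? [|? [|? [|? [|? [|? [|? [|? ?]]]]]]]]] //.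
  rewrite exchange_big /=; apply: eq_bigr => c _.
  rewrite (sum_tuple_delta f (fun b =>
    ((sgn_in (iota 0 8) (map val b ++ map val c))%:~R * X c))).
  congr ((sgn_in _ (_ ++ _))%:~R * _).
  apply: (@eq_from_nth _ 0%N); first by rewrite size_map size_tuple st.
  move=> i; rewrite size_map size_tuple => i4.
  rewrite (nth_map 0) ?size_tuple //.
  by rewrite -[i in LHS]/(nat_of_ord (Ordinal i4)) -tnth_nth tnth_mktuple.
rewrite mulr_sumr; under eq_bigr => t _ do rewrite mulrCA mulr_sumr mulr_sumr.
rewrite exchange_big /=; apply: eq_bigr => b _; rewrite /Phi0_dual.
elim: Phi0_terms => [|t l IH]; first by rewrite big_nil /= mul0r mulr0.
rewrite big_cons {}IH /= rmorphD rmorphM rmorphXn rmorphN1 /=.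
by ring.
Qed.

Lemma Phi0_volume :
  top_sum (fun a => Phi0 R (first4 a) * Phi0 R (last4 a)) != 0.
Proof.
(* 576 = 24 . 24, one factor 4! for each copy of [Phi0]; 14 is the evaluated pairing. *)
suff -> : top_sum (fun a => Phi0 R (first4 a) * Phi0 R (last4 a)) = (576 * 14)%:R.
  by rewrite pnatr_eq0.
pose delta (t : seq nat) : tensor R 4 :=
  fun d => \prod_(m < 4) (nth 0%N t m == tnth d m :> nat)%:R.
transitivity (\sum_(t <- Phi0_terms) (-1) ^+ (t.1 : bool) * 24 *
   top_sum (fun a => Phi0 R (first4 a) * alt (delta t.2) (last4 a))).
  under [RHS]eq_bigr => t _ do rewrite -top_sumZ.
  rewrite -top_sum_sum; apply: eq_top_sum => a; rewrite [Phi0 R (last4 a)]/Phi0.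
  rewrite mulr_sumr; apply: eq_bigr => t _; rewrite det_delta_alt.
  by ring.
have tP : all (fun t => (size t.2 == 4) && all (fun x => x < 8)%N t.2) Phi0_terms.
  by [].
transitivity (\sum_(t <- Phi0_terms)
   576 * ((-1) ^+ (t.1 : bool) * (Phi0_dual t.2)%:~R : R)).
  apply: eq_big_seq => t /(allP tP) /andP[/eqP st /allP t8].
  have nt8 (m : 'I_4) : (nth 0%N t.2 m < 8)%N by rewrite t8 // mem_nth ?st.
  pose f (m : 'I_4) : 'I_8 := Ordinal (nt8 m).
  rewrite top_sum_alt_last top_sum_Phi0.
  transitivity ((-1) ^+ (t.1 : bool) * 24 * (24 * \sum_(b : 4.-tuple 'I_8)
      (\prod_(m < 4) (tnth b m == f m)%:R) * (Phi0_dual (map val b))%:~R) : R).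
    congr (_ * (_ * _)); apply: eq_bigr => b _; rewrite mulrC; congr (_ * _).
    by apply: eq_bigr => m _; rewrite -(inj_eq val_inj) /= eq_sym.
  rewrite (sum_tuple_delta f (fun b => (Phi0_dual (map val b))%:~R)).
  rewrite (_ : map val _ = t.2); first by ring.
  apply: (@eq_from_nth _ 0%N); first by rewrite size_map size_tuple st.
  move=> i; rewrite size_map size_tuple => i4.
  rewrite (nth_map 0) ?size_tuple //.
  by rewrite -[i in LHS]/(nat_of_ord (Ordinal i4)) -tnth_nth tnth_mktuple.
rewrite -mulr_sumr natrM; congr (_ * _).
rewrite (_ : 14%:R = (14 : int)%:~R) //; move/eqP: volume_checkT => <-.
rewrite eq_foldr_sum rmorph_sum; apply: eq_bigr => t _.
by rewrite rmorphM rmorph_sign.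
Qed.

Lemma look4_table (I : Type) (x0 : I) (f : I -> nat -> nat -> nat -> int) r a b c d :
  (a < size r)%N -> (b < 8)%N -> (c < 8)%N -> (d < 8)%N ->
  look4 [seq [seq [seq [seq f x y z t | t <- iota 0 8] | z <- iota 0 8]
    | y <- iota 0 8] | x <- r] a b c d = f (nth x0 r a) b c d.
Proof.
move=> an b8 c8 d8; rewrite /look4 (nth_map x0) //.
rewrite (nth_map 0%N) ?size_iota // (nth_map 0%N) ?size_iota //.
rewrite (nth_map 0%N) ?size_iota //.
by rewrite !nth_iota.
Qed.

Lemma sum_tuple4 (F : 4.-tuple 'I_8 -> R) : \sum_a F a =
  \sum_(b < 8) \sum_(c < 8) \sum_(d < 8) \sum_(e < 8) F [tuple b; c; d; e].
Proof.
rewrite sum_tuple_cons; apply: eq_bigr => b _.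
rewrite sum_tuple_cons; apply: eq_bigr => c _.
rewrite sum_tuple_cons; apply: eq_bigr => d _.
rewrite sum_tuple_cons; apply: eq_bigr => e _.
rewrite (bigD1 [tuple]) //= big1 ?addr0 => [|t]; last by rewrite [t]tuple0.
by congr F; apply: val_inj.
Qed.

Lemma det3 (A : 'M[R]_3) (i0 := Ordinal (isT : 0 < 3)%N)
    (i1 := Ordinal (isT : 1 < 3)%N) (i2 := Ordinal (isT : 2 < 3)%N) :
  \det A = A i0 i0 * A i1 i1 * A i2 i2 + A i0 i1 * A i1 i2 * A i2 i0 +
    A i0 i2 * A i1 i0 * A i2 i1 - A i0 i1 * A i1 i0 * A i2 i2 -
    A i0 i0 * A i1 i2 * A i2 i1 - A i0 i2 * A i1 i1 * A i2 i0.
Proof.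
rewrite (expand_det_row _ ord0) !big_ord_recl big_ord0 /cofactor.
rewrite !(expand_det_row _ ord0) !big_ord_recl !big_ord0 /cofactor !det_mx11 !mxE.
pose B (i j : nat) := A (inord i) (inord j).
have E i j : A i j = B i j by rewrite /B !inord_val.
rewrite !E /=; ring.
Qed.

(** The basis form e^{v_0 v_1 v_2}; it is zero when [v] has a repeated index, so [v] may range over
    all triples. *)
Definition delta3 (v : 3.-tuple 'I_8) : tensor R 3 :=
  fun a => \det (\matrix_(m < 3, n < 3) (tnth v m == tnth a n)%:R).

Lemma delta3_alternating v : alternating (delta3 v).
Proof.
move=> s a; rewrite /delta3.
rewrite (_ : \matrix_(m, n) (tnth v m == tnth (permute_idx s a) n)%:R =
  col_perm s (\matrix_(m, n) (tnth v m == tnth a n)%:R)); last first.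
  by apply/matrixP => m n; rewrite !mxE tnth_mktuple.
by rewrite col_permE det_mulmx det_perm odd_permV mulrC.
Qed.

Lemma sum_delta3 (v : 3.-tuple 'I_8) (S : 'I_8 -> 'I_8 -> 'I_8 -> R) :
  \sum_x \sum_y \sum_z delta3 v [tuple x; y; z] * S x y z =
  alt3 S v`_0 v`_1 v`_2.
Proof.
have D (u0 u1 u2 : 'I_8) : \sum_x \sum_y \sum_z
    (u0 == x)%:R * (u1 == y)%:R * (u2 == z)%:R * S x y z = S u0 u1 u2.
  rewrite (bigD1 u0) //= [X in _ + X]big1 => [|x xu].
    rewrite addr0 (bigD1 u1) //= [X in _ + X]big1 => [|y yu].
      rewrite addr0 (bigD1 u2) //= [X in _ + X]big1 => [|z zu].
        by rewrite addr0 !eqxx !mul1r.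
      by rewrite ![u2 == _]eq_sym (negPf zu) mulr0 mul0r.
    by rewrite big1 // => z _; rewrite ![u1 == _]eq_sym (negPf yu) mulr0 !mul0r.
  rewrite big1 // => y _; rewrite big1 // => z _.
  by rewrite ![u0 == _]eq_sym (negPf xu) !mul0r.
have DN (u0 u1 u2 : 'I_8) : \sum_x \sum_y \sum_z
    - ((u0 == x)%:R * (u1 == y)%:R * (u2 == z)%:R * S x y z) = - S u0 u1 u2.
  rewrite -D -sumrN; apply: eq_bigr => x _; rewrite -sumrN; apply: eq_bigr => y _.
  by rewrite sumrN.
rewrite /alt3 -!DN -!D.
do 3 (rewrite -!big_split; apply: eq_bigr => ? _ /=).
by rewrite /delta3 det3 !mxE !(tnth_nth 0) /=; ring.
Qed.

(** An alternating [E] absorbs the antisymmetrisation of the coefficients: the 3! terms of [alt3]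
    are all equal after pairing. *)
Lemma sum_alt3 (N : nat -> nat -> nat -> int) (E : tensor R 3) : alternating E ->
  \sum_(x < 8) \sum_(y < 8) \sum_(z < 8) (alt3 N x y z)%:~R * E [tuple x; y; z] =
  6 * \sum_(x < 8) \sum_(y < 8) \sum_(z < 8) (N x y z)%:~R * E [tuple x; y; z].
Proof.
move=> aE.
pose S (N : nat -> nat -> nat -> int) := \sum_(x < 8) \sum_(y < 8) \sum_(z < 8)
  (N x y z)%:~R * E [tuple x; y; z].
have S102 N' : S (fun x y z => N' y x z) = - S N'.
  rewrite /S exchange_big /= -sumrN; apply: eq_bigr => x _.
  rewrite -sumrN; apply: eq_bigr => y _; rewrite -sumrN; apply: eq_bigr => z _.
  by rewrite alternating3_102 // mulrN.
have S021 N' : S (fun x y z => N' x z y) = - S N'.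
  rewrite /S -sumrN; apply: eq_bigr => x _.
  rewrite exchange_big /= -sumrN; apply: eq_bigr => y _.
  rewrite -sumrN; apply: eq_bigr => z _.
  by rewrite alternating3_021 // mulrN.
have S210 : S (fun x y z => N z y x) = - S N.
  rewrite (S102 (fun x y z => N z x y)) (S021 (fun x y z => N y x z)).
  by rewrite S102 opprK.
transitivity (S N + S (fun x y z => N y z x) + S (fun x y z => N z x y)
   - S (fun x y z => N y x z) - S (fun x y z => N x z y) - S (fun x y z => N z y x)).
  rewrite /S -!sumrN -!big_split; apply: eq_bigr => x _ /=.
  rewrite -!sumrN -!big_split; apply: eq_bigr => y _ /=.
  rewrite -!sumrN -!big_split; apply: eq_bigr => z _ /=.
  by rewrite /alt3 !rmorphB !rmorphD /= !mulrBl !mulrDl.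
rewrite (S102 (fun x y z => N x z y)) (S021 (fun x y z => N y x z)).
rewrite (S021 N) (S102 N) S210 -/(S N); ring.
Qed.

(** If every basis form paired to zero with [E], then J E = 0 for the operator J of the bilinear
    form; applying J + 20 gives 96 E = 0. *)
Lemma Phi0_nondegenerate (E : tensor R 3) (x0 y0 z0 : 'I_8) : alternating E ->
  E [tuple x0; y0; z0] != 0 ->
  exists2 v, alternating (delta3 v) &
  top_sum (fun a => Phi0 R (first4 a) * contract 1%:M E (delta3 v) (last4 a)) != 0.
Proof.
move=> aE E0; apply: contrapT => nE.
have H v : top_sum (fun a => Phi0 R (first4 a) *
    contract 1%:M E (delta3 v) (last4 a)) = 0.
  apply/eqP/negPn/negP => Hv; apply: nE; exists v => //.
  exact: delta3_alternating.
move/eqP: E0; apply.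
pose D := dual_table.
have DE a b c d : (a < 8)%N -> (b < 8)%N -> (c < 8)%N -> (d < 8)%N ->
    look4 D a b c d = Phi0_dual [:: a; b; c; d].
  move=> a8 b8 c8 d8; rewrite (look4_table 0%N
    (fun a b c d => Phi0_dual [:: a; b; c; d])) ?size_iota //.
  by rewrite nth_iota.
pose nt (v : 3.-tuple 'I_8) := (nat_of_ord v`_0, nat_of_ord v`_1, nat_of_ord v`_2).
pose N (v : nat * nat * nat) (a b c : nat) : int := alt3 (fun x y z => look4 D a b x y *+ (c == z))
  v.1.1 v.1.2 v.2.
(* The vanishing pairing with [delta3 v], read as a linear equation on the components of [E]. Its
   coefficients are so far antisymmetrised in the test triple only. *)
have N0 (v : 3.-tuple 'I_8) : \sum_(a < 8) \sum_(b < 8) \sum_(c < 8)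
    (N (nt v) a b c)%:~R * E [tuple a; b; c] = 0.
  pose S (x y z : 'I_8) : R := \sum_(a < 8) \sum_(b < 8)
     (look4 D a b x y)%:~R * E [tuple a; b; z].
  transitivity (alt3 S v`_0 v`_1 v`_2).
    have SE u0 u1 u2 : S u0 u1 u2 = \sum_(a < 8) \sum_(b < 8) \sum_(c < 8)
        (look4 D a b u0 u1 *+ (c == u2 :> nat))%:~R * E [tuple a; b; c].
      apply: eq_bigr => a _; apply: eq_bigr => b _.
      rewrite (bigD1 u2) //= (eqxx (val u2)) mulr1n big1 ?addr0 // => c cu.
      by rewrite -[_ == _ :> nat]/(c == u2) (negPf cu) mulr0n mul0r.
    rewrite /alt3 !SE.
    rewrite -!sumrN -!big_split; apply: eq_bigr => a _ /=.
    rewrite -!sumrN -!big_split; apply: eq_bigr => b _ /=.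
    rewrite -!sumrN -!big_split; apply: eq_bigr => c _ /=.
    by rewrite /N /alt3 !rmorphB !rmorphD /= !mulrBl !mulrDl.
  have /eqP := H v; rewrite top_sum_Phi0 mulf_eq0 pnatr_eq0 /= => /eqP <-.
  rewrite sum_tuple4 -sum_delta3 /S.
  transitivity (\sum_(c < 8) \sum_(d < 8) \sum_(r < 8) \sum_(a < 8) \sum_(b < 8)
    (look4 D a b c d)%:~R * E [tuple a; b; r] * delta3 v [tuple c; d; r]).
    apply: eq_bigr => c _; apply: eq_bigr => d _; apply: eq_bigr => r _.
    rewrite mulr_sumr; apply: eq_bigr => a _; rewrite mulr_sumr.
    by apply: eq_bigr => b _; rewrite mulrC.
  transitivity (\sum_(a < 8) \sum_(b < 8) \sum_(c < 8) \sum_(d < 8) \sum_(r < 8)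
    (look4 D a b c d)%:~R * E [tuple a; b; r] * delta3 v [tuple c; d; r]).
    have ex (F : 'I_8 -> 'I_8 -> 'I_8 -> 'I_8 -> R) :
        \sum_c \sum_d \sum_r \sum_a F c d r a = \sum_a \sum_c \sum_d \sum_r F c d r a.
      symmetry; rewrite exchange_big; apply: eq_bigr => c _ /=.
      by rewrite exchange_big; apply: eq_bigr => d _ /=; rewrite exchange_big.
    by rewrite ex; apply: eq_bigr => a _; rewrite ex.
  apply: eq_bigr => a _; apply: eq_bigr => b _; apply: eq_bigr => c _.
  apply: eq_bigr => d _; rewrite /contract mulr_sumr; apply: eq_bigr => r _ /=.
  rewrite (bigD1 r) //= big1 => [|q qr]; last by rewrite mxE eq_sym (negPf qr) mulr0.
  by rewrite addr0 mxE (eqxx r) mulr1 DE ?ltn_ord // mulrA.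
(* Antisymmetrising in the triple of [E] as well only multiplies the equation by 6 and brings it to
   the tabulated form. *)
have F0 (v : 3.-tuple 'I_8) : \sum_(a < 8) \sum_(b < 8) \sum_(c < 8)
    (form_coef D (nt v) a b c)%:~R *
    E [tuple a; b; c] = 0.
  by rewrite sum_alt3 // N0 mulr0.
have sortedE (x y z : 'I_8) : (x < y)%N -> (y < z)%N -> E [tuple x; y; z] = 0.
  move=> xy yz.
  have vT : ((x : nat), (y : nat), (z : nat)) \in triples.
    rewrite /triples map_id mem_filter; apply/andP; split; first by rewrite /= xy yz.
    apply/allpairsP; exists ((x : nat, y : nat), z : nat); split=> //.
      apply/allpairsP; exists (x : nat, y : nat); split=> //;
        by rewrite mem_iota !add0n ltn_ord.
    by rewrite mem_iota !add0n ltn_ord.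
  set i := index ((x : nat), (y : nat), (z : nat)) triples.
  have iT : (i < size triples)%N by rewrite index_mem.
  have FE j a b c : (j < size triples)%N -> (a < 8)%N -> (b < 8)%N -> (c < 8)%N ->
      look4 form_table j a b c = form_coef D (nth (0, 0, 0)%N triples j) a b c.
    by move=> *; rewrite (look4_table (0, 0, 0)%N (form_coef D)).
  (* Row [i] of J + 20. With these weights the equations of all increasing triples add up to 96 . 6
     = 576 times the component of [E] at the sorted triple. *)
  pose K j : int := let t := nth (0, 0, 0)%N triples j in
    look4 form_table i t.1.1 t.1.2 t.2 + 20 *+ (i == j).
  have chk a b c : (a < 8)%N -> (b < 8)%N -> (c < 8)%N ->
      \sum_(j <- iota 0 (size triples)) K j * look4 form_table j a b c =
      96 * alt3 (fun x' y' z' => ((x', y', z') == (x : nat, y : nat, z : nat))%:R) a b c.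
    move=> a8 b8 c8; have /eqP := all4P inverse_check iT a8 b8 c8.
    by rewrite eq_foldr_sum nth_index.
  have T8 j (t := nth (0, 0, 0)%N triples j) : (j < size triples)%N ->
      exists v : 3.-tuple 'I_8, (nt v) = t.
    move=> jT; have := mem_nth (0, 0, 0)%N jT; rewrite -/t /triples map_id.
    rewrite mem_filter => /andP[_ /allpairsP[[q w] [+ + ->]]].
    move=> /allpairsP[[x' y'] [+ + ->]].
    rewrite !mem_iota !add0n => x8 y8 w8.
    by exists [tuple Ordinal x8; Ordinal y8; Ordinal w8].
  have : \sum_(a < 8) \sum_(b < 8) \sum_(c < 8)
     (\sum_(j <- iota 0 (size triples)) K j * look4 form_table j a b c)%:~R *
     E [tuple a; b; c] = 0.
    transitivity (\sum_(j <- iota 0 (size triples)) (K j)%:~R *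
      \sum_(a < 8) \sum_(b < 8) \sum_(c < 8)
      (look4 form_table j a b c)%:~R * E [tuple a; b; c]).
      symmetry; under eq_bigr => j _ do rewrite mulr_sumr.
      rewrite exchange_big; apply: eq_bigr => a _ /=.
      under eq_bigr => j _ do rewrite mulr_sumr.
      rewrite exchange_big; apply: eq_bigr => b _ /=.
      under eq_bigr => j _ do rewrite mulr_sumr.
      rewrite exchange_big; apply: eq_bigr => c _ /=.
      rewrite rmorph_sum mulr_suml; apply: eq_bigr => j _.
      by rewrite rmorphM mulrA.
    rewrite big_seq big1 // => j; rewrite mem_iota add0n /= => jT.
    have [v vE] := T8 j jT.
    rewrite [X in _ * X](_ : _ = 0) ?mulr0 // -[RHS](F0 v).
    apply: eq_bigr => a _; apply: eq_bigr => b _; apply: eq_bigr => c _.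
    by rewrite FE ?ltn_ord // vE.
  under eq_bigr => a _ do under eq_bigr => b _ do under eq_bigr => c _ do
    rewrite chk ?ltn_ord // rmorphM -mulrA.
  under eq_bigr => a _ do under eq_bigr => b _ do rewrite -mulr_sumr.
  under eq_bigr => a _ do rewrite -mulr_sumr.
  rewrite -mulr_sumr sum_alt3 // mulrA => /eqP; rewrite mulf_eq0 => /orP[/eqP|/eqP <-].
    by move=> /eqP; rewrite (_ : _ * _ = 576%:R) ?pnatr_eq0 //; ring.
  rewrite (bigD1 x) //= [X in _ + X]big1 => [|a ax].
    rewrite addr0 (bigD1 y) //= [X in _ + X]big1 => [|b by_].
      rewrite addr0 (bigD1 z) //= [X in _ + X]big1 => [|c cz].
        by rewrite addr0 (eqxx ((x : nat), (y : nat), (z : nat))) mul1r.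
      by rewrite !xpair_eqE (inj_eq val_inj c) (negPf cz) andbF mul0r.
    rewrite big1 // => c _.
    by rewrite !xpair_eqE (inj_eq val_inj b) (negPf by_) andbF mul0r.
  rewrite big1 // => b _; rewrite big1 // => c _.
  by rewrite !xpair_eqE (inj_eq val_inj a) (negPf ax) mul0r.
have swap102 u v w : E [tuple u; v; w] = 0 -> E [tuple v; u; w] = 0.
  by move=> e; rewrite alternating3_102 // e oppr0.
have swap021 u v w : E [tuple u; v; w] = 0 -> E [tuple u; w; v] = 0.
  by move=> e; rewrite alternating3_021 // e oppr0.
have self (w : R) : w = - w -> w = 0 by lra.
have E102 u w : E [tuple u; u; w] = 0 by apply: self; exact: alternating3_102.
have E021 u w : E [tuple w; u; u] = 0 by apply: self; exact: alternating3_021.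
(* Unsorted triples reduce to sorted ones by transpositions; a repeated index makes the component
   its own negative. *)
case: (ltngtP x0 y0) => [xy|yx|/val_inj <- //];
  case: (ltngtP y0 z0) => [yz|zy|/val_inj <- //].
- exact: sortedE.
- case: (ltngtP x0 z0) => [xz|zx|/val_inj <-]; apply: swap021; last exact: E102.
    exact: sortedE.
  by apply: swap102; exact: sortedE.
- case: (ltngtP x0 z0) => [xz|zx|/val_inj <-]; apply: swap102.
  + exact: sortedE.
  + by apply: swap021; exact: sortedE.
  + exact: E021.
- by apply: (swap102); apply: swap021; apply: swap102; exact: sortedE.
Qed.

End Phi0.

(** * Smooth functions on R^8 *)

Section Smooth.
Variable R : realType.
Local Notation V := 'rV[R]_8.
Implicit Types (f g : V -> R) (U W : set V).

Lemma Cn_on_cont n U f : Cn_on n U f -> forall x, U x -> {for x, continuous f}.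
Proof. by case: n => [|n] []. Qed.

Lemma Cn_on_sub n U W f : W `<=` U -> Cn_on n U f -> Cn_on n W f.
Proof.
move=> WU; elim: n f => [|n IH] f /= [cf Df]; split=> //;
  try by move=> x /WU; exact: cf.
move=> a; have [Da Db] := Df a; split; first by move=> x /WU; exact: Da.
exact: IH.
Qed.

(** [Cn_on] constrains each point separately, through limits in the ambient space, so it can be
    verified on arbitrary pieces of [U]. *)
Lemma Cn_on_local n U f :
  (forall x, U x -> exists2 W : set V, W x & Cn_on n W f) -> Cn_on n U f.
Proof.
elim: n f => [|n IH] f H; split=> //=; try by
  move=> x /H[W Wx /Cn_on_cont]; exact.
move=> a; split; first by move=> x /H[W Wx /= [_ /(_ a)[Da _]]]; exact: Da.
by apply: IH => x /H[W Wx /= [_ /(_ a)[_ Db]]]; exists W.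
Qed.

Lemma Cn_onS n U f : Cn_on n.+1 U f -> Cn_on n U f.
Proof.
elim: n f => [|n IH] f [cf Df]; split=> // a.
by have [Da Db] := Df a; split=> //; exact: IH.
Qed.

Lemma open_near_eq U f g x : open U -> (forall x, U x -> f x = g x) -> U x ->
  \forall y \near x, f y = g y.
Proof.
move=> oU fg Ux; have : \forall y \near x, U y by exact: open_nbhs_nbhs.
by apply: filterS => y /fg.
Qed.

Lemma near_eq_continuous f g x : (\forall y \near x, f y = g y) ->
  {for x, continuous f} -> {for x, continuous g}.
Proof.
move=> fg cf; have E : f x = g x := nbhs_singleton fg.
suff : g @ x --> g x by [].
rewrite -E.
exact: cvg_trans (@near_eq_cvg _ _ (nbhs x) _ f g fg) cf.
Qed.

(** Openness of [U] turns equality on [U] into equality near each of its points, which is what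
    derivatives see. *)
Lemma Cn_on_eq n U f g : open U -> (forall x, U x -> f x = g x) ->
  Cn_on n U f -> Cn_on n U g.
Proof.
move=> oU; elim: n f g => [|n IH] f g fg [cf Df]; (split; first by
  move=> x Ux; apply: near_eq_continuous (cf _ Ux); exact: open_near_eq fg Ux).
  by [].
move=> a; have [Da Db] := Df a; split.
  move=> x Ux; apply: near_eq_derivable (Da _ Ux); exact: open_near_eq fg Ux.
apply: IH Db => x Ux; apply: near_eq_derive; exact: open_near_eq fg Ux.
Qed.

Lemma Cn_on_cst n U k : Cn_on n U (fun=> k).
Proof.
elim: n k => [|n IH] k; (split; first by move=> x _; exact: cst_continuous).
  by [].
move=> a; split; first by move=> x _; exact: derivable_cst.
have -> : (fun x => 'D_(basis_vec R a) (fun=> k) x) = fun=> 0 :> R.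
  by apply/funext => x; rewrite derive_cst.
exact: IH.
Qed.

Lemma Cn_onD n U f g : open U -> Cn_on n U f -> Cn_on n U g ->
  Cn_on n U (fun x => f x + g x).
Proof.
move=> oU; elim: n f g => [|n IH] f g [cf Df] [cg Dg]; (split; first by
  move=> x Ux; exact: continuousD (cf _ Ux) (cg _ Ux)).
  by [].
move=> a; have [Da Db] := Df a; have [Ea Eb] := Dg a; split.
  by move=> x Ux; apply: derivableD; [exact: Da|exact: Ea].
apply: Cn_on_eq (IH _ _ Db Eb) => // x Ux.
by rewrite -deriveD //; [exact: Da|exact: Ea].
Qed.

Lemma Cn_onM n U f g : open U -> Cn_on n U f -> Cn_on n U g ->
  Cn_on n U (fun x => f x * g x).
Proof.
move=> oU; elim: n f g => [|n IH] f g Cf Cg; (split; first by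
  move=> x Ux; exact: continuousM (Cn_on_cont Cf Ux) (Cn_on_cont Cg Ux)).
  by [].
move=> a; have [_ /(_ a)[Da Db]] := Cf; have [_ /(_ a)[Ea Eb]] := Cg; split.
  by move=> x Ux; apply: derivableM; [exact: Da|exact: Ea].
apply: (@Cn_on_eq _ _ (fun x => f x * 'D_(basis_vec R a) g x +
    g x * 'D_(basis_vec R a) f x)) => // [x Ux|].
  by rewrite -[LHS]deriveM //; [exact: Da|exact: Ea].
by apply: Cn_onD => //; apply: IH => //; exact: Cn_onS.
Qed.

(** The derivative - f^-2 f' is again a product of reciprocals and of functions one order less
    regular, which closes the induction. *)
Lemma Cn_onV n U f : open U -> (forall x, U x -> f x != 0) -> Cn_on n U f ->
  Cn_on n U (fun x => (f x)^-1).
Proof.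
move=> oU f0; elim: n f f0 => [|n IH] f f0 Cf; (split; first by
  move=> x Ux; exact: continuousV (f0 _ Ux) (Cn_on_cont Cf Ux)).
  by [].
move=> a; have [_ /(_ a)[Da Db]] := Cf; split.
  by move=> x Ux; apply: derivableV; [exact: f0|exact: Da].
apply: (@Cn_on_eq _ _ (fun x => (- 1 * ((f x)^-1 * (f x)^-1)) *
    'D_(basis_vec R a) f x)) => // [x Ux|].
  rewrite deriveV ?f0 //; last exact: Da.
  by rewrite mulN1r -invfM -expr2.
have CV := IH f f0 (Cn_onS Cf).
apply: Cn_onM => //; apply: Cn_onM => //; last exact: Cn_onM.
exact: Cn_on_cst.
Qed.

(** Smoothness on some neighbourhood: a property of germs, closed under algebraic operations without
    carrying an open domain along. *)
Definition smooth_at f x := exists2 U : set V, open U /\ U x & smooth_on U f.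

Lemma smooth_on_at U f x : open U -> U x -> smooth_on U f -> smooth_at f x.
Proof. by exists U. Qed.

Lemma smooth_at_on U f : (forall x, U x -> smooth_at f x) -> smooth_on U f.
Proof.
move=> H n; apply: Cn_on_local => x Ux.
by have [W [oW Wx] sW] := H x Ux; exists W.
Qed.

Lemma smooth_at_near f x : smooth_at f x -> \forall y \near x, smooth_at f y.
Proof.
move=> [U [oU Ux] sU]; have : \forall y \near x, U y by exact: open_nbhs_nbhs.
by apply: filterS => y Uy; exists U.
Qed.

Lemma smooth_at_cont f x : smooth_at f x -> {for x, continuous f}.
Proof. by move=> [U [oU Ux] /(_ 0)/Cn_on_cont]; exact. Qed.

Lemma smooth_at_derivable f x a : smooth_at f x -> derivable f x (basis_vec R a).
Proof. by move=> [U [oU Ux] /(_ 1%N)[_ /(_ a)[D _]]]; exact: D. Qed.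

Lemma smooth_at_derive f x a :
  smooth_at f x -> smooth_at (fun y => 'D_(basis_vec R a) f y) x.
Proof.
move=> [U [oU Ux] sU]; exists U => // n.
by have [_ /(_ a)[_]] := sU n.+1.
Qed.

Lemma smooth_at_eq f g x : (\forall y \near x, f y = g y) ->
  smooth_at f x -> smooth_at g x.
Proof.
rewrite /prop_near1 nbhsE => -[W [oW Wx] fg] [U [oU Ux] sU].
exists (U `&` W); first by split; [exact: openI|].
move=> n; apply: (@Cn_on_eq _ _ f); first exact: openI.
  by move=> y [_ /fg].
by apply: Cn_on_sub (sU n) => y [].
Qed.

Lemma smooth_at_cst k x : smooth_at (fun=> k) x.
Proof. by exists setT => [|n]; [split; [exact: openT|]|exact: Cn_on_cst]. Qed.

Lemma smooth_atD f g x : smooth_at f x -> smooth_at g x ->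
  smooth_at (fun y => f y + g y) x.
Proof.
move=> [U [oU Ux] sU] [W [oW Wx] sW]; exists (U `&` W).
  by split; [exact: openI|].
move=> n; apply: Cn_onD; first exact: openI.
  by apply: Cn_on_sub (sU n) => y [].
by apply: Cn_on_sub (sW n) => y [].
Qed.

Lemma smooth_atM f g x : smooth_at f x -> smooth_at g x ->
  smooth_at (fun y => f y * g y) x.
Proof.
move=> [U [oU Ux] sU] [W [oW Wx] sW]; exists (U `&` W).
  by split; [exact: openI|].
move=> n; apply: Cn_onM; first exact: openI.
  by apply: Cn_on_sub (sU n) => y [].
by apply: Cn_on_sub (sW n) => y [].
Qed.

Lemma smooth_atN f x : smooth_at f x -> smooth_at (fun y => - f y) x.
Proof.
move=> sf; apply: (@smooth_at_eq (fun y => - 1 * f y)).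
  by near=> y; rewrite mulN1r.
by apply: smooth_atM => //; exact: smooth_at_cst.
Unshelve. all: by end_near. Qed.

Lemma smooth_at_sum (I : Type) (r : seq I) (P : pred I) (F : I -> V -> R) x :
  (forall i, P i -> smooth_at (F i) x) ->
  smooth_at (fun y => \sum_(i <- r | P i) F i y) x.
Proof.
move=> H; elim: r => [|i r IH].
  apply: (@smooth_at_eq (fun=> 0)); last exact: smooth_at_cst.
  by near=> y; rewrite big_nil.
case Pi : (P i); last first.
  by apply: smooth_at_eq IH; near=> y; rewrite big_cons Pi.
apply: (@smooth_at_eq (fun y => F i y + \sum_(i <- r | P i) F i y)).
  by near=> y; rewrite big_cons Pi.
by apply: smooth_atD => //; exact: H.
Unshelve. all: by end_near. Qed.

Lemma smooth_at_prod (I : Type) (r : seq I) (P : pred I) (F : I -> V -> R) x :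
  (forall i, P i -> smooth_at (F i) x) ->
  smooth_at (fun y => \prod_(i <- r | P i) F i y) x.
Proof.
move=> H; elim: r => [|i r IH].
  apply: (@smooth_at_eq (fun=> 1)); last exact: smooth_at_cst.
  by near=> y; rewrite big_nil.
case Pi : (P i); last first.
  by apply: smooth_at_eq IH; near=> y; rewrite big_cons Pi.
apply: (@smooth_at_eq (fun y => F i y * \prod_(i <- r | P i) F i y)).
  by near=> y; rewrite big_cons Pi.
by apply: smooth_atM => //; exact: H.
Unshelve. all: by end_near. Qed.

Lemma smooth_atV f x : smooth_at f x -> f x != 0 ->
  smooth_at (fun y => (f y)^-1) x.
Proof.
move=> sf f0; have cf := smooth_at_cont sf.
have : \forall y \near x, f y != 0.
  by apply: (cf [set z : R | z != 0]); apply: open_nbhs_nbhs; split=> //; exact: open_neq.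
rewrite /prop_near1 nbhsE => -[W [oW Wx] Wf0]; case: sf => U [oU Ux] sU.
exists (U `&` W); first by split; [exact: openI|].
move=> n; apply: Cn_onV; [exact: openI|by move=> y [_ /Wf0]|].
by apply: Cn_on_sub (sU n) => y [].
Qed.

Lemma is_derive_coord (b : 'I_8) (y : V) a :
  is_derive y (basis_vec R a) (fun y : V => y 0 b) ((a == b)%:R).
Proof.
suff H : (fun h : R => h^-1 *: ((h *: basis_vec R a + y) 0 b - y 0 b)) @ 0^' -->
    ((a == b)%:R : R).
  by apply: DeriveDef; [apply/cvg_ex; eexists; exact: H|exact: cvg_lim H].
apply: cvg_near_cst; near=> h.
have h0 : h != 0 by near: h; exact: nbhs_dnbhs_neq.
by rewrite !mxE addrK eqxx /= eq_sym /GRing.scale /= mulrA mulVf ?mul1r.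
Unshelve. all: by end_near. Qed.

Lemma derive_coord (b : 'I_8) (y : V) a :
  'D_(basis_vec R a) (fun y : V => y 0 b) y = (a == b)%:R.
Proof. exact: (@derive_val _ _ _ _ _ _ _ (is_derive_coord b y a)). Qed.

End Smooth.

(** * Mean values, the chain rule and symmetry of second derivatives *)

Section Derivatives.
Variable R : realType.
Local Notation V := 'rV[R]_8.
Implicit Types (f g : V -> R).

Lemma cvg_sumr (T I : Type) (F : set_system T) {FF : Filter F} (r : seq I)
    (h : I -> T -> R) (l : I -> R) : (forall i, h i @ F --> l i) ->
  (fun x => \sum_(i <- r) h i x) @ F --> \sum_(i <- r) l i.
Proof.
move=> H; elim: r => [|i r IH].
  rewrite big_nil (_ : (fun x => \sum_(j <- [::]) h j x) = fun=> 0); first exact: cvg_cst.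
  by apply/funext => x; rewrite big_nil.
rewrite big_cons; have -> : (fun x => \sum_(j <- i :: r) h j x) =
    (fun x => h i x + \sum_(j <- r) h j x).
  by apply/funext => x; rewrite big_cons.
by apply: cvgD; [exact: H|exact: IH].
Qed.

Lemma coord_le_norm n (x : 'rV[R]_n.+1) j : `|x 0 j| <= `|x|.
Proof.
rewrite [leRHS]/Num.Def.normr/= mx_normrE.
exact: (le_bigmax _ (fun i : 'I_1 * 'I_n.+1 => `|x i.1 i.2|) (0, j)).
Qed.

Lemma norm_le_coord n (x : 'rV[R]_n.+1) e :
  0 <= e -> (forall j, `|x 0 j| <= e) -> `|x| <= e.
Proof.
move=> e0 H; rewrite [leLHS]/Num.Def.normr/= mx_normrE (bigmax_le _ e0)//= => i _.
by rewrite (ord1 i.1); exact: H.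
Qed.

Lemma norm_basis_vec a : `|basis_vec R a| <= 1.
Proof.
apply: norm_le_coord => // j; rewrite mxE eqxx /=.
by case: (_ == _); rewrite ?normr1 ?normr0.
Qed.

Lemma line_is_derive f (p v : V) s :
  derivable f (s *: v + p) v ->
  is_derive s 1 (fun s : R => f (s *: v + p)) ('D_v f (s *: v + p)).
Proof.
move=> df.
have E : (fun h : R => h^-1 *: (f ((h *: (1 : R) + s) *: v + p) - f (s *: v + p))) =
         (fun h : R => h^-1 *: (f (h *: v + (s *: v + p)) - f (s *: v + p))).
  by apply/funext => h; rewrite scalerDl addrA [h *: 1]mulr1.
apply: DeriveDef; first by rewrite /derivable E.
by rewrite /derive E.
Qed.

(** The mean value theorem for the restriction of [f] to a line. The two signs of [t] are separated
    because the one-variable statement concerns an ordered interval. *)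
Lemma MVT_line f (p v : V) (t : R) :
  (forall s : R, `|s| <= `|t| -> derivable f (s *: v + p) v) ->
  exists2 s : R, `|s| <= `|t| & f (t *: v + p) - f p = t * 'D_v f (s *: v + p).
Proof.
move=> df; pose g (s : R) := f (s *: v + p).
have g0 : g 0 = f p by rewrite /g scale0r add0r.
have dg (s : R) : `|s| <= `|t| -> is_derive s 1 g ('D_v f (s *: v + p)).
  by move=> /df; exact: line_is_derive.
have cg (a b : R) : (forall s : R, s \in `[a, b] -> `|s| <= `|t|) ->
    {within `[a, b], continuous g}.
  by move=> ab; apply: derivable_within_continuous => s /ab/dg[].
case: (leP 0 t) => t0.
  have ab (s : R) : s \in `[0, t] -> `|s| <= `|t|.
    by rewrite in_itv /= => /andP[s0 st]; rewrite !ger0_norm.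
  have dg' (s : R) : s \in `]0, t[ -> is_derive s 1 g ('D_v f (s *: v + p)).
    by move=> st; apply/dg/ab; apply: subset_itv_oo_cc st.
  have [s st gE] := MVT_segment t0 dg' (cg _ _ ab).
  by exists s; [exact: ab|rewrite -g0 -/(g t) gE subr0 mulrC].
have ab (s : R) : s \in `[t, 0] -> `|s| <= `|t|.
  rewrite in_itv /= => /andP[ts s0].
  by rewrite !ler0_norm ?(ltW t0) // lerN2.
have dg' (s : R) : s \in `]t, 0[ -> is_derive s 1 g ('D_v f (s *: v + p)).
  by move=> st; apply/dg/ab; apply: subset_itv_oo_cc st.
have [s st gE] := MVT_segment (ltW t0) dg' (cg _ _ ab).
exists s; first exact: ab.
by apply: oppr_inj; rewrite -g0 -/(g t) opprB gE sub0r mulrN mulrC.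
Qed.

(** Corners of a path from [y0] to [y] that changes one coordinate at a time. *)
Let staircase (y0 y : V) (k : nat) : V :=
  \row_j (if (j < k)%N then y 0 j else y0 0 j).

Let staircaseS y0 y (k : 'I_8) :
  staircase y0 y k.+1 =
  (y 0 k - y0 0 k) *: basis_vec R k + staircase y0 y k.
Proof.
apply/rowP => j; rewrite !mxE ltnS leq_eqVlt eqxx /=.
case: (eqVneq j k) => [->|jk]; first by rewrite eqxx ltnn mulr1 subrK.
by rewrite -(inj_eq val_inj) /= in jk; rewrite (negPf jk) mulr0 add0r.
Qed.

(** [smooth_on] speaks only of derivatives along basis vectors; differentiability comes from their
    continuity, by the mean value theorem on each step of the staircase. *)
Lemma C1_linear_approx f (y0 : V) e : smooth_at f y0 -> 0 < e ->
  \forall y \near y0, `|f y - f y0 -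
     \sum_b (y 0 b - y0 0 b) * 'D_(basis_vec R b) f y0| <=
     e * \sum_b `|y 0 b - y0 0 b|.
Proof.
move=> sf e0.
have : \forall y \near y0, forall b, derivable f y (basis_vec R b) /\
    `|'D_(basis_vec R b) f y - 'D_(basis_vec R b) f y0| < e.
  apply: (@filter_forall _ _ _ (nbhs y0)) => b.
  have cD := smooth_at_cont (smooth_at_derive b sf).
  have /cvgrPdist_lt /(_ e e0) H : 'D_(basis_vec R b) f y @[y --> y0] -->
    'D_(basis_vec R b) f y0 := cD.
  near=> y; split; last by rewrite distrC; near: y; exact: H.
  by apply: smooth_at_derivable; near: y; exact: smooth_at_near.
move=> /nbhs_ballP[d /= d0 Hd]; near=> y.
have yd : `|y0 - y| < d.
  by near: y; apply/nbhs_ballP; exists d => //= y; rewrite -ball_normE.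
have stair (k : 'I_8) : `|f (staircase y0 y k.+1) - f (staircase y0 y k) -
    (y 0 k - y0 0 k) * 'D_(basis_vec R k) f y0| <= e * `|y 0 k - y0 0 k|.
  have inball s : `|s| <= `|y 0 k - y0 0 k| ->
      ball y0 d (s *: basis_vec R k + staircase y0 y k).
    move=> sk; rewrite -ball_normE /=; apply: le_lt_trans yd.
    apply: norm_le_coord => // j; rewrite !mxE eqxx /=.
    have yj : `|y0 0 j - y 0 j| <= `|y0 - y|.
      by have := coord_le_norm (y0 - y) j; rewrite !mxE.
    case: (eqVneq j k) => [->|jk]; first rewrite ltnn mulr1.
      rewrite opprD addrCA subrr addr0 normrN (le_trans sk) // distrC.
      by have := coord_le_norm (y0 - y) k; rewrite !mxE.
    by rewrite mulr0 add0r; case: ifP => // _; rewrite subrr normr0.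
  rewrite staircaseS; have [|s sk ->] := @MVT_line f (staircase y0 y k) (basis_vec R k)
    (y 0 k - y0 0 k).
    by move=> s /inball/Hd/(_ k)[].
  rewrite -mulrBr normrM mulrC ler_wpM2r //.
  by have [_ /ltW] := Hd _ (inball _ sk) k.
have -> : f y - f y0 - \sum_b (y 0 b - y0 0 b) * 'D_(basis_vec R b) f y0 =
    \sum_(k < 8) (f (staircase y0 y k.+1) - f (staircase y0 y k) -
    (y 0 k - y0 0 k) * 'D_(basis_vec R k) f y0).
  rewrite sumrB; congr (_ - _).
  rewrite -(big_mkord xpredT (fun k => f (staircase y0 y k.+1) -
     f (staircase y0 y k))) telescope_sumr //; congr (f _ - f _).
    by apply/rowP => j; rewrite mxE ltn_ord.
  by apply/rowP => j; rewrite mxE.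
rewrite mulr_sumr (le_trans (ler_norm_sum _ _ _)) //.
by apply: ler_sum => k _; exact: stair.
Unshelve. all: by end_near. Qed.

(** The linear approximation of [f] is evaluated along [chi]. Its error is a small multiple of the
    sum of the difference quotients of the coordinates of [chi], and these stay bounded. *)
Lemma chain_rule f (chi : V -> V) (x v : V) (d : 'I_8 -> R) :
  smooth_at f (chi x) ->
  (forall b, is_derive x v (fun y => chi y 0 b) (d b)) ->
  is_derive x v (f \o chi) (\sum_b d b * 'D_(basis_vec R b) f (chi x)).
Proof.
move=> sf dchi.
pose q b (h : R) := h^-1 * (chi (h *: v + x) 0 b - chi x 0 b).
have qE b : q b @ 0^' --> d b.
  have [D <-] := dchi b; exact: D.
(* Continuity of [chi] along the line through [x] in direction [v], which its directional
   derivatives provide. *)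
have chic : chi (h *: v + x) @[h --> 0^'] --> chi x.
  have : derivable chi x v.
    apply/derivable_mxP => i j; rewrite (ord1 i); exact: (@ex_derive _ _ _ _ _ _ _ (dchi j)).
  move=> /derivable1P/derivable1_diffP/differentiable_continuous.
  by move=> /continuous_withinNx; rewrite scale0r add0r.
suff H : (fun h : R => h^-1 *: (f (chi (h *: v + x)) - f (chi x))) @ 0^' -->
    (\sum_b d b * 'D_(basis_vec R b) f (chi x)).
  by apply: DeriveDef; [apply/cvg_ex; eexists; exact: H|exact: cvg_lim H].
pose Q h := \sum_b q b h * 'D_(basis_vec R b) f (chi x).
have QE : Q @ 0^' --> \sum_b d b * 'D_(basis_vec R b) f (chi x).
  apply: cvg_sumr => b; apply: cvgM; [exact: qE|exact: cvg_cst].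
pose S h := \sum_b `|q b h|.
have SE : S @ 0^' --> \sum_b `|d b|.
  by apply: cvg_sumr => b; apply: cvg_norm; exact: qE.
(* Adding 1 makes [K] positive and an eventual strict bound for the sum of the difference
   quotients. *)
pose K := \sum_b `|d b| + 1.
have K0 : 0 < K by rewrite ltr_wpDl // sumr_ge0.
have SK : \forall h \near 0^', S h < K.
  by apply: cvgr_lt SE _ _; rewrite ltrDl.
apply/cvgrPdist_le => e e0.
have e2 : 0 < e / 2 by rewrite divr_gt0.
have eK : 0 < e / 2 / K by rewrite divr_gt0.
have /cvgrPdist_le /(_ _ e2) HQ := QE.
have HA := chic _ (C1_linear_approx sf eK).
near=> h.
have h0 : h != 0 by near: h; exact: nbhs_dnbhs_neq.
have approx : `|f (chi (h *: v + x)) - f (chi x) -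
     \sum_b (chi (h *: v + x) 0 b - chi x 0 b) * 'D_(basis_vec R b) f (chi x)| <=
     e / 2 / K * \sum_b `|chi (h *: v + x) 0 b - chi x 0 b|.
  by near: h; exact: HA.
rewrite -[_ - _](subrKA (Q h)) (le_trans (ler_normD _ _)) // (splitr e) lerD //.
  by near: h; exact: HQ.
have -> : Q h - h^-1 *: (f (chi (h *: v + x)) - f (chi x)) =
    - (h^-1 * (f (chi (h *: v + x)) - f (chi x) -
     \sum_b (chi (h *: v + x) 0 b - chi x 0 b) * 'D_(basis_vec R b) f (chi x))).
  rewrite mulrBr opprB; congr (_ - _); rewrite /Q mulr_sumr.
  by apply: eq_bigr => b _; rewrite /q mulrA.
rewrite normrN normrM.
apply: (@le_trans _ _ (`|h^-1| * (e / 2 / K * \sum_b `|chi (h *: v + x) 0 b - chi x 0 b|))).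
  by rewrite ler_wpM2l.
have -> : `|h^-1| * (e / 2 / K * \sum_b `|chi (h *: v + x) 0 b - chi x 0 b|) =
    e / 2 / K * S h.
  rewrite mulrCA; congr (_ * _); rewrite mulr_sumr; apply: eq_bigr => b _.
  by rewrite /q normrM.
rewrite -[leRHS](divfK (lt0r_neq0 K0)) ler_wpM2l ?(ltW eK) //.
by apply: ltW; near: h; exact: SK.
Unshelve. all: by end_near. Qed.

Lemma is_derive_translate f (c y v : V) : derivable f (c + y) v ->
  is_derive y v (fun y => f (c + y)) ('D_v f (c + y)).
Proof.
move=> D; have E : (fun h : R => h^-1 *: (f (c + (h *: v + y)) - f (c + y))) =
    (fun h : R => h^-1 *: (f (h *: v + (c + y)) - f (c + y))).
  by apply/funext => h; rewrite addrCA.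
apply: DeriveDef; first by rewrite /derivable /= E.
by rewrite /derive /= E.
Qed.

(** The mean value theorem is applied first to the increment of [f] in direction [w], as a function
    along [u], then to the derivative along [u] in direction [w]. *)
Let double_difference f (x u w : V) (t : R) :
  (forall s r, `|s| <= `|t| -> `|r| <= `|t| ->
     derivable f (s *: u + (r *: w + x)) u /\
     derivable (fun y => 'D_u f y) (s *: u + (r *: w + x)) w) ->
  exists s r, [/\ `|s| <= `|t|, `|r| <= `|t| &
    f (t *: u + (t *: w + x)) - f (t *: u + x) - (f (t *: w + x) - f x) =
    t * (t * 'D_w (fun y => 'D_u f y) (s *: u + (r *: w + x)))].
Proof.
have tt : `|t| <= `|t| by [].
have t0' : `|0 : R| <= `|t| by rewrite normr0.
move=> H; pose F y := f (t *: w + y) - f y.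
have DF s : `|s| <= `|t| -> is_derive (s *: u + x) u F
    ('D_u f (t *: w + (s *: u + x)) - 'D_u f (s *: u + x)).
  move=> st; have [+ _] := H s t st tt; rewrite addrCA => /is_derive_translate D1.
  have [+ _] := H s 0 st t0'; rewrite scale0r add0r => /derivableP D2.
  exact: is_deriveB.
have [|s st FE] := @MVT_line F x u t; first by move=> s /DF[].
have [_ E1] := DF s st; rewrite {}E1 in FE.
have [|r rt GE] := @MVT_line (fun y => 'D_u f y) (s *: u + x) w t.
  by move=> r rt; have [_] := H s r st rt; rewrite addrCA.
exists s, r; split=> //; rewrite [s *: u + (r *: w + x)]addrCA -GE -FE /F.
rewrite [t *: u + (t *: w + x)]addrCA.
by move: (f _) (f (t *: u + x)) (f (t *: w + x)) (f x) => ? ? ? ?; ring.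
Qed.

(** The second difference is symmetric in the two directions, so the two mixed derivatives agree at
    two points near [x]; continuity carries the equality to [x]. *)
Lemma derive_comm f x (a b : 'I_8) : smooth_at f x ->
  'D_(basis_vec R b) (fun y => 'D_(basis_vec R a) f y) x =
  'D_(basis_vec R a) (fun y => 'D_(basis_vec R b) f y) x.
Proof.
move=> sf; set ea := basis_vec R a; set eb := basis_vec R b.
have [Dba DbaE] : {h : V -> R | forall y, 'D_eb (fun y => 'D_ea f y) y = h y}.
  by exists (fun y => 'D_eb (fun y => 'D_ea f y) y).
have [Dab DabE] : {h : V -> R | forall y, 'D_ea (fun y => 'D_eb f y) y = h y}.
  by exists (fun y => 'D_ea (fun y => 'D_eb f y) y).
have cba : {for x, continuous Dba}.
  rewrite (_ : Dba = fun y => 'D_eb (fun y => 'D_ea f y) y); last exact/funext.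
  exact: (smooth_at_cont (smooth_at_derive b (smooth_at_derive a sf))).
have cab : {for x, continuous Dab}.
  rewrite (_ : Dab = fun y => 'D_ea (fun y => 'D_eb f y) y); last exact/funext.
  exact: (smooth_at_cont (smooth_at_derive a (smooth_at_derive b sf))).
rewrite DbaE DabE; apply/eqP; rewrite -subr_eq0 -normr_eq0 eq_le normr_ge0 andbT.
apply/ler_addgt0Pr => e e0; rewrite add0r.
have e2 : 0 < e / 2 by rewrite divr_gt0.
have : \forall y \near x, smooth_at f y /\
    (`|Dba x - Dba y| < e / 2 /\ `|Dab x - Dab y| < e / 2).
  have /cvgrPdist_lt /(_ _ e2) H1 : Dba y @[y --> x] --> Dba x := cba.
  have /cvgrPdist_lt /(_ _ e2) H2 : Dab y @[y --> x] --> Dab x := cab.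
  exact: (@filterI _ (nbhs x) _ _ _ (smooth_at_near sf)
    (@filterI _ (nbhs x) _ _ _ H1 H2)).
move=> /nbhs_ballP[d /= d0 Hd].
(* Two displacements of length at most d/4 keep the intermediate points inside the ball of radius
   d. *)
pose t := d / 4.
have t0 : 0 < t by rewrite divr_gt0.
have inb s r : `|s| <= `|t| -> `|r| <= `|t| -> ball x d (s *: ea + (r *: eb + x)).
  move=> st rt; rewrite -ball_normE /= addrA opprD addrCA subrr addr0 normrN.
  apply: (@le_lt_trans _ _ (`|s| * 1 + `|r| * 1)).
    rewrite (le_trans (ler_normD _ _)) // lerD // normrZ ler_wpM2l //;
      exact: norm_basis_vec.
  rewrite !mulr1; rewrite (gtr0_norm t0) /t in st rt; lra.
have [|s [r [st rt E1]]] := @double_difference f x ea eb t.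
  move=> s r st rt; have [sy _] := Hd _ (inb s r st rt).
  by split; apply: smooth_at_derivable => //; exact: smooth_at_derive.
have [|s' [r' [st' rt' E2]]] := @double_difference f x eb ea t.
  move=> s' r' st' rt'; have [sy _] := Hd _ (inb r' s' rt' st').
  rewrite [s' *: eb + _]addrCA.
  by split; apply: smooth_at_derivable => //; exact: smooth_at_derive.
rewrite DbaE in E1; rewrite DabE in E2.
have E : Dba (s *: ea + (r *: eb + x)) = Dab (s' *: eb + (r' *: ea + x)).
  apply: (mulfI (lt0r_neq0 t0)); apply: (mulfI (lt0r_neq0 t0)).
  rewrite -[LHS]E1 -[RHS]E2 [t *: eb + (t *: ea + x)]addrCA.
  by move: (f _) (f (t *: ea + x)) (f (t *: eb + x)) (f x) => ? ? ? ?; ring.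
have [_ [B1 _]] := Hd _ (inb s r st rt).
have [_ [_ B2]] := Hd _ (inb r' s' rt' st').
rewrite [r' *: ea + _]addrCA -E in B2.
rewrite -(subrKA (Dba (s *: ea + (r *: eb + x)))) (le_trans (ler_normD _ _)) //.
by rewrite (splitr e) lerD // ltW // distrC.
Qed.

End Derivatives.

(** * Flat functions *)

Section Bump.
Variable R : realType.
Local Notation V := 'rV[R]_8.

(** t^-k exp (- 1/t) extended by zero. The whole family in [k] is considered because it is closed
    under differentiation up to linear combinations. *)
Definition flat (k : nat) (t : R) : R :=
  if 0 < t then t ^- k * expR (- t^-1) else 0.

(** With u = 1/t, the exponential series gives exp u >= u^(k+1) / (k+1)!, one power more than
    [flat k] divides by. *)
Lemma flat_le k (t : R) : `|flat k t| <= k.+1`!%:R * `|t|.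
Proof.
rewrite /flat; case: ifPn => t0; last by rewrite normr0 mulr_ge0.
have u0 : 0 < t^-1 by rewrite invr_gt0.
rewrite ger0_norm; last by rewrite mulr_ge0 ?expR_ge0 // invr_ge0 exprn_ge0 // ltW.
rewrite gtr0_norm // expRN -exprVn ler_pdivrMr ?expR_gt0 //.
have F0 : 0 < (k.+1`!%:R : R) by rewrite ltr0n fact_gt0.
have -> : t^-1 ^+ k = k.+1`!%:R * t * (t^-1 ^+ k.+1 / k.+1`!%:R).
  by rewrite exprS; field; rewrite !gt_eqF.
apply: ler_wpM2l; first by rewrite mulr_ge0 // ltW.
by rewrite (le_trans _ (expR_ge1Dxn k (ltW u0))) // lerDr.
Qed.

Lemma flat_gt0 k (t : R) : 0 < t -> 0 < flat k t.
Proof.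
by move=> t0; rewrite /flat t0 mulr_gt0 ?expR_gt0 // invr_gt0 exprn_gt0.
Qed.

Lemma flat_le0 k (t : R) : t <= 0 -> flat k t = 0.
Proof. by rewrite /flat ltNge => ->. Qed.

Lemma flat_ge0 k (t : R) : 0 <= flat k t.
Proof.
by have [/(flat_le0 k) ->|/(flat_gt0 k)/ltW] := leP t 0.
Qed.

Lemma flat_is_derive k (t : R) :
  is_derive t 1 (flat k) (flat k.+2 t - k%:R * flat k.+1 t).
Proof.
have [t0|t0|->] := ltgtP t 0.
- have E : \forall s \near t, (fun=> 0 : R) s = flat k s.
    near=> s; rewrite flat_le0 //; apply: ltW; near: s.
    exact: (@cvgr_lt _ _ (nbhs t) _ id t (@cvg_id _ _)).
  rewrite !flat_le0 ?ltW // mulr0 subr0.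
  exact: near_eq_is_derive E (is_derive_cst _ _ _).
- have E : \forall s \near t, (fun s : R => (s ^+ k)^-1 * expR (- s^-1)) s = flat k s.
    near=> s; rewrite /flat ifT //; near: s.
  exact: (@cvgr_gt _ _ (nbhs t) _ id t (@cvg_id _ _)).
  apply: near_eq_is_derive E _.
  have tk : t ^+ k != 0 by rewrite expf_neq0 // gt_eqF.
  have tn : t != 0 by rewrite gt_eqF.
  have D1 : is_derive t 1 (fun s : R => (s ^+ k)^-1)
      (- (t ^+ k) ^- 2 * (k%:R * t ^+ k.-1)).
    have D : is_derive t 1 (fun s : R => s ^+ k) (k%:R * t ^+ k.-1).
      apply: DeriveDef; first exact: exprn_derivable.
      by rewrite exp_derive /GRing.scale /= mulr1.
    apply: DeriveDef; first by apply: derivableV => //; case: D.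
    have [Da Db] := D; by rewrite deriveV // Db.
  have D2 : is_derive t 1 (fun s : R => - s^-1) (t ^- 2).
    have D : is_derive t 1 (fun s : R => s^-1) (- t ^- 2).
      apply: DeriveDef; first exact: derivableV.
      by rewrite (@deriveV _ _ id) // derive_id [_ *: 1]mulr1.
    by rewrite -[t ^- 2]opprK; exact: is_deriveN.
  have D3 : is_derive t 1 (fun s : R => expR (- s^-1)) (expR (- t^-1) * t ^- 2).
    have := @is_derive1_comp _ expR (fun s => - s^-1) t _ _
      (is_derive_expR (- t^-1)) D2.
    by [].
  have H := is_deriveM D1 D3; apply: (is_derive_eq H).
  rewrite /flat t0 /GRing.scale /=; case: k {D1 H} tk => [|k] tk.
    by rewrite !expr0 !mul0r !mulr0; field.
  by rewrite /= !exprS -!natr1; field; rewrite tn /= expf_neq0.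
- rewrite !flat_le0 // mulr0 subr0.
  suff H : (fun h : R => h^-1 *: (flat k (h *: (1 : R) + 0) - flat k 0)) @ 0^' --> (0 : R).
    by apply: DeriveDef; [apply/cvg_ex; eexists; exact: H|exact: cvg_lim H].
  (* At 0 the difference quotient is exactly [flat k.+1], which tends to 0 by [flat_le]. *)
  have -> : (fun h : R => h^-1 *: (flat k (h *: (1 : R) + 0) - flat k 0)) = flat k.+1.
    apply/funext => h; rewrite addr0 [h *: 1]mulr1 (flat_le0 k (lexx 0)) subr0.
    rewrite /flat; case: ifP; rewrite ?scaler0 // => h0.
    by rewrite /GRing.scale /= mulrA -invfM -exprS.
  have B0 : 0 < (k.+2`!%:R : R) by rewrite ltr0n fact_gt0.
  apply/cvgrPdist_le => e e0; near=> h.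
  rewrite sub0r normrN (le_trans (flat_le _ _)) // -ler_pdivlMl // mulrC.
  by near: h; apply: dnbhs0_le; rewrite divr_gt0.
Unshelve. all: by end_near. Qed.

Lemma flat_continuous k (t : R) : {for t, continuous (flat k)}.
Proof.
apply: differentiable_continuous; apply/derivable1_diffP.
by have [] := flat_is_derive k t.
Qed.

Lemma is_derive_comp1 (h : R -> R) (f : V -> R) (x v : V) (dh df : R) :
  is_derive (f x) 1 h dh -> is_derive x v f df ->
  is_derive x v (h \o f) (dh * df).
Proof.
move=> Dh [Df <-].
have D0 : derivable f (0 *: v + x) v by rewrite scale0r add0r.
have := line_is_derive D0; rewrite scale0r add0r => D1.
have Dh' : is_derive (f (0 *: v + x)) 1 h dh by rewrite scale0r add0r.
have [D2 E2] := @is_derive1_comp _ h (fun s : R => f (s *: v + x)) 0 _ _ Dh' D1.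
have D3 : derivable (h \o f) x v by exact: (proj2 (derivable1P (h \o f) x v) D2).
apply: DeriveDef => //.
rewrite -E2 /derive.
have -> // : (fun s : R => s^-1 *: (h (f (s *: v + x)) - h (f x))) =
  (fun s : R => s^-1 *: (h (f ((s *: (1 : R) + 0) *: v + x)) - h (f (0 *: v + x)))).
by apply/funext => s; rewrite addr0 scale0r add0r [s *: 1]mulr1.
Qed.

(** The induction on the order is uniform in [k], since each derivative raises [k] by one or two. *)
Lemma smooth_at_flat k (f : V -> R) x :
  smooth_at f x -> smooth_at (fun y => flat k (f y)) x.
Proof.
move=> [U [oU Ux] sU]; exists U => // n.
elim: n k => [|n IH] k; (split; first by
  move=> y Uy;
  exact: (continuous_comp (Cn_on_cont (sU 0%N) Uy) (@flat_continuous k (f y)))).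
  by [].
move=> a; have D y : U y -> is_derive y (basis_vec R a) (fun y => flat k (f y))
    ((flat k.+2 (f y) - k%:R * flat k.+1 (f y)) * 'D_(basis_vec R a) f y).
  move=> Uy; apply: is_derive_comp1; first exact: flat_is_derive.
  by apply: derivableP; have [_ /(_ a)[+ _]] := sU 1%N; exact.
split; first by move=> y /D[].
apply: (@Cn_on_eq _ _ _ (fun y => (flat k.+2 (f y) + - k%:R * flat k.+1 (f y)) *
    'D_(basis_vec R a) f y)) => //.
  by move=> y /D[_ ->]; rewrite mulNr.
apply: Cn_onM => //; last by have [_ /(_ a)[_]] := sU n.+1.
apply: Cn_onD => //.
by apply: Cn_onM => //; exact: Cn_on_cst.
Qed.

End Bump.

(** * Charts *)

Section Charts.
Variables (R : realType) (M : manifold R).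
Local Notation V := 'rV[R]_8.
Implicit Types (i j k : chart_index M) (p q : M) (f h : M -> R).

Definition chart_image i : set V := chart i @` chart_dom i.

Lemma chart_imageP i p : chart_dom i p -> chart_image i (chart i p).
Proof. by exists p. Qed.

Lemma chart_invK i x : chart_image i x ->
  chart_dom i (chart_inv i x) /\ chart i (chart_inv i x) = x.
Proof. by move=> [p ip <-]; rewrite (chartK ip). Qed.

Lemma chart_cont i p : chart_dom i p -> {for p, continuous (chart i)}.
Proof.
have := @chart_continuous _ M i; rewrite continuous_open_subspace; last exact: dom_open.
by move=> + ip; apply; rewrite inE.
Qed.

Lemma chart_inv_cont i x : chart_image i x -> {for x, continuous (chart_inv i)}.
Proof.
have := @chart_inv_continuous _ M i; rewrite continuous_open_subspace;
  last exact: chart_image_open.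
by move=> + ix; apply; rewrite inE.
Qed.

Lemma near_dom i p : chart_dom i p -> \forall q \near p, chart_dom i q.
Proof. by move=> ip; apply: open_nbhs_nbhs; split=> //; exact: dom_open. Qed.

Lemma near_image i x : chart_image i x -> \forall y \near x, chart_image i y.
Proof. by move=> ix; apply: open_nbhs_nbhs; split=> //; exact: chart_image_open. Qed.

Lemma near_chart i p (P : set M) : chart_dom i p -> (\forall q \near p, P q) ->
  \forall x \near chart i p, P (chart_inv i x).
Proof.
move=> ip Pp; have := chart_inv_cont (chart_imageP ip); apply.
by rewrite /= (chartK ip).
Qed.

Lemma near_chart_inv i p (P : set V) : chart_dom i p ->
  (\forall x \near chart i p, P x) -> \forall q \near p, P (chart i q).
Proof. by move=> ip; exact: chart_cont. Qed.

Definition msmooth i f p := smooth_at (f \o chart_inv i) (chart i p).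

Lemma msmooth_eq i f h p : chart_dom i p -> (\forall q \near p, f q = h q) ->
  msmooth i f p -> msmooth i h p.
Proof. by move=> ip fh; apply: smooth_at_eq; exact: near_chart fh. Qed.

Lemma smooth_comp_at i f p : chart_dom i p -> smooth_comp i f -> msmooth i f p.
Proof.
move=> ip sf; apply: smooth_on_at sf; first exact: chart_image_open.
exact: chart_imageP.
Qed.

Lemma smooth_compP i f : (forall p, chart_dom i p -> msmooth i f p) ->
  smooth_comp i f.
Proof.
move=> sf; apply: smooth_at_on => x [p ip <-]; exact: sf.
Qed.

Lemma msmooth_cont i f p : chart_dom i p -> msmooth i f p -> {for p, continuous f}.
Proof.
move=> ip sf.
have C : {for p, continuous ((f \o chart_inv i) \o chart i)}.
  apply: continuous_comp; first exact: chart_cont.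
  exact: smooth_at_cont.
have E : f p = ((f \o chart_inv i) \o chart i) p by rewrite /= chartK.
suff : f @ p --> f p by [].
rewrite E; apply: cvg_trans C.
apply: (@near_eq_cvg _ _ (nbhs p)).
by apply: filterS (near_dom ip) => q iq; rewrite /= (chartK iq).
Qed.

(** [transition_smooth] concerns the image of the overlap; continuity of [chart_inv] shows that this
    image contains a neighbourhood of the point. *)
Lemma msmooth_transition i j p b : chart_dom i p -> chart_dom j p ->
  msmooth i (fun q => chart j q 0 b) p.
Proof.
move=> ip jp.
have sT := @transition_smooth _ M i j b.
have : \forall x \near chart i p, chart_dom i (chart_inv i x) /\ chart_dom j (chart_inv i x).
  apply: (near_chart (P := fun q => chart_dom i q /\ chart_dom j q)) => //.
  by apply: filterI; exact: near_dom.
move=> H; have : nbhs (chart i p) [set x | (chart_dom i (chart_inv i x) /\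
    chart_dom j (chart_inv i x)) /\ chart_image i x].
  exact: (@filterI _ (nbhs (chart i p)) _ _ _ H (near_image (chart_imageP ip))).
rewrite nbhsE => -[U [oU Ux] HU]; exists U; first by split.
move=> n; apply: Cn_on_sub (sT n).
move=> x /HU[[ix jx] xi]; exists (chart_inv i x) => //.
by have [] := chart_invK xi.
Qed.

Lemma near_partial_comp i f p a : chart_dom i p ->
  \forall x \near chart i p, (partial i a f \o chart_inv i) x =
    'D_(basis_vec R a) (f \o chart_inv i) x.
Proof.
move=> ip; apply: filterS (near_image (chart_imageP ip)) => x xi.
by rewrite /= /partial; have [_ ->] := chart_invK xi.
Qed.

Lemma msmooth_partial i f p a : chart_dom i p -> msmooth i f p ->
  msmooth i (partial i a f) p.
Proof.
move=> ip sf; apply: smooth_at_eq (smooth_at_derive a sf).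
by apply: filterS (near_partial_comp f a ip) => x ->.
Qed.

Lemma partial_comm i f p a b : chart_dom i p -> msmooth i f p ->
  partial i b (partial i a f) p = partial i a (partial i b f) p.
Proof.
move=> ip sf; rewrite /partial.
rewrite (near_eq_derive _ (near_partial_comp f a ip)).
by rewrite (near_eq_derive _ (near_partial_comp f b ip)) derive_comm.
Qed.

Lemma partial_eq i f h p a : chart_dom i p -> (\forall q \near p, f q = h q) ->
  partial i a f p = partial i a h p.
Proof.
move=> ip fh; apply: near_eq_derive.
exact: (near_chart (P := fun q => f q = h q)).
Qed.

Definition pderivable i a f p :=
  derivable (f \o chart_inv i) (chart i p) (basis_vec R a).

Lemma msmooth_pderivable i a f p : msmooth i f p -> pderivable i a f p.
Proof. exact: smooth_at_derivable. Qed.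

Lemma pderivableM i a f h p : pderivable i a f p -> pderivable i a h p ->
  pderivable i a (fun q => f q * h q) p.
Proof. exact: derivableM. Qed.

Lemma pderivable_sum (I : Type) (r : seq I) (P : pred I) (F : I -> M -> R) i p a :
  (forall n, P n -> pderivable i a (F n) p) ->
  pderivable i a (fun q => \sum_(n <- r | P n) F n q) p.
Proof.
move=> dF; elim: r => [|n r IH].
  have -> : (fun q => \sum_(n <- [::] | P n) F n q) = fun=> 0.
    by apply/funext => q; rewrite big_nil.
  exact: derivable_cst.
case Pn : (P n).
  have -> : (fun q => \sum_(n <- n :: r | P n) F n q) =
      fun q => F n q + \sum_(n <- r | P n) F n q.
    by apply/funext => q; rewrite big_cons Pn.
  by apply: derivableD => //; exact: dF.
have -> // : (fun q => \sum_(n <- n :: r | P n) F n q) =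
    fun q => \sum_(n <- r | P n) F n q.
by apply/funext => q; rewrite big_cons Pn.
Qed.

Lemma partialD i f h p a : pderivable i a f p -> pderivable i a h p ->
  partial i a (fun q => f q + h q) p = partial i a f p + partial i a h p.
Proof. by move=> df dh; rewrite /partial -deriveD. Qed.

Lemma partialM i f h p a : chart_dom i p ->
  pderivable i a f p -> pderivable i a h p ->
  partial i a (fun q => f q * h q) p =
  partial i a f p * h p + f p * partial i a h p.
Proof.
move=> ip df dh; rewrite [LHS](deriveM (f := f \o chart_inv i)
  (g := h \o chart_inv i)) //.
by rewrite /= (chartK ip) addrC mulrC.
Qed.

Lemma partial_cst i p a (c : R) : partial i a (fun=> c) p = 0.
Proof. exact: derive_cst. Qed.

Lemma partial_sum (I : Type) (r : seq I) (P : pred I) (F : I -> M -> R) i p a :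
  (forall n, P n -> pderivable i a (F n) p) ->
  partial i a (fun q => \sum_(n <- r | P n) F n q) p =
  \sum_(n <- r | P n) partial i a (F n) p.
Proof.
move=> sF; elim: r => [|n r IH].
  rewrite [RHS]big_nil -[RHS](partial_cst i p a 0); congr partial.
  by apply/funext => q; rewrite big_nil.
rewrite big_cons; case Pn : (P n); last first.
  by rewrite -IH; congr partial; apply/funext => q; rewrite big_cons Pn.
rewrite -IH -partialD; [|exact: sF|exact: pderivable_sum].
by congr partial; apply/funext => q; rewrite big_cons Pn.
Qed.

(** Near the point, [f] read in chart [i] is [f] read in chart [j] composed with the transition map,
    whose partial derivatives are the entries of the Jacobian. *)
Let is_derive_chain i j f p a : chart_dom i p -> chart_dom j p -> msmooth j f p ->
  is_derive (chart i p) (basis_vec R a) (f \o chart_inv i)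
  (\sum_b transition_jacobian i j p a b * partial j b f p).
Proof.
move=> ip jp sf.
pose chi x := chart j (chart_inv i x).
have chip : chi (chart i p) = chart j p by rewrite /chi chartK.
have D b : is_derive (chart i p) (basis_vec R a) (fun y => chi y 0 b)
    (transition_jacobian i j p a b).
  rewrite mxE; apply: derivableP.
  exact: smooth_at_derivable (msmooth_transition b ip jp).
have sf' : smooth_at (f \o chart_inv j) (chi (chart i p)) by rewrite chip.
have := chain_rule sf' D; rewrite chip; apply: near_eq_is_derive.
have H := near_chart ip (near_dom jp).
by apply: filterS H => x jx; rewrite /= /chi chartK.
Qed.

Lemma pderivable_chain i j f p a : chart_dom i p -> chart_dom j p ->
  msmooth j f p -> pderivable i a f p.
Proof. by move=> ip jp /(is_derive_chain a ip jp)[]. Qed.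

Lemma partial_chain i j f p a : chart_dom i p -> chart_dom j p -> msmooth j f p ->
  partial i a f p =
  \sum_b transition_jacobian i j p a b * partial j b f p.
Proof. by move=> ip jp /(is_derive_chain a ip jp)[]. Qed.

Lemma transition_jacobian_comp i j k p :
  chart_dom i p -> chart_dom j p -> chart_dom k p ->
  transition_jacobian i k p =
  transition_jacobian i j p *m transition_jacobian j k p.
Proof.
move=> ip jp kp; apply/matrixP => a b; rewrite !mxE (partial_chain _ ip jp).
  by apply: eq_bigr => c _; rewrite [transition_jacobian j k p _ _]mxE.
exact: msmooth_transition.
Qed.

Lemma transition_jacobian_id i p : chart_dom i p ->
  transition_jacobian i i p = 1%:M.
Proof.
move=> ip; apply/matrixP => a b; rewrite !mxE -(derive_coord b (chart i p) a).
apply: near_eq_derive; apply: filterS (near_image (chart_imageP ip)) => x xi.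
by rewrite /=; have [_ ->] := chart_invK xi.
Qed.

Lemma msmooth_jacobian i j p a b : chart_dom i p -> chart_dom j p ->
  msmooth i (fun q => transition_jacobian i j q a b) p.
Proof.
move=> ip jp; apply: (msmooth_eq ip _ (msmooth_partial a ip (msmooth_transition b ip jp))).
by near=> q; rewrite mxE.
Unshelve. all: by end_near. Qed.

Lemma partial_jacobian_sym i j p a b c : chart_dom i p -> chart_dom j p ->
  partial i a (fun q => transition_jacobian i j q b c) p =
  partial i b (fun q => transition_jacobian i j q a c) p.
Proof.
move=> ip jp; have E a' b' : partial i a' (fun q => transition_jacobian i j q b' c) p =
    partial i a' (partial i b' (fun q => chart j q 0 c)) p.
  by apply: partial_eq => //; near=> q; rewrite mxE.
by rewrite !E partial_comm //; exact: msmooth_transition.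
Unshelve. all: by end_near. Qed.

End Charts.

(** * Densities of the terms of the Lagrangian *)

(** The four terms of an exterior derivative contribute equally: a transposition brings the
    derivative index to slot 4, and its sign together with the reordering of [D e] cancels
    (-1)^m. *)
Lemma top_sum_ext_d (R : realType) (u : tensor R 4) (D : 'I_8 -> tensor R 3) :
  (forall e, alternating (D e)) ->
  top_sum (fun a => u (first4 a) * \sum_(m < 4) (-1) ^+ m *
    D (tnth (last4 a) m) [tuple tnth (last4 a) (lift m n) | n < 3]) =
  4 * top_sum (fun a => u (first4 a) * D a`_4 [tuple a`_5; a`_6; a`_7]).
Proof.
move=> aD; set S := top_sum (fun a => u (first4 a) * D a`_4 _).
have Fperm (i : 'I_8) a : (4 < i)%N ->
    first4 (permute_idx (tperm (Ordinal (isT : 4 < 8)%N) i) a) = first4 a.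
  move=> i4; rewrite [LHS]first4E [RHS]first4E !nth_permute_tperm //=.
  by case: i i4 => -[|[|[|[|?]]]].
transitivity (\sum_(m < 4) (-1) ^+ m * top_sum (fun a => u (first4 a) *
    D (tnth (last4 a) m) [tuple tnth (last4 a) (lift m n) | n < 3])).
  under [RHS]eq_bigr => m _ do rewrite -top_sumZ.
  rewrite -top_sum_sum; apply: eq_top_sum => a; rewrite mulr_sumr.
  by apply: eq_bigr => m _; rewrite mulrCA.
have tE (m : 'I_4) (n : 'I_3) (a : 4.-tuple 'I_8) :
    [tuple tnth a (lift m n) | n < 3]`_n = a`_(bump m n).
  by rewrite -(tnth_nth 0) tnth_mktuple (tnth_nth 0).
have E0 (a : 4.-tuple 'I_8) (m : 'I_4) : [tuple tnth a (lift m n) | n < 3] =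
    [tuple a`_(bump m 0); a`_(bump m 1); a`_(bump m 2)].
  rewrite [LHS]tuple3E; congr [tuple _; _; _].
  - exact: (tE m (Ordinal (isT : 0 < 3)%N)).
  - exact: (tE m (Ordinal (isT : 1 < 3)%N)).
  - exact: (tE m (Ordinal (isT : 2 < 3)%N)).
rewrite !big_ord_recl big_ord0 /= addr0.
have -> : 4 * S = 1 * S + (- 1 * - S + (1 * S + - 1 * - S)) by ring.
have -> : (-1) ^+ bump 0 (bump 0 (bump 0 0)) = -1 :> R.
  by rewrite /bump /= -[(-1) ^+ _]signr_odd.
have -> : (-1) ^+ bump 0 (bump 0 0) = 1 :> R.
  by rewrite /bump /= -[(-1) ^+ _]signr_odd.
rewrite !expr0 !mul1r.
congr (_ + (_ * _ + (_ + _ * _))).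
- apply: eq_top_sum => a; congr (_ * _).
  by rewrite E0 !(tnth_nth 0) /= /bump /= !nth_last4.
- apply: (@top_sum_swap _ (Ordinal (isT : 4 < 8)%N) (Ordinal (isT : 5 < 8)%N)) => //.
  move=> a; rewrite Fperm // !nth_permute_tperm //=; congr (_ * _).
  by rewrite E0 !(tnth_nth 0) /= /bump /= !nth_last4.
- have -> : S = - top_sum (fun a => - (u (first4 a) * D a`_4 [tuple a`_5; a`_6; a`_7])).
    rewrite -mulN1r -top_sumZ; apply: eq_top_sum => a.
    by rewrite mulN1r opprK.
  apply: (@top_sum_swap _ (Ordinal (isT : 4 < 8)%N) (Ordinal (isT : 6 < 8)%N)) => //.
  move=> a.
  rewrite Fperm // !nth_permute_tperm //= -mulrN; congr (_ * _).
  rewrite E0 !(tnth_nth 0) /= /bump /= !nth_last4 //.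
  by rewrite alternating3_102 // opprK.
- apply: (@top_sum_swap _ (Ordinal (isT : 4 < 8)%N) (Ordinal (isT : 7 < 8)%N)) => //.
  move=> a; rewrite Fperm // !nth_permute_tperm //=; congr (_ * _).
  rewrite E0 !(tnth_nth 0) /= /bump /= !nth_last4 //.
  by rewrite alternating3_102 // alternating3_021 // opprK.
Qed.

Section Fields.
Variables (R : realType) (M : manifold R).
Implicit Types (i j : chart_index M) (p q : M).

Section Forms.
Variables (k : nat) (w : tensor_field M k).
Hypothesis fw : is_form w.

Lemma form_msmooth i p a : chart_dom i p -> msmooth i (fun q => w i q a) p.
Proof. by move=> ip; case: fw => sw _ _; exact: smooth_comp_at (sw i a). Qed.

Lemma form_alternating i p : chart_dom i p -> alternating (w i p).
Proof. by move=> ip; case: fw => _ aw _; exact: aw. Qed.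

Lemma partial_alternating i p e : chart_dom i p ->
  alternating (fun a => partial i e (fun q => w i q a) p).
Proof.
move=> ip s a.
transitivity (partial i e (fun q => (-1) ^+ s * w i q a) p).
  apply: partial_eq => //; apply: filterS (near_dom ip) => q iq.
  by rewrite form_alternating.
rewrite partialM //; first by rewrite partial_cst mul0r add0r.
  exact: derivable_cst.
by apply: msmooth_pderivable; exact: form_msmooth.
Qed.

End Forms.

Section Densities.
Variables (Phi : tensor_field M 4) (g : matrix_field M).

(** By [top_sum_ext_d], 4/576 times this is the top component of Phi /\ dc in the chart [i]. *)
Definition density_d i p (c : tensor_field M 3) : R :=
  top_sum (fun a => Phi i p (first4 a) *
    partial i a`_4 (fun q => c i q [tuple a`_5; a`_6; a`_7]) p).

Definition density_contract i p (C c : tensor_field M 3) : R :=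
  top_sum (fun a => Phi i p (first4 a) *
    contract (invmx (g i p)) (C i p) (c i p) (last4 a)).

Definition density_vol i p : R :=
  top_sum (fun a => Phi i p (first4 a) * Phi i p (last4 a)).

Lemma vol_form_top i p : vol_form Phi i p top_idx = (14 * 576)^-1 * density_vol i p.
Proof. by rewrite /vol_form wedge_top mulrA -invfM. Qed.

Lemma lagrangian_top lambda (C : tensor_field M 3) i p :
  is_form C -> chart_dom i p ->
  lagrangian Phi g lambda C i p top_idx =
  576^-1 * (4 * density_d i p C - 6 * density_contract i p C C) +
  lambda / 6 * vol_form Phi i p top_idx.
Proof.
move=> fC ip; rewrite /lagrangian; congr (_ + _).
rewrite wedge_top; congr (_ * _).
rewrite /density_d -(top_sum_ext_d (Phi i p)
  (D := fun e a => partial i e (fun q => C i q a) p)); last first.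
  by move=> e; exact: partial_alternating.
rewrite /density_contract -top_sum_alt_last.
rewrite -mulNr -top_sumZ -top_sumD; apply: eq_top_sum => a.
by rewrite mulrBr; congr (_ + _); rewrite mulNr mulrCA.
Qed.

Hypothesis hPhi : is_cayley_form Phi.
Hypothesis hg : is_metric_of Phi g.

Let fPhi : is_form Phi. Proof. by case: hPhi. Qed.

Lemma metric_coframe i p : chart_dom i p -> exists A : 'M[R]_8,
  [/\ A \in unitmx, Phi i p = pullback A (@Phi0 R) & g i p = A^T *m A].
Proof.
move=> ip; have [_ /(_ i p ip)[A [Au AP gA]]] := hg; exists A; split=> //.
exact/funext.
Qed.

Lemma metric_unit i p : chart_dom i p -> g i p \in unitmx.
Proof.
by move=> /metric_coframe[A [Au _ ->]]; rewrite unitmx_mul unitmx_tr Au.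
Qed.

Lemma inv_metric_sym i p a b : chart_dom i p ->
  invmx (g i p) a b = invmx (g i p) b a.
Proof.
move=> ip; have [[_ sg _ _] _] := hg.
by rewrite -[in LHS](sg i p ip) -trmx_inv mxE.
Qed.

Let c0 := top_sum (fun a => Phi0 R (first4 a) * Phi0 R (last4 a)).

Lemma density_vol_coframe i p A : Phi i p = pullback A (@Phi0 R) ->
  density_vol i p = \det A * c0.
Proof. by move=> AP; rewrite /density_vol AP top_sum_pullback2. Qed.

Lemma density_vol_neq0 i p : chart_dom i p -> density_vol i p != 0.
Proof.
move=> /metric_coframe[A [Au /density_vol_coframe -> _]].
by rewrite mulf_neq0 ?Phi0_volume // -unitfE -unitmxE.
Qed.

(** In an orthonormal coframe det g = (det A)^2, so Phi /\ Phi and the Riemannian density differ by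
    a sign and the universal constant [c0]. *)
Lemma normr_density_vol i p : chart_dom i p ->
  `|density_vol i p| = Num.sqrt (\det (g i p)) * `|c0|.
Proof.
move=> /metric_coframe[A [_ /density_vol_coframe -> ->]].
by rewrite normrM det_mulmx det_tr -expr2 sqrtr_sqr.
Qed.

Section Transition.
Variables (i j : chart_index M) (p : M).
Hypotheses (ip : chart_dom i p) (jp : chart_dom j p).
Let A := (transition_jacobian i j p)^T.

Lemma form_transition (k : nat) (w : tensor_field M k) : is_form w ->
  w i p = pullback A (w j p).
Proof. by case=> _ _ tw; apply/funext => a; exact: tw. Qed.

Lemma density_vol_transition : density_vol i p = \det A * density_vol j p.
Proof. by rewrite /density_vol (form_transition fPhi) top_sum_pullback2. Qed.

(** Invertibility of the Jacobian is read off from Phi /\ Phi, which is non-zero in chart [i] and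
    carries this determinant as a factor. *)
Lemma det_transition_neq0 : \det A != 0.
Proof.
have := density_vol_neq0 ip; rewrite density_vol_transition.
by apply: contra_neq => ->; rewrite mul0r.
Qed.

Lemma density_contract_transition C c : is_form C -> is_form c ->
  density_contract i p C c = \det A * density_contract j p C c.
Proof.
move=> fC fc; rewrite /density_contract -top_sum_pullback2.
apply: eq_top_sum => a; rewrite -(form_transition fPhi); congr (_ * _).
rewrite (contract_pullback (G := invmx (g i p))).
  by rewrite -!form_transition.
have [[_ _ _ tg] _] := hg.
have AT : A^T = transition_jacobian i j p by rewrite trmxK.
have gE : g i p = A^T *m g j p *m A by rewrite AT -tg.
have Au : A \in unitmx by rewrite unitmxE unitfE det_transition_neq0.
(* From g_i = A^T g_j A it remains to deduce g_j^-1 = A g_i^-1 A^T, the transformation law of upper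
   indices. *)
have gju := metric_unit jp.
rewrite -[RHS](mulmxK gju) -[LHS]mul1mx; congr (_ *m _).
rewrite -[LHS](mulmxV Au) -!mulmxA; congr (A *m _).
have giu := metric_unit ip.
apply: (can_inj (mulmxK Au)); rewrite mulVmx // -!mulmxA [A^T *m _]mulmxA -gE.
by rewrite mulVmx.
Qed.

Lemma density_d_transition c : is_form c ->
  density_d i p c = \det A * density_d j p c.
Proof.
move=> fc; rewrite /density_d.
rewrite -(@top_sum_pullback_derivative _ A (Phi j p) (c j p)
  (fun b e x => partial i e (fun q => transition_jacobian i j q x b) p)
  (fun e a => partial i e (fun q => c i q a) p)
  (fun e a => partial j e (fun q => c j q a) p)).
- by rewrite -form_transition.
- by move=> b e x; exact: partial_jacobian_sym.
move=> e x y z.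
pose J a b q := transition_jacobian i j q a b.
have sJ a b : msmooth i (J a b) p by exact: msmooth_jacobian.
(* The transition law of [c] holds on a neighbourhood of [p], so it may be differentiated; the
   product rule then separates derivatives of the Jacobian from those of [c]. *)
transitivity (partial i e (fun q => \sum_(b < 8) \sum_(k < 8) \sum_(d < 8)
    J x b q * J y k q * J z d q * c j q [tuple b; k; d]) p).
  apply: partial_eq => //.
  apply: filterS (@filterI _ (nbhs p) _ _ _ (near_dom ip) (near_dom jp)) => q [iq jq].
  have [_ _ tc] := fc; rewrite (tc i j q _ iq jq).
  rewrite pullback3E; apply: eq_bigr => b _; apply: eq_bigr => k _.
  by apply: eq_bigr => d _; rewrite /J !mxE.
have dJ a b l : pderivable i l (J a b) p by exact: msmooth_pderivable.
have dc a l : pderivable i l (fun q => c j q a) p.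
  exact: (pderivable_chain ip jp (form_msmooth fc a jp)).
rewrite partial_sum => [|b _]; last first.
  apply: pderivable_sum => k _; apply: pderivable_sum => d _.
  by do 3 (apply: pderivableM => //).
apply: eq_bigr => b _; rewrite partial_sum => [|k _]; last first.
  by apply: pderivable_sum => d _; do 3 (apply: pderivableM => //).
apply: eq_bigr => k _; rewrite partial_sum => [|d _]; last first.
  by do 3 (apply: pderivableM => //).
apply: eq_bigr => d _.
rewrite partialM //; last by do 2 (apply: pderivableM => //).
rewrite partialM //; last by apply: pderivableM.
rewrite partialM // (partial_chain e ip jp (form_msmooth fc _ jp)).
rewrite /J /A.
have -> : \sum_f (transition_jacobian i j p)^T f e *
    partial j f (fun q => c j q [tuple b; k; d]) p =
    \sum_f transition_jacobian i j p e f *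
    partial j f (fun q => c j q [tuple b; k; d]) p.
  by apply: eq_bigr => f _; rewrite mxE.
rewrite !mxE; ring.
Qed.

End Transition.
End Densities.
End Fields.

Lemma smooth_at_det (R : realType) n (F : 'rV[R]_8 -> 'M[R]_n) x :
  (forall a b, smooth_at (fun y => F y a b) x) ->
  smooth_at (fun y => \det (F y)) x.
Proof.
move=> sF; rewrite /determinant; apply: smooth_at_sum => s _.
apply: smooth_atM; first exact: smooth_at_cst.
by apply: smooth_at_prod => m _.
Qed.

(** * Quotients by Phi /\ Phi as functions on the manifold *)

Section Ratios.
Variables (R : realType) (M : manifold R).
Implicit Types (i j : chart_index M) (p q : M).

Lemma is_formD (k : nat) (u v : tensor_field M k) (t : R) : is_form u -> is_form v ->
  is_form (fun i p a => u i p a + t * v i p a).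
Proof.
move=> fu fv; split.
- move=> i a; apply: smooth_compP => p ip; apply: smooth_atD.
    exact: form_msmooth fu _ _ _ _.
  by apply: smooth_atM; [exact: smooth_at_cst|exact: form_msmooth fv _ _ _ _].
- move=> i p ip s a; rewrite (form_alternating fu ip) (form_alternating fv ip).
  by rewrite mulrDr; congr (_ + _); rewrite mulrCA.
- move=> i j p a ip jp; have [_ _ tu] := fu; have [_ _ tv] := fv.
  rewrite (tu i j p a ip jp) (tv i j p a ip jp) /pullback mulr_sumr -big_split.
  by apply: eq_bigr => b _ /=; ring.
Qed.

Section Metric.
Variables (Phi : tensor_field M 4) (g : matrix_field M).
Hypothesis hPhi : is_cayley_form Phi.
Hypothesis hg : is_metric_of Phi g.

Let fPhi : is_form Phi. Proof. by case: hPhi. Qed.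

Lemma metric_msmooth i p a b : chart_dom i p -> msmooth i (fun q => g i q a b) p.
Proof.
by move=> ip; have [[sg _ _ _] _] := hg; exact: smooth_comp_at (sg i a b).
Qed.

(** Cramer's rule: the entries of the inverse are cofactors divided by the determinant. *)
Lemma inv_metric_msmooth i p a b :
  chart_dom i p -> msmooth i (fun q => invmx (g i q) a b) p.
Proof.
move=> ip; apply: (@msmooth_eq _ _ i (fun q => (\det (g i q))^-1 * cofactor (g i q) b a)
  (fun q => invmx (g i q) a b) p ip).
  apply: filterS (near_dom ip) => q iq.
  by rewrite /invmx (metric_unit hg iq) !mxE.
apply: smooth_atM.
  apply: smooth_atV; first by apply: smooth_at_det => *; exact: metric_msmooth.
  by rewrite /= (chartK ip) -unitfE -unitmxE; exact: metric_unit hg _ _ _.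
apply: smooth_atM; first exact: smooth_at_cst.
apply: smooth_at_det => a' b'.
apply: (@msmooth_eq _ _ i (fun q => g i q (lift b a') (lift a b'))
  (fun q => row' b (col' a (g i q)) a' b') p ip).
  by near=> q; rewrite !mxE.
exact: metric_msmooth.
Unshelve. all: by end_near. Qed.

Lemma density_d_msmooth i p c : is_form c -> chart_dom i p ->
  msmooth i (fun q => density_d Phi i q c) p.
Proof.
move=> fc ip; rewrite /density_d /top_sum; apply: smooth_at_sum => s _.
apply: smooth_atM; first exact: smooth_at_cst.
apply: smooth_atM; first exact: form_msmooth fPhi _ _ _ _.
by apply: msmooth_partial => //; exact: form_msmooth.
Qed.

Lemma density_contract_msmooth i p C c : is_form C -> is_form c -> chart_dom i p ->
  msmooth i (fun q => density_contract Phi g i q C c) p.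
Proof.
move=> fC fc ip; rewrite /density_contract /top_sum; apply: smooth_at_sum => s _.
apply: smooth_atM; first exact: smooth_at_cst.
apply: smooth_atM; first exact: form_msmooth fPhi _ _ _ _.
apply: smooth_at_sum => r _; apply: smooth_at_sum => q _.
apply: smooth_atM; last exact: inv_metric_msmooth.
by apply: smooth_atM; apply: form_msmooth.
Qed.

Lemma density_vol_msmooth i p : chart_dom i p ->
  msmooth i (fun q => density_vol Phi i q) p.
Proof.
move=> ip; rewrite /density_vol /top_sum; apply: smooth_at_sum => s _.
apply: smooth_atM; first exact: smooth_at_cst.
by apply: smooth_atM; apply: form_msmooth fPhi _ _ _ _.
Qed.

Lemma density_dD i p (u v : tensor_field M 3) t : is_form u -> is_form v ->
  chart_dom i p ->
  density_d Phi i p (fun i p a => u i p a + t * v i p a) =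
  density_d Phi i p u + t * density_d Phi i p v.
Proof.
move=> fu fv ip; rewrite /density_d -top_sumZ -top_sumD; apply: eq_top_sum => a.
have du l b : pderivable i l (fun q => u i q b) p.
  exact: msmooth_pderivable (form_msmooth fu b ip).
have dv l b : pderivable i l (fun q => v i q b) p.
  exact: msmooth_pderivable (form_msmooth fv b ip).
have dt l : pderivable i l (fun=> t) p by exact: derivable_cst.
rewrite partialD //; last exact: pderivableM.
rewrite partialM // partial_cst; ring.
Qed.

Lemma density_contractDr i p (C u v : tensor_field M 3) t :
  density_contract Phi g i p C (fun i p a => u i p a + t * v i p a) =
  density_contract Phi g i p C u + t * density_contract Phi g i p C v.
Proof.
rewrite /density_contract -top_sumZ -top_sumD; apply: eq_top_sum => a.
rewrite mulrCA -mulrDr; congr (_ * _).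
rewrite /contract mulr_sumr -big_split; apply: eq_bigr => r _ /=.
by rewrite mulr_sumr -big_split; apply: eq_bigr => q _ /=; ring.
Qed.

(** Exchanging the pairs of slots 4, 5 and 6, 7 is a product of two transpositions, and the metric
    is symmetric. Both sides are compared with the expression lying one transposition away from
    each. This symmetry gives the factor 2 in the first variation. *)
Lemma density_contractC i p (C c : tensor_field M 3) : chart_dom i p ->
  density_contract Phi g i p C c = density_contract Phi g i p c C.
Proof.
move=> ip; apply: oppr_inj.
rewrite -(@top_sum_swap _ (Ordinal (isT : 5 < 8)%N) (Ordinal (isT : 7 < 8)%N)
  _ (fun a => Phi i p (first4 a) * \sum_r \sum_q
    C i p [tuple a`_4; a`_7; r] * c i p [tuple a`_6; a`_5; q] * invmx (g i p) r q)) //;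
  last first.
  move=> a; rewrite [first4 (permute_idx _ _)]first4E last4E /contract /=.
  by rewrite !nth_permute_tperm //= -first4E.
rewrite -[RHS](@top_sum_swap _ (Ordinal (isT : 4 < 8)%N) (Ordinal (isT : 6 < 8)%N)
  _ (fun a => Phi i p (first4 a) * \sum_r \sum_q
    C i p [tuple a`_4; a`_7; r] * c i p [tuple a`_6; a`_5; q] * invmx (g i p) r q)) //.
move=> a; rewrite [first4 (permute_idx _ _)]first4E last4E /contract /=.
rewrite !nth_permute_tperm //= -first4E; congr (_ * _).
rewrite exchange_big; apply: eq_bigr => r _ /=; apply: eq_bigr => q _ /=.
by rewrite (inv_metric_sym hg _ _ ip) [C _ _ _ * _]mulrC.
Qed.

(** The vector density dual to the 7-form Phi /\ c: slot 4 marks the missing index, and its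
    coordinate divergence represents d(Phi /\ c). *)
Definition flux (c : tensor_field M 3) i (e : 'I_8) p : R :=
  top_sum (fun a => (a`_4 == e)%:R *
    (Phi i p (first4 a) * c i p [tuple a`_5; a`_6; a`_7])).

Lemma flux_msmooth c i e p : is_form c -> chart_dom i p -> msmooth i (flux c i e) p.
Proof.
move=> fc ip; rewrite /flux /top_sum; apply: smooth_at_sum => s _.
apply: smooth_atM; first exact: smooth_at_cst.
apply: smooth_atM; first exact: smooth_at_cst.
by apply: smooth_atM; [exact: form_msmooth fPhi _ _ _ _|exact: form_msmooth].
Qed.

Lemma christoffel_sym i p e a b : chart_dom i p ->
  christoffel g i p e a b = christoffel g i p e b a.
Proof.
move=> ip; rewrite /christoffel; congr (_ * _); apply: eq_bigr => d _.
congr (_ * _); rewrite [X in X - _]addrC; congr (_ - _).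
apply: partial_eq => //; apply: filterS (near_dom ip) => q iq.
by have [[_ sg _ _] _] := hg; rewrite -{1}(sg i q iq) mxE.
Qed.

(** The Leibniz rule for d(Phi /\ c), with the part containing dPhi replaced by - 3 times the
    contraction with [T]. *)
Lemma divergence_flux T c i p : is_torsion Phi g T -> is_form c -> chart_dom i p ->
  density_d Phi i p c - 3 * density_contract Phi g i p T c =
  \sum_e partial i e (flux c i e) p.
Proof.
move=> [fT nT] fc ip.
have sP l : msmooth i (fun q => Phi i q l) p by exact: form_msmooth.
have sc l : msmooth i (fun q => c i q l) p by exact: form_msmooth.
transitivity (top_sum (fun a => partial i a`_4 (fun q =>
    Phi i q (first4 a) * c i q [tuple a`_5; a`_6; a`_7]) p)).
  rewrite -mulNr -(@top_sum_torsion _ (Phi i p)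
    (fun b a => partial i b (fun q => Phi i q a) p) (T i p) (c i p) _
    (christoffel g i p)).
  - rewrite -top_sumD; apply: eq_top_sum => a.
    rewrite partialM //; try exact: msmooth_pderivable.
    by rewrite addrC.
  - exact: form_alternating fPhi _ _ _.
  - exact: form_alternating fT _ _ _.
  - exact: form_alternating fc _ _ _.
  - by move=> a b; exact: inv_metric_sym hg _ _ _ _ _.
  - by move=> e a b; exact: christoffel_sym.
  - by move=> b a; rewrite -[RHS]nT.
transitivity (\sum_e top_sum (fun a => (a`_4 == e)%:R * partial i e (fun q =>
    Phi i q (first4 a) * c i q [tuple a`_5; a`_6; a`_7]) p)).
  rewrite -top_sum_sum; apply: eq_top_sum => a.
  rewrite (bigD1 a`_4) //= (eqxx a`_4) mul1r big1 ?addr0 // => e /negPf ea.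
  by rewrite [a`_4 == e]eq_sym ea mul0r.
apply: eq_bigr => e _; rewrite /flux /top_sum.
have dPc a : pderivable i e (fun q =>
    Phi i q (first4 a) * c i q [tuple a`_5; a`_6; a`_7]) p.
  by apply: pderivableM; exact: msmooth_pderivable.
have dcst k : pderivable i e (fun=> k) p by exact: derivable_cst.
rewrite partial_sum => [|s _]; last by apply: pderivableM => //; exact: pderivableM.
apply: eq_bigr => s _; set a := [tuple s m | m < 8].
rewrite (partialM ip (dcst _) (pderivableM (dcst _) (dPc a))).
by rewrite (partialM ip (dcst _) (dPc a)) !partial_cst !mul0r !add0r.
Qed.

(** Both densities and [density_vol] acquire the same factor det A, which cancels whatever its sign;
    the quotients are therefore functions on [M]. *)
Lemma ratio_transition i j p C c : is_form C -> is_form c ->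
  chart_dom i p -> chart_dom j p ->
  (density_d Phi i p c / density_vol Phi i p =
   density_d Phi j p c / density_vol Phi j p) *
  (density_contract Phi g i p C c / density_vol Phi i p =
   density_contract Phi g j p C c / density_vol Phi j p).
Proof.
move=> fC fc ip jp.
rewrite (density_d_transition hPhi ip jp fc) (density_vol_transition hPhi ip jp).
rewrite (density_contract_transition hPhi hg ip jp fC fc).
have d0 := det_transition_neq0 hPhi hg ip jp.
have v0 := density_vol_neq0 hg jp.
by split; field; rewrite d0 v0.
Qed.

Definition ratio_d (c : tensor_field M 3) p : R :=
  density_d Phi (chart_at p) p c / density_vol Phi (chart_at p) p.

Definition ratio_contract (C c : tensor_field M 3) p : R :=
  density_contract Phi g (chart_at p) p C c / density_vol Phi (chart_at p) p.

Lemma ratio_dE c i p : is_form c -> chart_dom i p ->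
  ratio_d c p = density_d Phi i p c / density_vol Phi i p.
Proof.
by move=> fc ip; rewrite (ratio_transition fc fc ip (dom_chart_at p)).
Qed.

Lemma ratio_contractE C c i p : is_form C -> is_form c -> chart_dom i p ->
  ratio_contract C c p = density_contract Phi g i p C c / density_vol Phi i p.
Proof.
by move=> fC fc ip; rewrite (ratio_transition fC fc ip (dom_chart_at p)).
Qed.

Lemma ratio_d_continuous c : is_form c -> continuous (ratio_d c).
Proof.
move=> fc p; set i := chart_at p; have ip : chart_dom i p := dom_chart_at p.
apply: (@msmooth_cont _ _ i) => //.
apply: (@msmooth_eq _ _ i (fun q => density_d Phi i q c * (density_vol Phi i q)^-1)
  (ratio_d c) p ip).
  by apply: filterS (near_dom ip) => q iq; rewrite (ratio_dE fc iq).
apply: smooth_atM; first exact: density_d_msmooth.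
apply: smooth_atV; first exact: density_vol_msmooth.
by rewrite /= (chartK ip); exact: density_vol_neq0 hg _ _ _.
Qed.

Lemma ratio_contract_continuous C c : is_form C -> is_form c ->
  continuous (ratio_contract C c).
Proof.
move=> fC fc p; set i := chart_at p; have ip : chart_dom i p := dom_chart_at p.
apply: (@msmooth_cont _ _ i) => //.
apply: (@msmooth_eq _ _ i
  (fun q => density_contract Phi g i q C c * (density_vol Phi i q)^-1)
  (ratio_contract C c) p ip).
  by apply: filterS (near_dom ip) => q iq; rewrite (ratio_contractE fC fc iq).
apply: smooth_atM; first exact: density_contract_msmooth.
apply: smooth_atV; first exact: density_vol_msmooth.
by rewrite /= (chartK ip); exact: density_vol_neq0 hg _ _ _.
Qed.

(** Dividing by [vol_form] brings in 14, whence 56 = 14 . 4 and 84 = 14 . 6; the cross term 168 = 2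
    . 84 uses the symmetry of the contraction. *)
Lemma lagrangian_ratio lambda C c t p : is_form C -> is_form c ->
  lagrangian Phi g lambda (fun i p a => C i p a + t * c i p a) (chart_at p) p top_idx
    / vol_form Phi (chart_at p) p top_idx =
  (56 * ratio_d C p - 84 * ratio_contract C C p + lambda / 6) +
  t * (56 * ratio_d c p - 168 * ratio_contract C c p) +
  t ^+ 2 * (- 84 * ratio_contract c c p).
Proof.
move=> fC fc; have ip := dom_chart_at p.
rewrite lagrangian_top //; last exact: is_formD.
rewrite density_dD // density_contractDr.
rewrite (density_contractC _ C ip) (density_contractC _ c ip) !density_contractDr.
rewrite (density_contractC c C ip).
rewrite vol_form_top /ratio_d /ratio_contract.
have v0 := density_vol_neq0 hg ip.
by field.
Qed.

Lemma ratio_contract_sub C C' c p :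
  ratio_contract c (fun i p a => C i p a + - 1 * C' i p a) p =
  ratio_contract c C p - ratio_contract c C' p.
Proof.
by rewrite /ratio_contract density_contractDr mulN1r mulrBl.
Qed.

Lemma ratio_contractC C c p : ratio_contract C c p = ratio_contract c C p.
Proof. by rewrite /ratio_contract density_contractC //; exact: dom_chart_at. Qed.

End Metric.
End Ratios.

(** * Integration *)

Section IteratedIntegral.
Variable R : realType.
Local Open Scope ereal_scope.

Import HBNNSimple.

(* No measurability is required: the integral of a non-negative function is a
   supremum over the simple functions below it. *)
Lemma ge0_le_integral_nomeas d (T : measurableType d)
    (mu : {measure set T -> \bar R}) (f1 f2 : T -> \bar R) :
  (forall x, 0 <= f1 x) -> (forall x, f1 x <= f2 x) ->
  \int[mu]_x f1 x <= \int[mu]_x f2 x.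
Proof.
move=> f10 f12; have f20 x : 0 <= f2 x by exact: le_trans (f12 x).
rewrite !ge0_integralTE //= ge_ereal_sup// => _ [h/= hf <-].
apply: le_ereal_sup_tmp; exists (sintegral mu h) => //.
by exists h => // x; exact: le_trans (f12 x).
Qed.

Let translation_measurable (s : R) :
  measurable_fun setT (fun t : measurableTypeR R => (t + s)%R).
Proof. exact: measurable_funD. Qed.

(** The pushforward by a translation agrees with Lebesgue measure on half-open intervals, and these
    determine it. *)
Lemma lebesgue_measure_translation (s : R) (A : set (measurableTypeR R)) :
  measurable A -> lebesgue_measure ((fun t => t + s)%R @^-1` A) = lebesgue_measure A.
Proof.
move=> mA; apply/esym; pose mphi := translation_measurable s.
apply: (@lebesgue_measure_unique R (pushforward lebesgue_measure
  (fun t : measurableTypeR R => (t + s)%R : measurableTypeR R))) => //.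
move=> _ [[a b] _ <-] /=; rewrite /pushforward.
have -> : (fun t : R => (t + s)%R) @^-1` `]a, b] = `](a - s)%R, (b - s)%R]%classic.
  apply/seteqP; split=> t /=; rewrite !in_itv /=;
  by rewrite ltrBlDr lerBrDr.
rewrite !lebesgue_measure_itv /= !lte_fin ltrD2r.
by case: ifP => // _; rewrite -!EFinB; congr EFin; ring.
Qed.

(** Stated for arbitrary nonnegative [f] because inner iterated integrals serve as integrands.
    Translating the simple functions below [h] gives one inequality; applied also to the translate,
    with the opposite shift, it gives the other. *)
Lemma ge0_integral_translation (f : R -> \bar R) (s : R) : (forall t, 0 <= f t) ->
  \int[lebesgue_measure]_t f (t + s)%R = \int[@lebesgue_measure R]_t f t.
Proof.
have le (h : R -> \bar R) (r : R) : (forall t, 0 <= h t) ->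
    \int[@lebesgue_measure R]_t h t <= \int[lebesgue_measure]_t h (t + r)%R.
  move=> h0; rewrite [leLHS]ge0_integralTE //= ge_ereal_sup// => _ [k/= kh <-].
  rewrite -integralT_nnsfun.
  apply: (@le_trans _ _ (\int[lebesgue_measure]_t (k (t + r)%R)%:E)); last first.
    by apply: ge0_le_integral_nomeas => t; [rewrite lee_fin|exact: kh].
  have mk : measurable_fun setT (EFin \o k : measurableTypeR R -> \bar R).
    exact/measurable_EFinP.
  have := @ge0_integral_pushforward _ _ (measurableTypeR R) (measurableTypeR R) R
    _ (translation_measurable r) lebesgue_measure setT _ measurableT mk.
  rewrite preimage_setT /= => <-; last by move=> t _; rewrite lee_fin.
  rewrite le_eqVlt; apply/orP; left; apply/eqP/esym.
  apply: eq_measure_integral => [|mt A mA _]; first exact: translation_measurable.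
  exact: lebesgue_measure_translation.
move=> f0; apply/eqP; rewrite eq_le le // andbT.
have := le (fun t => f (t + s)%R) (- s)%R (fun t => f0 _).
by under [leRHS]eq_integral do rewrite subrK.
Qed.

Lemma integral_rV_ge0 n (f : 'rV[R]_n -> \bar R) : (forall x, 0 <= f x) ->
  0 <= integral_rV f.
Proof.
elim: n f => [|n IH] f f0 /=; first exact: f0.
by apply: integral_ge0 => t _; exact: IH.
Qed.

Lemma le_integral_rV n (f g : 'rV[R]_n -> \bar R) :
  (forall x, 0 <= f x) -> (forall x, f x <= g x) -> integral_rV f <= integral_rV g.
Proof.
elim: n f g => [|n IH] f g f0 fg /=; first exact: fg.
apply: ge0_le_integral_nomeas => t; first exact: integral_rV_ge0.
exact: IH.
Qed.

Lemma eq_integral_rV n (f g : 'rV[R]_n -> \bar R) : f =1 g ->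
  integral_rV f = integral_rV g.
Proof. by move=> /funext ->. Qed.

Lemma integral_rV_translation n (f : 'rV[R]_n -> \bar R) (w : 'rV[R]_n) :
  (forall x, 0 <= f x) -> integral_rV (fun x => f (x + w)%R) = integral_rV f.
Proof.
elim: n f w => [|n IH] f w f0 /=; first by congr f; apply/rowP => -[].
pose w0 : R := (lsubmx (w : 'rV[R]_(1 + n)) 0 0)%R.
pose w1 : 'rV[R]_n := rsubmx (w : 'rV[R]_(1 + n)).
have wE : w = row_mx (w0%:M : 'rV[R]_1) w1.
  have El : lsubmx (w : 'rV[R]_(1 + n)) = w0%:M.
    by apply/rowP => j; rewrite (ord1 j) [RHS]mxE eqxx mulr1n.
  by rewrite -[LHS](@hsubmxK _ 1 1 n) El.
transitivity (\int[@lebesgue_measure R]_t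
    integral_rV (fun v : 'rV[R]_n => f (row_mx ((t + w0)%R%:M : 'rV[R]_1) v))).
  apply: eq_integral => t _.
  rewrite -[RHS](IH _ w1) //; apply: eq_integral_rV => v.
  by rewrite wE (@add_row_mx _ 1 1 n) -raddfD.
rewrite (@ge0_integral_translation
  (fun t => integral_rV (fun v : 'rV[R]_n => f (row_mx (t%:M : 'rV[R]_1) v)))) //.
by move=> t; exact: integral_rV_ge0.
Qed.

(** The explicit value supplies both the finite upper bounds and the positive lower bounds for
    integrals in a chart. *)
Lemma integral_rV_cube n (y : 'rV[R]_n) (c e : R) : (0 <= c)%R -> (0 <= e)%R ->
  integral_rV (fun x => (if [forall j, (`|y 0 j - x 0 j| < e)%R] then c else 0)%R%:E) =
  (c * (e *+ 2) ^+ n)%R%:E.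
Proof.
elim: n y c => [|n IH] y c c0 e0 /=.
  by rewrite expr0 mulr1; case: ifP => // /forallP; case=> -[].
pose y0 : R := (y 0 (0 : 'I_n.+1))%R.
pose y1 : 'rV[R]_n := rsubmx (y : 'rV[R]_(1 + n)).
pose d (t : R) : R := (if `|y0 - t| < e then c else 0)%R.
have L0 : (lshift n (0%R : 'I_1) : 'I_n.+1) = 0%R by exact: val_inj.
have d0 t : (0 <= d t)%R by rewrite /d; case: ifP.
transitivity (\int[@lebesgue_measure R]_t (d t * (e *+ 2) ^+ n)%R%:E).
  apply: eq_integral => t _; rewrite -(IH y1) //; apply: eq_integral_rV => v.
  congr EFin; rewrite /d.
  have -> : [forall j : 'I_n.+1, (`|y 0 j - row_mx (t%:M : 'rV[R]_1) v 0 j| < e)%R] =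
      (`|y0 - t| < e)%R && [forall j, (`|y1 0 j - v 0 j| < e)%R].
    apply/forallP/andP => [H|[H0 /forallP H] j].
      split; first by have := H (lshift n (0%R : 'I_1));
        rewrite (@row_mxEl _ 1 1 n) mxE eqxx mulr1n L0.
      apply/forallP => j; have := H (rshift 1 j).
      by rewrite (@row_mxEr _ 1 1 n) /y1 mxE.
    case: (@split_ordP 1 n j) => k ->.
      by rewrite (@row_mxEl _ 1 1 n) (ord1 k) mxE eqxx mulr1n L0.
    by have := H k; rewrite (@row_mxEr _ 1 1 n) /y1 mxE.
  by case: (`|y0 - t| < e)%R => //=; case: ifP.
transitivity (\int[@lebesgue_measure R]_(t in ball y0 e) (c * (e *+ 2) ^+ n)%R%:E).
  rewrite [RHS]integral_mkcond; apply: eq_integral => t _; rewrite /d patchE.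
  rewrite (_ : (t \in (ball y0 e : set R)) = (`|y0 - t| < e)%R); last first.
    by apply/idP/idP; rewrite inE -ball_normE.
  by case: ifP => //; rewrite mul0r.
rewrite integral_cst /=; last exact: measurable_ball.
by rewrite lebesgue_measure_ball // -EFinM exprSr mulrA.
Qed.

End IteratedIntegral.

Section Cubes.
Variable R : realType.
Local Notation V := 'rV[R]_8.
Implicit Types (x y : V) (r : R).

(** For r > 0 this is a ball of the maximum norm; the coordinatewise form matches the integrand of
    [integral_rV_cube]. *)
Definition cube x r : set V := [set y | forall j, `|x 0 j - y 0 j| < r].
Definition closed_cube x r : set V := [set y | forall j, `|x 0 j - y 0 j| <= r].

Lemma cube_norm x r : 0 < r -> cube x r = [set y | `|x - y| < r].
Proof.
move=> r0; apply/seteqP; split=> y /=.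
  move=> H; rewrite [ltLHS]/Num.Def.normr/= mx_normrE (bigmax_lt _ r0)//= => i _.
  by rewrite (ord1 i.1) !mxE; exact: H.
move=> H j; apply: le_lt_trans H.
by have := coord_le_norm (x - y) j; rewrite !mxE.
Qed.

Lemma cube_ball x r : 0 < r -> cube x r = ball x r.
Proof. by move=> r0; rewrite cube_norm // -ball_normE. Qed.

Lemma cube_nbhs x r : 0 < r -> nbhs x (cube x r).
Proof. by move=> r0; rewrite cube_ball //; exact: nbhsx_ballx. Qed.

Lemma cube_center x r : 0 < r -> cube x r x.
Proof. by move=> r0 j; rewrite subrr normr0. Qed.

Lemma sub_cube x r s : r <= s -> cube x r `<=` cube x s.
Proof. by move=> rs y H j; exact: lt_le_trans rs. Qed.

Lemma closed_cube_sub x r s : r < s -> closed_cube x r `<=` cube x s.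
Proof. by move=> rs y H j; exact: le_lt_trans rs. Qed.

Lemma nbhs_cube x (P : set V) : nbhs x P -> exists2 r, 0 < r & cube x r `<=` P.
Proof.
by move=> /nbhs_ballP[r /= r0 H]; exists r => //; rewrite cube_ball.
Qed.

Lemma closed_cube_compact x r : compact (closed_cube x r).
Proof.
have -> : closed_cube x r = [set v : V | forall i, `[x 0 i - r, x 0 i + r]%classic (v ord0 i)].
  apply/seteqP; split=> y H j; have := H j; rewrite /= in_itv /= ler_distlC.
    by [].
  by [].
apply: (@rV_compact R 8 (fun i => `[x 0 i - r, x 0 i + r]%classic)) => i.
exact: segment_compact.
Qed.

Lemma closed_cube_setC_nbhs x r y :
  ~ closed_cube x r y -> nbhs y (~` closed_cube x r).
Proof.
move=> ny; apply: open_nbhs_nbhs; split=> //; apply: closed_openC.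
by apply: compact_closed; [exact: norm_hausdorff|exact: closed_cube_compact].
Qed.

Lemma cube_asbool x r y : `[< cube x r y >] = [forall j, `|x 0 j - y 0 j| < r].
Proof.
by apply/asboolP/forallP => H j; exact: H.
Qed.

End Cubes.

(** * Integration against the volume measure in one chart *)

Section ChartIntegral.
Variables (R : realType) (M : manifold R).
Variables (Phi : tensor_field M 4) (g : matrix_field M).
Hypothesis hg : is_metric_of Phi g.
Variable mu : {measure set (borel M) -> \bar R}.
Hypothesis hmu : is_riemannian_measure mu g.
Local Notation V := 'rV[R]_8.
Implicit Types (i : chart_index M) (p q : M).

Lemma open_measurable_borel (A : set M) : open A -> measurable (A : set (borel M)).
Proof. by move=> oA; exact: sub_sigma_algebra. Qed.

Lemma compact_measurable_borel (A : set M) :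
  compact A -> measurable (A : set (borel M)).
Proof.
move=> cA; rewrite -[A]setCK; apply: measurableC; apply: open_measurable_borel.
by rewrite openC; apply: compact_closed => //; exact: point_hausdorff.
Qed.

Lemma continuous_measurable_borel (A : set M) (f : M -> R) : open A ->
  (forall p, A p -> {for p, continuous f}) ->
  measurable_fun (A : set (borel M)) (f : borel M -> R).
Proof.
move=> oA cf; apply: (measurability _ (RGenOInfty.measurableE R)).
move=> _ [_ [x ->] <-]; apply: open_measurable_borel.
rewrite openE => p /= [Ap fp].
have nA : \forall q \near p, A q by exact: open_nbhs_nbhs.
have nf : \forall q \near p, x < f q.
  have : {for p, continuous f} := cf p Ap.
  move=> /(_ [set y | x < y]); apply; apply: open_nbhs_nbhs; split.
    exact: open_gt.
  by move: fp; rewrite in_itv /= andbT.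
rewrite /interior; apply: filterS (@filterI _ (nbhs p) _ _ _ nA nf) => q [Aq fq].
by split=> //=; rewrite in_itv /= andbT.
Qed.

Definition vol_density i p : R := Num.sqrt (\det (g i p)).

Lemma vol_density_gt0 i p : chart_dom i p -> 0 < vol_density i p.
Proof.
move=> ip; rewrite sqrtr_gt0; have [A [Au _ ->]] := metric_coframe hg ip.
by rewrite det_mulmx det_tr -expr2 lt0r sqrf_eq0 -unitfE -unitmxE Au sqr_ge0.
Qed.

Lemma vol_density_cont i p : chart_dom i p -> {for p, continuous (vol_density i)}.
Proof.
move=> ip; have cd : {for p, continuous (fun q => \det (g i q))}.
  apply: (@msmooth_cont _ _ i) => //; apply: smooth_at_det => a b.
  exact: metric_msmooth hg _ _ _ _ _.
exact: (continuous_comp cd (@sqrt_continuous _ _)).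
Qed.

(** Dividing by sqrt (det g) cancels the density of [mu], so the integral over the chart domain is
    the Lebesgue integral of [u]. *)
Definition chart_quot i (u : V -> R) p : R := u (chart i p) / vol_density i p.

Lemma chart_quot_measurable i u : continuous u ->
  measurable_fun (chart_dom i : set (borel M)) (chart_quot i u : borel M -> R).
Proof.
move=> cu; apply: continuous_measurable_borel; first exact: dom_open.
move=> p ip; rewrite /chart_quot.
have c1 : {for p, continuous (fun q => u (chart i q))}.
  exact: (continuous_comp (chart_cont ip) (cu _)).
have c2 : {for p, continuous (fun q => (vol_density i q)^-1)}.
  by apply: continuousV; [rewrite gt_eqF // vol_density_gt0|exact: vol_density_cont].
exact: continuousM c1 c2.
Qed.

Lemma chart_integral i (u : V -> R) : continuous u -> (forall x, 0 <= u x) ->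
  (forall x, ~ chart_image i x -> u x = 0) ->
  (\int[mu]_(p in chart_dom i) (chart_quot i u p)%:E)%E =
  integral_rV (fun x => (u x)%:E).
Proof.
move=> cu u0 uz.
(* [hmu] concerns Borel functions on all of [M], hence the extension by zero outside the chart. *)
pose f : borel M -> \bar R := (EFin \o chart_quot i u) \_ (chart_dom i).
have -> : (\int[mu]_(p in chart_dom i) (chart_quot i u p)%:E)%E =
    (\int[mu]_(p in chart_dom i) f p)%E.
  by apply: eq_integral => p ip; rewrite /f patchE ip.
rewrite hmu.
- apply: eq_integral_rV => x; rewrite patchE; case: ifPn => [|/negP].
    rewrite inE => /chart_invK[ix xE]; rewrite /f patchE mem_set //= /chart_quot xE.
    by rewrite -EFinM divfK // gt_eqF // vol_density_gt0.
  by rewrite inE => /uz ->.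
- have := (@measurable_restrictT _ _ (borel M) (\bar R) (chart_dom i)
    (EFin \o chart_quot i u) (open_measurable_borel (@dom_open _ _ i))).1; apply.
  by apply/measurable_EFinP; exact: chart_quot_measurable.
- move=> p; rewrite /f patchE; case: ifPn => //; rewrite inE => ip.
  by rewrite lee_fin divr_ge0 // ltW // vol_density_gt0.
Qed.

Let integral_cube_lty (x0 : V) r c : 0 <= c -> 0 <= r ->
  (integral_rV (fun x : V => (if `[< cube x0 r x >] then c else 0)%:E) < +oo)%E.
Proof.
move=> c0 r0; rewrite (@eq_integral_rV _ _ _ (fun x : V =>
  (if [forall j, `|x0 0 j - x 0 j| < r] then c else 0)%:E)) => [|x].
  by rewrite integral_rV_cube // ltry.
by rewrite cube_asbool.
Qed.

Lemma chart_quot_integrable i (u : V -> R) x0 (r c : R) : continuous u -> 0 <= r ->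
  cube x0 r `<=` chart_image i -> (forall x, ~ cube x0 r x -> u x = 0) ->
  (forall x, `|u x| <= c) ->
  mu.-integrable (chart_dom i : set (borel M)) (EFin \o chart_quot i u).
Proof.
move=> cu r0 sub uz uc; apply/integrableP; split.
  by apply/measurable_EFinP; exact: chart_quot_measurable.
have c0 : 0 <= c by exact: le_trans (uc x0).
rewrite (@eq_integral _ (borel M) _ _ _ (fun p => (chart_quot i (fun x => `|u x|) p)%:E)).
  rewrite chart_integral //.
  - apply: le_lt_trans (integral_cube_lty x0 c0 r0); apply: le_integral_rV => x.
      by rewrite lee_fin.
    rewrite lee_fin; case: asboolP => [_|/uz ->]; first exact: uc.
    by rewrite normr0.
  - by move=> x; exact: (continuous_comp (cu x) (@norm_continuous R R (u x))).
  - by move=> x xi; rewrite uz ?normr0 // => /sub.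
move=> p; rewrite inE => ip; rewrite /chart_quot /= normrM; congr (_ * _)%:E.
by rewrite ger0_norm // invr_ge0 ltW // vol_density_gt0.
Qed.

Let translate_continuous (v : V -> R) (w : V) :
  continuous v -> continuous (fun x : V => v (x + w)).
Proof.
move=> cv x; have c : {for x, continuous ((fun y => y + w) : V -> V)}.
  have c1 : {for x, continuous (id : V -> V)} by exact: cvg_id.
  have c2 : {for x, continuous (cst w : V -> V)} by exact: cst_continuous.
  exact: (continuousD c1 c2).
exact: (continuous_comp c (cv (x + w))).
Qed.

Let chart_Rintegral_translation_ge0 i (u : V -> R) (w : V) : continuous u -> (forall x, 0 <= u x) ->
  (forall x, ~ chart_image i x -> u x = 0) ->
  (forall x, ~ chart_image i x -> u (x + w) = 0) ->
  \int[mu]_(p in (chart_dom i : set (borel M))) chart_quot i (fun x : V => u (x + w)) p =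
  \int[mu]_(p in (chart_dom i : set (borel M))) chart_quot i u p.
Proof.
move=> cu u0 uz uwz; have cuw : continuous (fun x : V => u (x + w)).
  exact: translate_continuous.
have E1 := chart_integral cu u0 uz.
have E2 := chart_integral cuw (fun x => u0 (x + w)) uwz.
have u0' (x : V) : (0 <= (u x)%:E)%E by rewrite lee_fin.
have E3 := integral_rV_translation w u0'.
exact: etrans (congr1 fine E2) (etrans (congr1 fine E3) (esym (congr1 fine E1))).
Qed.

Lemma chart_Rintegral_translation i (u : V -> R) x0 (r c : R) (w : V) : continuous u -> 0 <= r ->
  cube x0 r `<=` chart_image i -> (forall x, ~ cube x0 r x -> u x = 0) ->
  (forall x, ~ cube x0 r x -> u (x + w) = 0) -> (forall x, `|u x| <= c) ->
  \int[mu]_(p in (chart_dom i : set (borel M))) chart_quot i (fun x : V => u (x + w)) p =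
  \int[mu]_(p in (chart_dom i : set (borel M))) chart_quot i u p.
Proof.
move=> cu r0 sub uz uwz uc.
(* Translation invariance is available for nonnegative functions; the positive and negative parts of
   [u] keep its continuity, support and bound. *)
pose up x := (`|u x| + u x) / 2; pose un x := (`|u x| - u x) / 2.
have cnu : continuous (fun x => `|u x|).
  by move=> x; exact: (continuous_comp (cu x) (@norm_continuous R R (u x))).
have cup : continuous up.
  move=> x; have c2 : {for x, continuous (cst 2^-1 : V -> R)} by exact: cst_continuous.
  exact: (continuousM (continuousD (cnu x) (cu x)) c2).
have cun : continuous un.
  move=> x; have c2 : {for x, continuous (cst 2^-1 : V -> R)} by exact: cst_continuous.
  exact: (continuousM (continuousB (cnu x) (cu x)) c2).
have up0 x : 0 <= up x.
  by rewrite divr_ge0 //; have := ler_norm (- u x); rewrite normrN; lra.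
have un0 x : 0 <= un x by rewrite divr_ge0 // subr_ge0 ler_norm.
have upc x : `|up x| <= c.
  by rewrite ger0_norm // /up; have := uc x; have := ler_norm (u x); lra.
have unc x : `|un x| <= c.
  rewrite ger0_norm // /un; have := uc x; have := ler_norm (- u x).
  by rewrite normrN; lra.
have zp x : u x = 0 -> up x = 0 by rewrite /up => ->; rewrite normr0 addr0 mul0r.
have zn x : u x = 0 -> un x = 0 by rewrite /un => ->; rewrite normr0 subr0 mul0r.
have uE x : u x = up x - un x by rewrite /up /un; lra.
have tr (v : V -> R) : continuous v -> continuous (fun x : V => v (x + w)).
  exact: translate_continuous.
have md := open_measurable_borel (@dom_open _ M i).
have E (v vp vn : V -> R) : continuous vp -> continuous vn ->
    (forall x, ~ cube x0 r x -> vp x = 0) -> (forall x, ~ cube x0 r x -> vn x = 0) ->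
    (forall x, `|vp x| <= c) -> (forall x, `|vn x| <= c) ->
    (forall x, v x = vp x - vn x) ->
    \int[mu]_(p in (chart_dom i : set (borel M))) chart_quot i v p =
    \int[mu]_(p in (chart_dom i : set (borel M))) chart_quot i vp p -
    \int[mu]_(p in (chart_dom i : set (borel M))) chart_quot i vn p.
  move=> cvp cvn zvp zvn bvp bvn vE; rewrite -RintegralB //.
  - by apply: eq_Rintegral => p _; rewrite /chart_quot vE mulrBl.
  - exact: chart_quot_integrable cvp r0 sub zvp bvp.
  - exact: chart_quot_integrable cvn r0 sub zvn bvn.
rewrite (E u up un) //; last 2 first.
- by move=> x /uz/zp.
- by move=> x /uz/zn.
rewrite (E (fun x : V => u (x + w)) (fun x : V => up (x + w)) (fun x : V => un (x + w))) //.
- congr (_ - _); apply: chart_Rintegral_translation_ge0 => // x xi; first apply: zp.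
  + by apply: uz => /sub.
  + by apply: zp; apply: uwz => /sub.
  + by apply: zn; apply: uz => /sub.
  + by apply: zn; apply: uwz => /sub.
- exact: tr.
- exact: tr.
- by move=> x /uwz/zp.
- by move=> x /uwz/zn.
Qed.

End ChartIntegral.

Section Tent.
Variable R : realType.
Local Notation V := 'rV[R]_8.

(** A continuous substitute for the indicator of a cube, as the passage to Lebesgue integrals is
    made for continuous functions. *)
Definition tent (x : V) (r : R) (y : V) : R := Num.max 0 (r - `|x - y|).

Lemma tent_ge0 x r y : 0 <= tent x r y.
Proof. by rewrite le_max lexx. Qed.

Lemma tent_continuous x r : continuous (tent x r).
Proof.
move=> y; have c1 : {for y, continuous (fun z : V => `|x - z|)}.
  exact: (continuous_comp (continuousB (@cst_continuous V V x y) (@cvg_id _ (nbhs y)))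
    (@norm_continuous R V (x - y))).
exact: (continuous_max (@cst_continuous V R 0 y)
  (continuousB (@cst_continuous V R r y) c1)).
Qed.

Lemma tent_eq0 x r y : 0 < r -> ~ cube x r y -> tent x r y = 0.
Proof.
move=> r0; rewrite cube_norm //= => /negP; rewrite -leNgt => xy.
by apply/max_idPl; rewrite subr_le0.
Qed.

Lemma tent_ge x r y : r - `|x - y| <= tent x r y.
Proof. by rewrite le_max lexx orbT. Qed.

Lemma tent_le x r y : 0 <= r -> tent x r y <= r.
Proof. by move=> r0; rewrite ge_max r0 gerBl normr_ge0. Qed.

End Tent.

Section ChartDerivative.
Variables (R : realType) (M : manifold R).
Variables (Phi : tensor_field M 4) (g : matrix_field M).
Hypothesis hg : is_metric_of Phi g.
Variable mu : {measure set (borel M) -> \bar R}.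
Hypothesis hmu : is_riemannian_measure mu g.
Local Notation V := 'rV[R]_8.
Implicit Types (i : chart_index M) (p q : M).

Let continuous_bounded (v : V -> R) x r : continuous v ->
  exists2 L : R, 0 <= L & forall y, closed_cube x r y -> `|v y| <= L.
Proof.
move=> cv; have := @compact_bounded _ _ _ (continuous_compact
  (continuous_subspaceT cv) (@closed_cube_compact _ x r)).
move=> [L [_ HL]]; exists (`|L| + 1); first by rewrite addr_ge0.
move=> y xy; apply: HL; last by exists y.
by rewrite (le_lt_trans (ler_norm L)) // ltrDl.
Qed.

(** Translates of [h] all have the same integral, and differentiating this constant under the
    integral sign gives the claim. The doubled radius leaves room for translations of length up to
    [r]. *)
Lemma chart_Rintegral_derivative i (h : V -> R) (x0 : V) (r : R) a : 0 < r ->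
  cube x0 (r *+ 2) `<=` chart_image i -> continuous h ->
  (forall x, derivable h x (basis_vec R a)) ->
  continuous (fun x => 'D_(basis_vec R a) h x) ->
  (forall x, ~ cube x0 r x -> h x = 0) ->
  mu.-integrable (chart_dom i : set (borel M))
    (EFin \o chart_quot g i (fun x => 'D_(basis_vec R a) h x)) /\
  \int[mu]_(p in (chart_dom i : set (borel M)))
    chart_quot g i (fun x => 'D_(basis_vec R a) h x) p = 0.
Proof.
move=> r0 sub ch dh cdh hz; set ea := basis_vec R a.
have nea : `|ea| <= 1 := norm_basis_vec _ _.
have r2 : 0 < r *+ 2 by rewrite mulrn_wgt0.
have nsea (s : R) : `|s *: ea| <= `|s|.
  by rewrite normrZ -[leRHS]mulr1 ler_wpM2l.
have farE (s : R) x : `|s| <= r -> ~ cube x0 (r *+ 2) x -> h (x + s *: ea) = 0.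
  move=> sr nx; apply: hz => H; apply: nx; move: H; rewrite !cube_norm //= => H.
  have -> : x0 - x = x0 - (x + s *: ea) + s *: ea by rewrite opprD addrA subrK.
  by rewrite mulr2n (le_lt_trans (ler_normD _ _)) // ltr_leD // (le_trans (nsea s)).
have D0 x : r < `|x0 - x| -> 'D_ea h x = 0.
  move=> rx.
  have no : nbhs x [set y : V | h y = 0].
    have oU : open [set y : V | r < `|x0 - y|].
      rewrite (_ : [set _ | _] = (fun y : V => `|x0 - y|) @^-1` [set t : R | r < t]) //.
      apply: open_comp; last exact: open_gt.
      move=> y _; have c1 : {for y, continuous (fun z : V => x0 - z)}.
        have c2 : {for y, continuous (cst x0 : V -> V)} by exact: cst_continuous.
        have c3 : {for y, continuous (id : V -> V)} by exact: cvg_id.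
        exact: (continuousB c2 c3).
      exact: (continuous_comp c1 (@norm_continuous R V (x0 - y))).
    have nU : nbhs x [set y : V | r < `|x0 - y|] by exact: open_nbhs_nbhs.
    apply: filterS nU => y ry; apply: hz; rewrite cube_norm //=.
    by move/(lt_trans ry); rewrite ltxx.
  have := near_eq_derive (V := V) (W := R^o) (f := h) (g := cst 0) ea no.
  by rewrite derive_cst.
have [L L0 hL] := continuous_bounded x0 r cdh.
have [c c0 hc] := continuous_bounded x0 r ch.
have hcT x : `|h x| <= c.
  have [/(sub_cube _)|/hz->] := pselect (cube x0 r x); last by rewrite normr0.
  by move=> H; apply: hc => j; exact/ltW/(H r).
have DL x : `|'D_ea h x| <= L.
  have [/D0->|rx] := ltP r `|x0 - x|; first by rewrite normr0.
  apply: hL => j; apply: le_trans rx.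
  by have := coord_le_norm (x0 - x) j; rewrite !mxE.
split.
  apply: (chart_quot_integrable hg hmu cdh (ltW r2) sub _ DL) => x.
  rewrite cube_norm //= => /negP; rewrite -leNgt => x2; apply: D0.
  by apply: lt_le_trans x2; lra.
pose b (x : V) : R := L / r * 2 * tent x0 (r *+ 2) x.
have k0 : 0 <= L / r * 2 by rewrite mulr_ge0 // divr_ge0 // ltW.
have b0 x : 0 <= b x by rewrite mulr_ge0 ?tent_ge0.
have cb : continuous b.
  by move=> x; exact: (continuousM (@cst_continuous V R _ x) (@tent_continuous _ _ _ x)).
have bz x : ~ cube x0 (r *+ 2) x -> b x = 0.
  by move=> nx; rewrite /b tent_eq0 // mulr0.
have bL x (s : R) : `|s| < r / 2 -> `|'D_ea h (s *: ea + x)| <= b x.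
  move=> sr; have [/D0->|rx] := ltP r `|x0 - (s *: ea + x)|; first by rewrite normr0.
  apply: le_trans (DL _) _.
  have x32 : `|x0 - x| <= r + r / 2.
    have -> : x0 - x = x0 - (s *: ea + x) + s *: ea by rewrite opprD addrA addrAC subrK.
    rewrite (le_trans (ler_normD _ _)) // lerD // (le_trans (nsea s)) //; exact: ltW.
  rewrite /b -!mulrA -[leLHS]mulr1 ler_wpM2l //.
  rewrite -[leLHS](mulVf (lt0r_neq0 r0)) ler_pM2l ?invr_gt0 //.
  by have := tent_ge x0 (r *+ 2) x; lra.
have bB x : `|b x| <= L / r * 2 * (r *+ 2).
  by rewrite ger0_norm // ler_wpM2l // tent_le // ltW.
pose F (s : R) (p : borel M) := chart_quot g i (fun x => h (x + s *: ea)) p.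
have md := open_measurable_borel (@dom_open _ M i).
have Fconst (s : R) : `|s| <= r ->
    \int[mu]_(p in (chart_dom i : set (borel M))) F s p =
    \int[mu]_(p in (chart_dom i : set (borel M))) chart_quot g i h p.
  move=> sr; apply: (chart_Rintegral_translation hg hmu ch (ltW r2) sub) => //.
    by move=> x nx; apply: hz => H; apply: nx; apply: sub_cube H; lra.
  by move=> x; exact: farE.
have dF (s : R) p : derivable (F ^~ p) s 1 /\
    partial1of2 F s p = chart_quot g i (fun x => 'D_ea h (s *: ea + x)) p.
  have -> : F ^~ p = fun s : R => (vol_density g i p)^-1 *: h (s *: ea + chart i p).
    by apply/funext => t; rewrite /F /chart_quot mulrC addrC.
  have D := @line_is_derive _ _ _ _ s (dh (s *: ea + chart i p)).
  have D' : is_derive s 1 (fun s : R => (vol_density g i p)^-1 *: h (s *: ea + chart i p))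
      ((vol_density g i p)^-1 *: 'D_ea h (s *: ea + chart i p)) by exact: is_deriveZ.
  split; first by case: D'.
  rewrite /partial1of2 derive1E.
  have -> : F ^~ p = fun s : R => (vol_density g i p)^-1 *: h (s *: ea + chart i p).
    by apply/funext => t; rewrite /F /chart_quot mulrC addrC.
  by case: D' => _ ->; rewrite /chart_quot mulrC.
have I0 : `](- (r / 2)), (r / 2)[%classic (0 : R).
  by rewrite /= in_itv /= oppr_lt0 divr_gt0.
have Is (s : R) : `](- (r / 2)), (r / 2)[%classic s -> `|s| < r / 2.
  by rewrite /= in_itv /= ltr_norml.
have iF (s : R) : `](- (r / 2)), (r / 2)[%classic s ->
    mu.-integrable (chart_dom i : set (borel M)) (EFin \o F s).
  move=> /Is sr; apply: (@chart_quot_integrable _ _ _ _ hg mu hmu i _ x0 (r *+ 2) c) => //.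
  - move=> x; have c1 : {for x, continuous (fun y : V => y + s *: ea)}.
      exact: (continuousD (@cvg_id _ (nbhs x)) (@cst_continuous V V (s *: ea) x)).
    exact: (continuous_comp c1 (ch _)).
  - exact: ltW.
  - by move=> x; apply: farE; apply: ltW; apply: (lt_le_trans sr); lra.
have ib : mu.-integrable (chart_dom i : set (borel M)) (EFin \o chart_quot g i b).
  exact: (chart_quot_integrable hg hmu cb (ltW r2) sub bz bB).
have b0' p : 0 <= chart_quot g i b p by rewrite divr_ge0 ?b0 ?sqrtr_ge0.
have Fb (s : R) p : `](- (r / 2)), (r / 2)[%classic s -> chart_dom i p ->
    `|partial1of2 F s p| <= chart_quot g i b p.
  move=> /Is sr ip; rewrite (dF s p).2 /chart_quot normrM.
  by rewrite [X in _ * X]ger0_norm ?invr_ge0 ?sqrtr_ge0 // ler_wpM2r ?invr_ge0 ?sqrtr_ge0 ?bL.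
have := differentiation_under_integral md I0 iF (fun s p _ _ => (dF s p).1) b0' ib Fb.
(* Near s = 0 the integral is constant by [Fconst]. *)
have -> : (fun s : R => \int[mu]_(p in (chart_dom i : set (borel M))) F s p)^`()%classic 0 = 0.
  rewrite derive1E.
  have no : nbhs (0 : R) [set s : R | \int[mu]_(p in (chart_dom i : set (borel M))) F s p =
      cst (\int[mu]_(p in (chart_dom i : set (borel M))) chart_quot g i h p : R) s].
    apply/nbhs_ballP; exists r => // s; rewrite -ball_normE /= sub0r normrN => sr.
    by apply: Fconst; exact: ltW.
  by rewrite (near_eq_derive (V := R^o) (W := R^o) (1 : R) no) derive_cst.
move=> /esym E; rewrite -[RHS]E; apply: eq_Rintegral => p _.
rewrite (dF 0 p).2 /chart_quot; congr (_ / _).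
by rewrite scale0r add0r.
Qed.

End ChartDerivative.

Lemma compact_seq_cover (T : ptopologicalType) (K : set T) (U : T -> set T) :
  compact K -> (forall p, open (U p)) -> (forall p, U p p) ->
  exists s : seq T, forall q, K q -> exists2 p, p \in s & U p q.
Proof.
rewrite compact_cover => cK oU Up.
have [//|q _|D _ HD] := cK T setT U; first by exists q.
by exists (finmap.enum_fset D) => q /HD[p pD Upq]; exists p.
Qed.

(** * Finiteness and positivity of the volume measure *)

Section CompactIntegral.
Variables (R : realType) (M : manifold R).
Variables (Phi : tensor_field M 4) (g : matrix_field M).
Hypothesis hg : is_metric_of Phi g.
Variable mu : {measure set (borel M) -> \bar R}.
Hypothesis hmu : is_riemannian_measure mu g.
Local Notation V := 'rV[R]_8.
Implicit Types (i : chart_index M) (p q : M).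

Let tent_integral i (x0 : V) (r : R) : 0 < r -> cube x0 r `<=` chart_image i ->
  (\int[mu]_(p in chart_dom i) (chart_quot g i (tent x0 r) p)%:E)%E =
  integral_rV (fun x : V => (tent x0 r x)%:E).
Proof.
move=> r0 sub; apply: (chart_integral hg hmu).
- exact: tent_continuous.
- by move=> x; exact: tent_ge0.
- by move=> x nx; apply: tent_eq0 => // /sub.
Qed.

(** A positive multiple of the measure of a small open set is bounded by the integral of a tent,
    which is a finite Lebesgue integral. *)
Lemma locally_finite_measure p :
  exists U : set M, [/\ open U, U p & (mu (U : set (borel M)) < +oo)%E].
Proof.
have ip := dom_chart_at p; set i := chart_at p in ip *.
have xi : nbhs (chart i p) (chart_image i) by exact: near_image (chart_imageP ip).
have [r r0 sub] := nbhs_cube xi; set x0 := chart i p in sub *.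
(* A lower bound for the tent quotient on [U]: the tent is at least r/2 on the half-size cube, and
   the density is below its value at [p] plus 1. *)
pose k := (vol_density g i p + 1)^-1 * (r / 2).
pose U := [set q | [/\ chart_dom i q, cube x0 (r / 2) (chart i q) &
   vol_density g i q < vol_density g i p + 1]].
have oU : open U.
  rewrite openE => q [iq qr vq]; rewrite /interior.
  have n2 : nbhs q (chart i @^-1` cube x0 (r / 2)).
    apply: chart_cont iq _ _; rewrite cube_ball ?divr_gt0 // in qr *.
    by apply: open_nbhs_nbhs; split=> //; exact: ball_open.
  have n3 : nbhs q (vol_density g i @^-1` [set y | y < vol_density g i p + 1]).
    apply: (vol_density_cont hg iq); apply: open_nbhs_nbhs; split=> //.
  by apply: filterS3 (near_dom iq) n2 n3 => z.
have mU := open_measurable_borel oU; have mi := open_measurable_borel (@dom_open _ M i).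
have k0 : 0 < k.
  by rewrite mulr_gt0 ?divr_gt0 // invr_gt0 ltr_wpDl // sqrtr_ge0.
exists U; split=> //.
  by split=> //; [apply: cube_center; rewrite divr_gt0|rewrite ltrDl].
have : (k%:E * mu U < +oo)%E.
  apply: (@le_lt_trans _ _ (integral_rV (fun x : V => (tent x0 r x)%:E))); last first.
    apply: (@le_lt_trans _ _ (integral_rV (fun x : V =>
      (if [forall j, `|x0 0 j - x 0 j| < r] then r else 0)%:E))); last first.
      by rewrite integral_rV_cube ?ltry // ltW.
    apply: le_integral_rV => x; rewrite lee_fin ?tent_ge0 //.
    case: ifP => [_|/negP nx]; first by rewrite tent_le // ltW.
    rewrite tent_eq0 // => H; apply: nx; apply/forallP => j; exact: H.
  rewrite -(tent_integral r0 sub).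
  have mt : measurable_fun (chart_dom i : set (borel M))
      (fun p => (chart_quot g i (tent x0 r) p)%:E).
    by apply/measurable_EFinP; apply: (chart_quot_measurable hg); exact: tent_continuous.
  have Ud : U `<=` chart_dom i by move=> q [].
  have t0 q : (0 <= (chart_quot g i (tent x0 r) q)%:E)%E.
    by rewrite lee_fin divr_ge0 ?tent_ge0 ?sqrtr_ge0.
  have t0' q : U q -> (0 <= (chart_quot g i (tent x0 r) q)%:E)%E by [].
  have t0'' q : chart_dom i q -> (0 <= (chart_quot g i (tent x0 r) q)%:E)%E by [].
  apply: (le_trans _ (ge0_subset_integral mu mU mi mt t0'' Ud)).
  rewrite -(@integral_cst _ _ _ mu U mU k%:E).
  apply: ge0_le_integral => //.
  - by move=> q _; rewrite lee_fin ltW.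
  - exact: measurable_funS mt.
  move=> q [iq qr vq]; rewrite lee_fin /chart_quot /k mulrC.
  have v0 := vol_density_gt0 hg iq.
  have v1 : 0 < vol_density g i p + 1 := lt_trans v0 vq.
  apply: ler_pM.
  - by rewrite divr_ge0 // ltW.
  - by rewrite invr_ge0 ltW.
  - have := tent_ge x0 r (chart i q).
    by move: qr; rewrite cube_norm ?divr_gt0 //=; move: `|_ - _| (tent _ _ _) => u v; lra.
  - by rewrite lef_pV2 ?posrE // ltW.
have := measure_ge0 mu (U : set (borel M)).
by case: (mu U) => [s _ _|_|]; rewrite ?ltry // gt0_muley ?lte_fin.
Qed.

(** If [U] were null, a tent supported in its image would integrate to zero, although it is at least
    r/2 on a cube of positive volume. *)
Lemma open_measure_gt0 (U : set M) p : open U -> U p ->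
  (0 < mu (U : set (borel M)))%E.
Proof.
move=> oU Up; have ip := dom_chart_at p; set i := chart_at p in ip *.
have nU : nbhs p U by exact: open_nbhs_nbhs.
have nUx : nbhs (chart i p) (chart_inv i @^-1` U) by exact: near_chart ip nU.
have [r r0 sub] := nbhs_cube (@filterI _ (nbhs (chart i p)) _ _ _
  (near_image (chart_imageP ip)) nUx).
have sub1 : cube (chart i p) r `<=` chart_image i by move=> x /sub[].
have mU := open_measurable_borel oU; have mi := open_measurable_borel (@dom_open _ M i).
rewrite lt0e measure_ge0 andbT; apply/eqP => U0.
have := tent_integral r0 sub1; set I := (\int[mu]_(p in _) _)%E.
have -> : I = 0%E.
  rewrite /I; pose F q := (chart_quot g i (tent (chart i p) r) q)%:E.
  transitivity (\int[mu]_(q in (chart_dom i : set (borel M))) (F \_ U) q)%E.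
    apply: eq_integral => q /set_mem iq; rewrite patchE; case: ifPn => // /negP qU.
    rewrite /F /chart_quot tent_eq0 ?mul0r // => /sub[_] /=.
    by rewrite (chartK iq) => /mem_set.
  rewrite -integral_mkcondr; apply: null_set_integral.
  - exact: measurableI.
  - apply: (@measurable_funS _ _ (borel M) _ (chart_dom i)) => //.
    apply/measurable_EFinP; apply: (chart_quot_measurable hg); exact: tent_continuous.
  - apply/eqP; rewrite -measure_le0 -U0; apply: le_measure; rewrite ?inE //.
    exact: measurableI.
have r20 : 0 <= r / 2 by rewrite divr_ge0 // ltW.
pose w (x : V) : \bar R :=
  (if [forall j, `|chart i p 0 j - x 0 j| < r / 2] then r / 2 else 0)%:E.
have w0 x : (0 <= w x)%E by rewrite lee_fin; case: ifP.
have wt x : (w x <= (tent (chart i p) r x)%:E)%E.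
  rewrite lee_fin; case: ifP => [/forallP H|_]; last exact: tent_ge0.
  have : cube (chart i p) (r / 2) x by move=> j; exact: H.
  rewrite cube_norm ?divr_gt0 //=; have := tent_ge (chart i p) r x.
  by move: `|_ - _| (tent _ _ _) => u v; lra.
have eqle (x y : \bar R) : x = y -> (x <= y)%E by move=> ->.
have E := @integral_rV_cube R 8 (chart i p) _ _ r20 r20.
move=> I0; have := le_trans (eqle _ _ (esym E)) (le_trans (le_integral_rV w0 wt)
  (eqle _ _ (esym I0))).
by rewrite lee_fin leNgt mulr_gt0 ?exprn_gt0 ?mulrn_wgt0 ?divr_gt0.
Qed.

Lemma compact_measure_lty (K : set M) : compact K ->
  (mu (K : set (borel M)) < +oo)%E.
Proof.
move=> cK; have [U HU] := choice locally_finite_measure.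
have [s hs] := compact_seq_cover cK (fun p => let: And3 o _ _ := HU p in o)
  (fun p => let: And3 _ u _ := HU p in u).
have mU p := open_measurable_borel (let: And3 o _ _ := HU p in o).
pose W := \big[setU/set0]_(p <- s) (U p : set (borel M)).
have [mW Wlt] : measurable (W : set (borel M)) /\ (mu W < +oo)%E.
  rewrite /W; elim: (s) => [|p s' [IH1 IH2]].
    by rewrite big_nil measure0; split.
  rewrite big_cons; split; first exact: measurableU.
  apply: le_lt_trans (measureU2 _ (mU p) IH1) _.
  by rewrite lte_add_pinfty //; case: (HU p).
apply: le_lt_trans Wlt; apply: le_measure; rewrite ?inE //.
  exact: compact_measurable_borel.
by move=> q /hs[p ps Uq]; rewrite /W -bigcup_seq; exists p.
Qed.

Lemma continuous_integrable (K : set M) (f : M -> R) : compact K -> continuous f ->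
  mu.-integrable (K : set (borel M)) (EFin \o f).
Proof.
move=> cK cf; have mK := compact_measurable_borel cK.
apply: measurable_bounded_integrable => //.
- exact: compact_measure_lty.
- apply: (@measurable_funS _ _ (borel M) _ setT) => //.
  by apply: continuous_measurable_borel; [exact: (@openT M)|move=> q _; exact: cf].
have := compact_bounded (continuous_compact (continuous_subspaceT cf) cK).
move=> [m [mr Hm]]; exists m; split=> // x /Hm H p Kp; apply: H.
by exists p.
Qed.

Lemma Rintegral_gt0 (K : set M) (f : M -> R) p : compact K -> nbhs p K ->
  continuous f -> (forall q, K q -> 0 <= f q) -> 0 < f p ->
  0 < \int[mu]_(q in (K : set (borel M))) f q.
Proof.
move=> cK nK cf f0 fp; have mK := compact_measurable_borel cK.
have nf : nbhs p [set q | f p / 2 < f q].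
  apply: (cf p [set y | f p / 2 < y]); apply: open_nbhs_nbhs; split.
    exact: open_gt.
  by rewrite /= ltr_pdivrMr // ltr_pMr // ltr1n.
pose U := (K `&` [set q | f p / 2 < f q])°.
have Up : U p by exact: (@filterI _ (nbhs p) _ _ _ nK nf).
have oU : open U by exact: open_interior.
have sub : U `<=` K `&` [set q | f p / 2 < f q] by exact: interior_subset.
have mU := open_measurable_borel oU.
have UK : U `<=` K by move=> q /sub[].
have U0 := open_measure_gt0 oU Up.
have Ulty : (mu (U : set (borel M)) < +oo)%E.
  by apply: le_lt_trans (compact_measure_lty cK); apply: le_measure; rewrite ?inE.
have iU : mu.-integrable (K : set (borel M)) 
    (EFin \o (\1_U : borel M -> R)).
  apply: measurable_bounded_integrable => //.
  - exact: compact_measure_lty.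
  exists 1; split=> // x x1 q _; apply: le_trans (ltW x1).
  by rewrite indicE; case: (_ \in _); rewrite ?normr1 ?normr0.
apply: (@lt_le_trans _ _ (\int[mu]_(q in (K : set (borel M))) (f p / 2 * \1_U q))).
  rewrite RintegralZl // mulr_gt0 ?divr_gt0 //.
  by rewrite /Rintegral integral_indic // setIidl // fine_gt0 // U0 Ulty.
apply: le_Rintegral => //.
- have := integrableZl mK (f p / 2) iU; apply: eq_integrable => // q _.
- exact: continuous_integrable.
move=> q Kq; rewrite indicE; case: (boolP (q \in (U : set M))) => [/set_mem/sub[_] /= fq|_].
  by rewrite mulr1 ltW.
by rewrite mulr0 f0.
Qed.

End CompactIntegral.

(** * Stokes' theorem *)

Section Bump.
Variables (R : realType) (M : manifold R).
Local Notation V := 'rV[R]_8.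
Implicit Types (i j : chart_index M) (p q : M).

(** Off the closed set [K] only the vanishing of the product is assumed. This allows quotients with
    a denominator that vanishes there, and forms that are constant in one chart and meaningless
    outside it. *)
Lemma is_form_mul (k : nat) (rho : M -> R) (w : tensor_field M k) (K : set M) :
  closed K ->
  (forall j p, chart_dom j p -> K p -> msmooth j rho p) ->
  (forall j p a, chart_dom j p -> K p -> msmooth j (fun q => w j q a) p) ->
  (forall j p, chart_dom j p -> alternating (w j p)) ->
  (forall i j p, chart_dom i p -> chart_dom j p -> K p ->
    w i p = pullback (transition_jacobian i j p)^T (w j p)) ->
  (forall j p a, chart_dom j p -> ~ K p -> rho p * w j p a = 0) ->
  is_form (fun j p a => rho p * w j p a).
Proof.
move=> cK srho sw aw tw zw; split.
- move=> j a; apply: smooth_compP => p jp; have [Kp|nKp] := pselect (K p).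
    by apply: smooth_atM; [exact: srho|exact: sw].
  apply: (@msmooth_eq _ _ j (fun=> 0)) => //; last exact: smooth_at_cst.
  have nK : nbhs p (~` K) by apply: open_nbhs_nbhs; split=> //; exact: closed_openC.
  by apply: filterS2 nK (near_dom jp) => q nq jq; rewrite zw.
- by move=> j p jp s a; rewrite (aw j p jp) mulrCA.
- move=> i j p a ip jp; have [Kp|nKp] := pselect (K p).
    rewrite (tw i j p ip jp Kp) /pullback mulr_sumr.
    by apply: eq_bigr => b _; rewrite mulrCA.
  by rewrite zw // /pullback big1 // => b _; rewrite zw // mulr0.
Qed.

Variables (i : chart_index M) (x0 : V) (r : R).
Hypothesis r0 : 0 < r.
Hypothesis sub : closed_cube x0 r `<=` chart_image i.

(** Positive exactly on the Euclidean ball of radius [r] in the chart, which lies inside the open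
    cube; the squared distance is a polynomial, hence smooth. *)
Definition bump p : R :=
  if `[< chart_dom i p >]
  then flat 0 (r ^+ 2 - \sum_b (chart i p 0 b - x0 0 b) ^+ 2) else 0.

Definition chart_cube : set M := chart_inv i @` closed_cube x0 r.

Lemma chart_cubeP p : chart_cube p -> chart_dom i p /\ closed_cube x0 r (chart i p).
Proof.
by move=> [x xr <-]; have [ix ->] := chart_invK (sub xr).
Qed.

Lemma chart_cubeI p : chart_dom i p -> closed_cube x0 r (chart i p) -> chart_cube p.
Proof. by move=> ip pr; exists (chart i p); rewrite ?chartK. Qed.

Lemma chart_cube_compact : compact chart_cube.
Proof.
apply: continuous_compact; last exact: closed_cube_compact.
by apply: continuous_in_subspaceT => x /set_mem/sub; exact: chart_inv_cont.
Qed.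

Lemma chart_cube_closed : closed chart_cube.
Proof. exact: (compact_closed (@point_hausdorff _ M) chart_cube_compact). Qed.

Lemma bump_ge0 p : 0 <= bump p.
Proof. by rewrite /bump; case: asboolP => // _; exact: flat_ge0. Qed.

Lemma bump_gt0 p : chart_dom i p -> chart i p = x0 -> 0 < bump p.
Proof.
move=> ip E; rewrite /bump asboolT // flat_gt0 // E big1 ?subr0 ?exprn_gt0 //.
by move=> b _; rewrite subrr expr0n.
Qed.

Lemma bump_neq0 p : bump p != 0 -> chart_dom i p /\ cube x0 r (chart i p).
Proof.
rewrite /bump; case: asboolP => [ip H|_]; last by rewrite eqxx.
split=> // b; rewrite ltNge; apply: contra H => H.
rewrite flat_le0 // subr_le0 (bigD1 b) //= ler_wpDr //.
  by apply: sumr_ge0 => c _; exact: sqr_ge0.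
by rewrite -[leRHS]real_normK ?num_real // distrC lerXn2r // ?nnegrE ?normr_ge0 // ltW.
Qed.

Lemma bump_eq0 p : ~ chart_cube p -> bump p = 0.
Proof.
move=> np; apply: contrapT => /eqP/bump_neq0[ip pr]; apply: np.
by apply: chart_cubeI => // b; exact/ltW/(pr b).
Qed.

(** Holds in every chart. At points of the compact cube the transition map is available; the cube is
    closed because [M] is Hausdorff, so off it the bump vanishes on a neighbourhood. *)
Lemma bump_msmooth j p : chart_dom j p -> msmooth j bump p.
Proof.
move=> jp; have [/chart_cubeP[ip _]|np] := pselect (chart_cube p).
  apply: (@msmooth_eq _ _ j
    (fun q => flat 0 (r ^+ 2 - \sum_b (chart i q 0 b - x0 0 b) ^+ 2))) => //.
    by apply: filterS (near_dom ip) => q iq; rewrite /bump asboolT.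
  apply: smooth_at_flat; apply: smooth_atD; first exact: smooth_at_cst.
  apply: smooth_atN; apply: smooth_at_sum => b _.
  have sb : smooth_at (fun x : V => chart i (chart_inv j x) 0 b - x0 0 b) (chart j p).
    apply: smooth_atD; last exact: smooth_at_cst.
    exact: msmooth_transition.
  exact: smooth_atM.
apply: (@msmooth_eq _ _ j (fun=> 0)) => //; last exact: smooth_at_cst.
have nK : nbhs p (~` chart_cube).
  by apply: open_nbhs_nbhs; split=> //; apply: closed_openC; exact: chart_cube_closed.
by apply: filterS nK => q /bump_eq0 ->.
Qed.

Lemma bump_continuous : continuous bump.
Proof.
move=> p; apply: (@msmooth_cont _ _ (chart_at p)); first exact: dom_chart_at.
by apply: bump_msmooth; exact: dom_chart_at.
Qed.

End Bump.

Section PullbackAlgebra.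
Variable R : realType.

Lemma pullback_alternating k (A : 'M[R]_8) (t : tensor R k) :
  alternating t -> alternating (pullback A t).
Proof.
move=> at_ s a; rewrite /pullback mulr_sumr.
have inj : injective (@permute_idx k s).
  move=> b b' /eqP/eqP E; apply: eq_from_tnth => m.
  by have := congr1 (fun c => tnth c (s^-1%g m)) E; rewrite !tnth_mktuple permKV.
rewrite (reindex_inj inj); apply: eq_bigr => b _.
rewrite at_ mulrCA; congr (_ * (_ * _)).
rewrite [RHS](reindex_inj (@perm_inj _ s)); apply: eq_bigr => m _.
by rewrite !tnth_mktuple.
Qed.

Lemma pullback_sum (I : Type) (r : seq I) k (A : 'M[R]_8) (c : I -> R)
    (t : I -> tensor R k) a :
  pullback A (fun b => \sum_(n <- r) c n * t n b) a =
  \sum_(n <- r) c n * pullback A (t n) a.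
Proof.
under [RHS]eq_bigr do rewrite /pullback mulr_sumr.
rewrite exchange_big; apply: eq_bigr => b _; rewrite mulr_sumr.
by apply: eq_bigr => n _; rewrite mulrCA.
Qed.

Lemma pullback_comp k (A B : 'M[R]_8) (t : tensor R k) :
  pullback A (pullback B t) = pullback (B *m A) t.
Proof.
apply/funext; elim: k t => [|k IH] t a; first by rewrite !pullback_nil.
case/tupleP: a => x a; rewrite !pullback_cons.
transitivity (\sum_y \sum_z B z y * A y x * pullback (B *m A) (fun b => t [tuple of z :: b]) a).
  apply: eq_bigr => y _; rewrite -[RHS]/(\sum_(z <- _) _).
  transitivity (A y x * pullback A (fun b => \sum_z B z y *
      pullback B (fun b' => t [tuple of z :: b']) b) a).
    by congr (_ * pullback A _ a); apply/funext => b; rewrite pullback_cons.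
  rewrite pullback_sum mulr_sumr; apply: eq_bigr => z _.
  by rewrite -IH mulrA [A y x * _]mulrC.
rewrite exchange_big; apply: eq_bigr => z _ /=; rewrite mxE mulr_suml.
by apply: eq_bigr.
Qed.

Lemma pullback1 k (t : tensor R k) : pullback 1%:M t = t.
Proof.
apply/funext; elim: k t => [|k IH] t a; first by rewrite pullback_nil.
case/tupleP: a => x a; rewrite pullback_cons (bigD1 x) //= IH mxE eqxx mul1r.
by rewrite big1 ?addr0 // => y /negPf yx; rewrite mxE yx mul0r.
Qed.

End PullbackAlgebra.

Section Stokes.
Variables (R : realType) (M : manifold R).
Variables (Phi : tensor_field M 4) (g : matrix_field M).
Hypothesis hPhi : is_cayley_form Phi.
Hypothesis hg : is_metric_of Phi g.
Variable T : tensor_field M 3.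
Hypothesis hT : is_torsion Phi g T.
Variable mu : {measure set (borel M) -> \bar R}.
Hypothesis hmu : is_riemannian_measure mu g.
Local Notation V := 'rV[R]_8.
Implicit Types (i j : chart_index M) (p q : M).

Let fT : is_form T. Proof. by case: hT. Qed.

(** Up to a constant, d(Phi /\ c) divided by Phi /\ Phi. *)
Definition divergence (c : tensor_field M 3) p : R :=
  ratio_d Phi c p - 3 * ratio_contract Phi g T c p.

Lemma divergence_continuous c : is_form c -> continuous (divergence c).
Proof.
move=> fc p; have c1 := ratio_d_continuous hPhi hg fc (x := p).
have c2 := ratio_contract_continuous hPhi hg fT fc (x := p).
exact: (continuousB c1 (continuousM (@cst_continuous M R 3 p) c2)).
Qed.

(** Derivatives of [c] enter, so [c] is assumed to vanish on a neighbourhood and not merely at the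
    point. *)
Lemma divergence_near0 c p :
  (\forall q \near p, forall j a, chart_dom j q -> c j q a = 0) ->
  divergence c p = 0.
Proof.
move=> nc; have ip := dom_chart_at p; set i := chart_at p in ip *.
rewrite /divergence /ratio_d /ratio_contract -/i.
have -> : density_d Phi i p c = 0.
  rewrite /density_d /top_sum big1 // => s _.
  have -> a e : partial i e (fun q => c i q a) p = 0.
    rewrite -(partial_cst i p e 0); apply: partial_eq => //.
    by apply: filterS2 nc (near_dom ip) => q H iq; exact: H.
  by rewrite !mulr0.
have cp a : c i p a = 0 by have H := nbhs_singleton nc; exact: H.
have -> : density_contract Phi g i p T c = 0.
  rewrite /density_contract /top_sum big1 // => s _.
  rewrite /contract big1 ?mulr0 // => r _; rewrite big1 // => q _.
  by rewrite cp mulr0 mul0r.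
by rewrite !mul0r mulr0 subrr.
Qed.

Lemma divergenceD u v t p : is_form u -> is_form v ->
  divergence (fun i p a => u i p a + t * v i p a) p =
  divergence u p + t * divergence v p.
Proof.
move=> fu fv; have ip := dom_chart_at p.
rewrite /divergence /ratio_d /ratio_contract (density_dD Phi _ fu fv ip).
by rewrite density_contractDr; ring.
Qed.

Lemma divergenceE c i p : is_form c -> chart_dom i p ->
  divergence c p = (\sum_e partial i e (flux Phi c i e) p) / density_vol Phi i p.
Proof.
move=> fc ip; rewrite /divergence (ratio_dE hPhi hg fc ip).
rewrite (ratio_contractE hPhi hg fT fc ip) mulrA -mulrBl.
by rewrite (divergence_flux hPhi hg hT fc ip).
Qed.

(* The sign of Phi /\ Phi relative to the coordinates is locally constant; k is
   this sign times the value of Phi /\ Phi in an orthonormal coframe. *)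
Lemma chart_box p (P : set M) (i := chart_at p) : nbhs p P ->
  exists r k : R, [/\ 0 < r, cube (chart i p) (r *+ 2) `<=` chart_image i, k != 0 &
    forall q, chart_dom i q -> closed_cube (chart i p) r (chart i q) ->
      P q /\ density_vol Phi i q = k * vol_density g i q].
Proof.
move=> nP; have ip : chart_dom i p := dom_chart_at p.
have v0 : density_vol Phi i p != 0 := density_vol_neq0 hg ip.
have cv : {for p, continuous (fun q => density_vol Phi i q * density_vol Phi i p)}.
  have c1 := msmooth_cont ip (density_vol_msmooth hPhi ip).
  exact: (continuousM c1 (@cst_continuous M R _ p)).
have nv : nbhs p [set q | 0 < density_vol Phi i q * density_vol Phi i p].
  apply: (cv [set y | 0 < y]); apply: open_nbhs_nbhs; split; first exact: open_gt.
  by rewrite /= -expr2 exprn_even_gt0.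
have nx : nbhs (chart i p) (chart_inv i @^-1`
    [set q | P q /\ 0 < density_vol Phi i q * density_vol Phi i p]).
  by apply: near_chart ip _; exact: (@filterI _ (nbhs p) _ _ _ nP nv).
have [s s0 sub] := nbhs_cube (@filterI _ (nbhs (chart i p)) _ _ _
  (near_image (chart_imageP ip)) nx).
exists (s / 2), (Num.sg (density_vol Phi i p) *
  `|top_sum (fun a => Phi0 R (first4 a) * Phi0 R (last4 a))|).
have sE : (s / 2) *+ 2 = s by rewrite -mulr_natr divfK.
split; first by rewrite divr_gt0.
- by rewrite sE => x /sub[].
- by rewrite mulf_neq0 ?sgr_eq0 // normr_eq0 Phi0_volume.
move=> q iq qr; have /sub[_ /=] : cube (chart i p) s (chart i q).
  by apply: closed_cube_sub qr; rewrite ltr_pdivrMr // ltr_pMr // ltr1n.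
rewrite (chartK iq) => -[Pq vq]; split=> //.
rewrite -mulrA [_ * vol_density _ _ _]mulrC -(normr_density_vol hg iq).
have -> : Num.sg (density_vol Phi i p) = Num.sg (density_vol Phi i q).
  have := vq; rewrite -sgr_gt0 sgrM; case: (sgrP (density_vol Phi i q));
  case: (sgrP (density_vol Phi i p)); rewrite ?mul0r ?mulr0 ?ltxx ?mulN1r ?mulr1;
  by rewrite ?mul1r ?oppr_gt0 ?ltr10 ?ltrN10.
by rewrite -numEsg.
Qed.

Let Rintegral_sum_eq0 (D : set M) (I : Type) (s : seq I) (F : I -> M -> R) :
  measurable (D : set (borel M)) ->
  (forall n, mu.-integrable (D : set (borel M)) (EFin \o F n) /\
    \int[mu]_(p in (D : set (borel M))) F n p = 0) ->
  mu.-integrable (D : set (borel M)) (EFin \o (fun p => \sum_(n <- s) F n p)) /\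
  \int[mu]_(p in (D : set (borel M))) (\sum_(n <- s) F n p) = 0.
Proof.
move=> mD HF; elim: s => [|n s [IH1 IH2]].
  have -> : (fun p : M => \sum_(n <- [::]) F n p) = cst 0.
    by apply/funext => p; rewrite big_nil.
  by split; [exact: integrable0|rewrite Rintegral_cst // mul0r].
have -> : (fun p : M => \sum_(m <- n :: s) F m p) = fun p => F n p + \sum_(m <- s) F m p.
  by apply/funext => p; rewrite big_cons.
have [H1 H2] := HF n; split.
  by apply: eq_integrable mD _ _ _ (integrableD mD H1 IH1) => q _.
by rewrite RintegralD // H2 IH2 addr0.
Qed.

(** In the box the divergence is 1/k times the coordinate divergence of the flux over sqrt (det g),
    and each partial derivative integrates to zero. *)
Lemma local_stokes c i (x0 : V) (r k : R) : is_form c -> 0 < r ->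
  cube x0 (r *+ 2) `<=` chart_image i -> k != 0 ->
  (forall q, chart_dom i q -> closed_cube x0 r (chart i q) ->
    density_vol Phi i q = k * vol_density g i q) ->
  (forall j p a, chart_dom j p -> ~ (chart_dom i p /\ cube x0 r (chart i p)) ->
    c j p a = 0) ->
  \int[mu]_(p in (chart_dom i : set (borel M))) divergence c p = 0.
Proof.
move=> fc r0 sub k0 vE cz.
have subc : closed_cube x0 r `<=` chart_image i.
  move=> x xr; apply: sub; apply: closed_cube_sub xr; lra.
(* The flux extended by zero to all of R^8; the extension is smooth because the closed cube lies
   inside the chart image. *)
pose h e x := if `[< chart_image i x >] then flux Phi c i e (chart_inv i x) else 0.
have hz e x : ~ cube x0 r x -> h e x = 0.
  move=> nx; rewrite /h; case: asboolP => // xi.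
  have [ix xE] := chart_invK xi; rewrite /flux /top_sum big1 // => s _.
  by rewrite cz ?mulr0 // xE => -[].
have sh e x : smooth_at (h e) x.
  have [xi|nxi] := pselect (chart_image i x).
    have [ix xE] := chart_invK xi.
    apply: (@smooth_at_eq _ (flux Phi c i e \o chart_inv i)).
      by apply: filterS (near_image xi) => y yi; rewrite /h asboolT.
    by have := flux_msmooth hPhi e fc ix; rewrite /msmooth xE.
  apply: (@smooth_at_eq _ (fun=> 0)); last exact: smooth_at_cst.
  have nx : ~ closed_cube x0 r x by move=> /subc.
  apply: filterS (closed_cube_setC_nbhs nx) => y ny; rewrite hz // => yr.
  by apply: ny => j; exact/ltW/(yr j).
have H e := chart_Rintegral_derivative hg hmu (a := e) r0 sub
  (fun x => smooth_at_cont (sh e x)) (fun x => smooth_at_derivable (sh e x))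
  (fun x => smooth_at_cont (smooth_at_derive e (sh e x))) (hz e).
have md := open_measurable_borel (@dom_open _ M i).
have [H1 H2] := Rintegral_sum_eq0 (index_enum 'I_8) md H.
rewrite -[RHS](mulr0 k^-1) -H2 -RintegralZl //; apply: eq_Rintegral => p /set_mem ip.
rewrite (divergenceE fc ip).
have -> : \sum_e partial i e (flux Phi c i e) p =
    \sum_e 'D_(basis_vec R e) (h e) (chart i p).
  apply: eq_bigr => e _; apply: near_eq_derive.
  apply: filterS (near_image (chart_imageP ip)) => y yi.
  by rewrite /h asboolT.
rewrite /chart_quot -mulr_suml.
have [pr|npr] := pselect (closed_cube x0 r (chart i p)).
  by rewrite (vE p ip pr) invfM mulrCA.
rewrite big1 ?mul0r ?mulr0 // => e _.
rewrite -(@derive_cst _ _ R^o 0 (chart i p) (basis_vec R e)); apply: near_eq_derive.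
apply: filterS (closed_cube_setC_nbhs npr) => y ny; rewrite hz // => yr.
by apply: ny => j; exact/ltW/(yr j).
Qed.

End Stokes.

Section GlobalStokes.
Variables (R : realType) (M : manifold R).
Variables (Phi : tensor_field M 4) (g : matrix_field M).
Hypothesis hPhi : is_cayley_form Phi.
Hypothesis hg : is_metric_of Phi g.
Variable T : tensor_field M 3.
Hypothesis hT : is_torsion Phi g T.
Variable mu : {measure set (borel M) -> \bar R}.
Hypothesis hmu : is_riemannian_measure mu g.
Local Notation V := 'rV[R]_8.
Implicit Types (i j : chart_index M) (p q : M).

Let Rintegral_support (D D' : set M) (f : M -> R) :
  (forall p, ~ D p -> f p = 0) -> (forall p, ~ D' p -> f p = 0) ->
  \int[mu]_(p in (D : set (borel M))) f p = \int[mu]_(p in (D' : set (borel M))) f p.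
Proof.
have E (A : set M) : (forall p, ~ A p -> f p = 0) -> f \_ A = f.
  move=> fz; apply/funext => p; rewrite patchE; case: ifPn => // /negP pA.
  by rewrite fz // => Ap; apply: pA; rewrite inE.
by move=> fD fD'; rewrite Rintegral_mkcond (E D) // [RHS]Rintegral_mkcond (E D').
Qed.

Let is_form0 : is_form ((fun=> fun=> fun=> 0) : tensor_field M 3).
Proof.
split=> [j a|j p jp s a|j i p a jp ip]; last by rewrite /pullback big1 // => *; rewrite mulr0.
- by apply: smooth_compP => p jp; exact: smooth_at_cst.
- by rewrite mulr0.
Qed.

Lemma stokes c (K : set M) : is_form c -> compact K ->
  (forall j p a, chart_dom j p -> ~ K p -> c j p a = 0) ->
  \int[mu]_(p in (K : set (borel M))) divergence Phi g T c p = 0.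
Proof.
move=> fc cK cz; have clK : closed K := compact_closed (@point_hausdorff _ M) cK.
have nK p : ~ K p -> nbhs p (~` K) 
  by move=> np; apply: open_nbhs_nbhs; split=> //; exact: closed_openC.
have /choice[r /choice[k box]] : forall p, exists r k : R, [/\ 0 < r,
    cube (chart (chart_at p) p) (r *+ 2) `<=` chart_image (chart_at p), k != 0 &
    forall q, chart_dom (chart_at p) q ->
      closed_cube (chart (chart_at p) p) r (chart (chart_at p) q) ->
      setT q /\ density_vol Phi (chart_at p) q = k * vol_density g (chart_at p) q].
  by move=> p; apply: chart_box hPhi hg _ _ _; exact: filterT.
have r0 p : 0 < r p by case: (box p).
have sub p : closed_cube (chart (chart_at p) p) (r p) `<=` chart_image (chart_at p).
  have [_ s _ _] := box p; move=> x xr; apply: s; apply: closed_cube_sub xr.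
  by have := r0 p; lra.
pose rho p := bump (chart_at p) (chart (chart_at p) p) (r p).
have rho0 p q : 0 <= rho p q by exact: bump_ge0.
have crho p : continuous (rho p) by exact: bump_continuous.
have oU p : open [set q | 0 < rho p q].
  by apply: (@open_comp _ _ (rho p) [set y | 0 < y]) => [q _|]; [exact: crho|exact: open_gt].
have Up p : [set q | 0 < rho p q] p.
  by apply: bump_gt0 => //; exact: dom_chart_at.
have [s hs] := compact_seq_cover cK oU Up.
pose S q := \sum_(p <- s) rho p q.
have S0 q : K q -> S q != 0.
  move=> /hs[p ps pq]; rewrite gt_eqF // /S (big_rem p ps) /= ltr_wpDr //.
  exact: sumr_ge0.
have sS j q : chart_dom j q -> msmooth j S q.
  by move=> jq; apply: smooth_at_sum => p _; exact: bump_msmooth.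
(* Weights of a partition of unity on [K]. Where [S] vanishes the quotient is not smooth, but this
   happens only off [K], where [c] is zero. *)
pose cut p : tensor_field M 3 := fun j q a => rho p q / S q * c j q a.
have fcut p : is_form (cut p).
  apply: (@is_form_mul _ _ _ (fun q => rho p q / S q) c K) => //.
  - move=> j q jq Kq; apply: smooth_atM; first exact: bump_msmooth.
    by apply: smooth_atV; [exact: sS|rewrite /= (chartK jq); exact: S0].
  - by move=> j q a jq _; exact: form_msmooth.
  - by move=> j q jq; exact: form_alternating.
  - by move=> i j q iq jq _; exact: form_transition.
  - by move=> j q a jq nq; rewrite cz ?mulr0.
(* Partial sums along the list, so that additivity of the divergence is applied to one cut-off form
   at a time. *)
pose csum (t : seq M) : tensor_field M 3 :=
  fun j q a => (\sum_(p <- t) rho p q) / S q * c j q a.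
have csumE p t : csum (p :: t) = fun j q a => csum t j q a + 1 * cut p j q a.
  apply/funext => j; apply/funext => q; apply/funext => a.
  by rewrite /csum /cut big_cons; ring.
have fsum t : is_form (csum t).
  elim: t => [|p t IH]; last by rewrite csumE; exact: is_formD.
  have -> : csum [::] = fun=> fun=> fun=> 0.
    apply/funext => j; apply/funext => q; apply/funext => a.
    by rewrite /csum big_nil !mul0r.
  exact: is_form0.
have mK := compact_measurable_borel cK.
have divz (u : tensor_field M 3) q : (forall j p a, chart_dom j p -> ~ K p -> u j p a = 0) ->
    ~ K q -> divergence Phi g T u q = 0.
  by move=> uz /nK nq; apply: divergence_near0; apply: filterS nq => z nz j a jz; exact: uz.
have I0 p : \int[mu]_(q in (K : set (borel M))) divergence Phi g T (cut p) q = 0.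
  have [_ sub2 k0 vE] := box p.
  rewrite -(@local_stokes _ _ _ _ hPhi hg _ hT mu hmu (cut p) (chart_at p)
    (chart (chart_at p) p) (r p) (k p)) //.
  - apply: Rintegral_support => q; first by apply: divz => j z a jz nz; rewrite /cut cz ?mulr0.
    move=> nq; have nC : ~ chart_cube (chart_at p) (chart (chart_at p) p) (r p) q.
      by move=> /(chart_cubeP (@sub p))[].
    have nn : nbhs q (~` chart_cube (chart_at p) (chart (chart_at p) p) (r p)).
      apply: open_nbhs_nbhs; split=> //; apply: closed_openC; apply: chart_cube_closed.
      exact: sub.
    apply: divergence_near0; apply: filterS nn => z nz j a jz.
    by rewrite /cut /rho bump_eq0 // !mul0r.
  - by move=> q iq qr; case: (vE q iq qr).
  - move=> j q a jq nq; rewrite /cut.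
    have -> : rho p q = 0 by apply: contrapT => /eqP/(bump_neq0 (r0 p)).
    by rewrite !mul0r.
have It t : \int[mu]_(q in (K : set (borel M))) divergence Phi g T (csum t) q = 0.
  elim: t => [|p t IH].
    rewrite (@eq_Rintegral _ (borel M) _ _ _ (cst 0)) ?Rintegral_cst ?mul0r // => q _.
    by apply: divergence_near0; near=> z => j a _; rewrite /csum big_nil !mul0r.
  rewrite (@eq_Rintegral _ (borel M) _ _ _
    (fun q => divergence Phi g T (csum t) q + divergence Phi g T (cut p) q)).
    rewrite RintegralD // ?IH ?I0 ?addr0 //; apply: (continuous_integrable hg hmu cK);
    exact: divergence_continuous.
  by move=> q _; rewrite csumE divergenceD // mul1r.
rewrite -[RHS](It s); apply: eq_Rintegral => q /set_mem Kq.
apply/eqP; rewrite -subr_eq0 -mulN1r; apply/eqP.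
(* The full sum coincides with [c]: on [K] the weights add up to one, off [K] both vanish. *)
rewrite -divergenceD //; apply: divergence_near0; near=> z => j a jz.
have [Kz|nKz] := pselect (K z); last by rewrite /csum cz // !mulr0 addr0.
by rewrite /csum -/(S z) divff ?S0 // mul1r mulN1r subrr.
Unshelve. all: by end_near. Qed.

End GlobalStokes.

(** * The first variation *)

Section Variation.
Variables (R : realType) (M : manifold R).
Variables (Phi : tensor_field M 4) (g : matrix_field M).
Hypothesis hPhi : is_cayley_form Phi.
Hypothesis hg : is_metric_of Phi g.
Variable mu : {measure set (borel M) -> \bar R}.
Hypothesis hmu : is_riemannian_measure mu g.
Local Notation V := 'rV[R]_8.
Implicit Types (i j : chart_index M) (p q : M).

Lemma form_extension (k : nat) p (t : tensor R k) : alternating t ->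
  exists (w : tensor_field M k) (b : R), [/\ is_form w, b != 0 &
    forall a, w (chart_at p) p a = b * t a].
Proof.
move=> at_; have ip := dom_chart_at p; set i := chart_at p in ip *.
have [s s0 sub] := nbhs_cube (near_image (chart_imageP ip)).
have r0 : 0 < s / 2 by rewrite divr_gt0.
have sub' : closed_cube (chart i p) (s / 2) `<=` chart_image i.
  by move=> x xr; apply: sub; apply: closed_cube_sub xr; lra.
exists (fun j q a => bump i (chart i p) (s / 2) q *
  pullback (transition_jacobian j i q)^T t a), (bump i (chart i p) (s / 2) p).
split; last 2 first.
- by rewrite gt_eqF // bump_gt0.
- by move=> a; rewrite transition_jacobian_id // trmx1 pullback1.
apply: (@is_form_mul _ _ _ (bump i (chart i p) (s / 2))
  (fun j q => pullback (transition_jacobian j i q)^T t) (chart_cube i (chart i p) (s / 2))).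
- exact: chart_cube_closed.
- by move=> j q jq _; exact: bump_msmooth.
- move=> j q a jq /(chart_cubeP sub')[iq _]; apply: smooth_at_sum => b _.
  apply: smooth_atM; last exact: smooth_at_cst.
  apply: smooth_at_prod => m _.
  apply: (@msmooth_eq _ _ j (fun z => transition_jacobian j i z (tnth a m) (tnth b m))
    (fun z => (transition_jacobian j i z)^T (tnth b m) (tnth a m)) q jq).
    by near=> z; rewrite [RHS]mxE.
  exact: msmooth_jacobian.
- by move=> j q jq; exact: pullback_alternating.
- move=> j l q jq lq /(chart_cubeP sub')[iq _].
  by rewrite pullback_comp -trmx_mul -transition_jacobian_comp.
- by move=> j q a jq nq; rewrite bump_eq0 // mul0r.
Unshelve. all: by end_near. Qed.

Lemma ratio_contractZr E (rho : M -> R) c p :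
  ratio_contract Phi g E (fun j q a => rho q * c j q a) p =
  rho p * ratio_contract Phi g E c p.
Proof.
rewrite /ratio_contract mulrA; congr (_ / _); rewrite /density_contract -top_sumZ.
apply: eq_top_sum => a; rewrite mulrCA; congr (_ * _).
rewrite /contract mulr_sumr; apply: eq_bigr => r _; rewrite mulr_sumr.
by apply: eq_bigr => q _; ring.
Qed.

Lemma ratio_contract_nondegenerate E i p a : is_form E -> chart_dom i p ->
  E i p a != 0 -> exists2 c, is_form c & ratio_contract Phi g E c p != 0.
Proof.
move=> fE ip Ea; have jp := dom_chart_at p; set j := chart_at p in jp *.
have [A [Au PA gA]] := metric_coframe hg jp.
(* The components of [E] in the orthonormal coframe, where [Phi] is [Phi0] and the metric is the
   identity. *)
pose E' := pullback (invmx A) (E j p).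
have EE' : E j p = pullback A E' by rewrite pullback_comp mulVmx // pullback1.
have aE' : alternating E' by apply: pullback_alternating; exact: form_alternating.
have [b Eb] : exists b, E' b != 0.
  apply: contrapT => H; move/eqP: Ea; apply.
  have E0 b : E' b = 0 by apply: contrapT => /eqP H'; apply: H; exists b.
  have [_ _ tE] := fE; rewrite (tE i j p a ip jp) EE' pullback_comp.
  by rewrite /pullback big1 // => d _; rewrite E0 mulr0.
rewrite (tuple3E b) in Eb; have [v av nv] := Phi0_nondegenerate aE' Eb.
have [c [k [fc k0 cE]]] := form_extension p (pullback_alternating A av).
exists c => //; rewrite /ratio_contract -/j mulf_neq0 ?invr_eq0 ?(density_vol_neq0 hg) //.
have -> : density_contract Phi g j p E c =
    k * top_sum (fun a => pullback A (@Phi0 R) (first4 a) *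
      pullback A (contract 1%:M E' (delta3 R v)) (last4 a)).
  rewrite /density_contract -top_sumZ; apply: eq_top_sum => d.
  rewrite -PA mulrCA; congr (_ * _).
  rewrite (contract_pullback (G := invmx (g j p))); last first.
    have AT : A^T \in unitmx by rewrite unitmx_tr.
    have E1 : A^T *m (A *m invmx (g j p) *m A^T) = A^T.
      by rewrite !mulmxA -gA mulmxV ?mul1mx // (metric_unit hg jp).
    by rewrite -[RHS](mulKmx AT) E1 mulVmx.
  rewrite -EE' /contract mulr_sumr; apply: eq_bigr => r _; rewrite mulr_sumr.
  by apply: eq_bigr => q _; rewrite cE; ring.
by rewrite top_sum_pullback2 !mulf_neq0 // -unitfE -unitmxE.
Qed.

(** The form [c] found at [p] is multiplied by a bump supported where the contraction keeps the sign
    of its value [n] at [p]. Times [n], the integrand is then nonnegative on [K] and positive at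
    [p]. *)
Lemma contract_test_form E i p a : is_form E -> chart_dom i p -> E i p a != 0 ->
  exists (c : tensor_field M 3) (K : set M), [/\ is_form c, compact K,
    forall j q b, chart_dom j q -> ~ K q -> c j q b = 0 &
    \int[mu]_(q in (K : set (borel M))) ratio_contract Phi g E c q != 0].
Proof.
move=> fE ip Ea; have [c fc cp] := ratio_contract_nondegenerate fE ip Ea.
set n := ratio_contract Phi g E c p in cp.
have jp := dom_chart_at p; set j := chart_at p in jp *.
have cN : continuous (fun q => n * ratio_contract Phi g E c q).
  move=> q; have c2 := ratio_contract_continuous hPhi hg fE fc (x := q).
  exact: (continuousM (@cst_continuous M R n q) c2).
have nN : nbhs p [set q | 0 < n * ratio_contract Phi g E c q].
  apply: (cN p [set y | 0 < y]); apply: open_nbhs_nbhs; split; first exact: open_gt.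
  by rewrite /= -expr2 exprn_even_gt0.
have [r [k [r0 sub2 _ box]]] := chart_box hPhi hg nN; rewrite -/j in sub2 box.
have sub : closed_cube (chart j p) r `<=` chart_image j.
  by move=> x xr; apply: sub2; apply: closed_cube_sub xr; lra.
pose rho := bump j (chart j p) r; pose K := chart_cube j (chart j p) r.
have fw : is_form (fun l q b => rho q * c l q b).
  apply: (@is_form_mul _ _ _ rho c setT) => //.
  - by move=> l q lq _; exact: bump_msmooth.
  - by move=> l q b lq _; exact: form_msmooth.
  - by move=> l q lq; exact: form_alternating.
  - by move=> l m q lq mq _; exact: form_transition.
  - by move=> l q b _ /(_ Logic.I).
exists (fun l q b => rho q * c l q b), K; split=> //.
- exact: chart_cube_compact.
- by move=> l q b lq nq; rewrite /rho bump_eq0 // mul0r.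
have crw : continuous (ratio_contract Phi g E (fun l q b => rho q * c l q b)).
  exact: ratio_contract_continuous.
suff : 0 < \int[mu]_(q in (K : set (borel M)))
    (n * ratio_contract Phi g E (fun l q b => rho q * c l q b) q).
  rewrite RintegralZl; first by apply: contraTneq => ->; rewrite mulr0 ltxx.
  - by apply: compact_measurable_borel; exact: chart_cube_compact.
  - by apply: (continuous_integrable hg hmu) => //; exact: chart_cube_compact.
apply: (Rintegral_gt0 hg hmu (p := p)).
- exact: chart_cube_compact.
- have nx := near_chart_inv jp (cube_nbhs (chart j p) r0).
  apply: filterS2 nx (near_dom jp) => q qr jq; apply: chart_cubeI => // b.
  exact/ltW/(qr b).
- move=> q; exact: (continuousM (@cst_continuous M R n q) (crw q)).
- move=> q /(chart_cubeP sub)[jq qr]; have [/= /ltW nq _] := box q jq qr.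
  by rewrite ratio_contractZr mulrCA mulr_ge0 // bump_ge0.
- rewrite ratio_contractZr mulrCA mulr_gt0 //; first by apply: bump_gt0.
  by rewrite -/n -expr2 exprn_even_gt0.
Qed.

Variable T : tensor_field M 3.
Hypothesis hT : is_torsion Phi g T.
Variables (lambda : R) (C : tensor_field M 3).
Hypothesis fC : is_form C.
Let fT : is_form T. Proof. by case: hT. Qed.

Lemma cayley_action_quadratic c (K : set M) : is_form c -> compact K ->
  (forall i p a, chart_dom i p -> ~ K p -> c i p a = 0) ->
  exists u v : R, forall t : R,
    cayley_action mu Phi g lambda K (fun i p a => C i p a + t * c i p a) =
    u + t * (- 168 * \int[mu]_(p in (K : set (borel M)))
      ratio_contract Phi g (fun i p a => C i p a + - 1 * T i p a) c p) + t ^+ 2 * v.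
Proof.
move=> fc cK cz; have mK := compact_measurable_borel cK.
set E : tensor_field M 3 := fun i p a => C i p a + - 1 * T i p a.
have fE : is_form E by exact: is_formD.
pose u p := 56 * ratio_d Phi C p - 84 * ratio_contract Phi g C C p + lambda / 6.
(* The linear coefficient rewritten with 56 . 3 = 168: what [divergence] subtracts combines with the
   cross term into the contraction with C - T, and the divergence integrates to zero. *)
pose w p := 56 * divergence Phi g T c p - 168 * ratio_contract Phi g E c p.
pose v p := - 84 * ratio_contract Phi g c c p.
have cZ (k : R) (f : M -> R) : continuous f -> continuous (fun p => k * f p).
  by move=> cf p; exact: (continuousM (@cst_continuous M R k p) (cf p)).
have cu : continuous u.
  move=> p; exact: (continuousD (continuousB (cZ _ _ (ratio_d_continuous hPhi hg fC) p)
    (cZ _ _ (ratio_contract_continuous hPhi hg fC fC) p))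
    (@cst_continuous M R (lambda / 6) p)).
have cd := cZ 56 _ (divergence_continuous hPhi hg hT fc).
have ce := cZ 168 _ (ratio_contract_continuous hPhi hg fE fc).
have cw : continuous w by move=> p; exact: (continuousB (cd p) (ce p)).
have cv : continuous v by exact: cZ (ratio_contract_continuous hPhi hg fc fc).
have int (f : M -> R) : continuous f -> mu.-integrable (K : set (borel M)) (EFin \o f).
  exact: (continuous_integrable hg hmu cK).
exists (\int[mu]_(p in (K : set (borel M))) u p),
  (\int[mu]_(p in (K : set (borel M))) v p) => t.
rewrite /cayley_action /integral_form.
rewrite (@eq_Rintegral _ (borel M) _ _ _ (fun p => u p + t * w p + t ^+ 2 * v p)); last first.
  move=> p _; rewrite (lagrangian_ratio hg lambda t p fC fc) /u /w /v /divergence.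
  have -> : ratio_contract Phi g E c p =
      ratio_contract Phi g C c p - ratio_contract Phi g T c p.
    rewrite (ratio_contractC hg E) ratio_contract_sub.
    by rewrite (ratio_contractC hg c C) (ratio_contractC hg c T).
  by move: (ratio_d _ _ _) (ratio_d _ _ _) (ratio_contract _ _ _ _ _)
    (ratio_contract _ _ _ _ _) (ratio_contract _ _ _ _ _) (ratio_contract _ _ _ _ _) => *; ring.
have ctw := cZ t _ cw; have ctv := cZ (t ^+ 2) _ cv.
have cutw : continuous (fun p => u p + t * w p) by move=> p; exact: (continuousD (cu p) (ctw p)).
rewrite (RintegralD mK (int _ cutw) (int _ ctv)) (RintegralD mK (int _ cu) (int _ ctw)).
rewrite (RintegralZl t mK (int _ cw)) (RintegralZl (t ^+ 2) mK (int _ cv)).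
congr (_ + _ * _ + _); rewrite (RintegralB mK (int _ cd) (int _ ce)).
have dc := divergence_continuous hPhi hg hT fc.
have ec := ratio_contract_continuous hPhi hg fE fc.
rewrite (RintegralZl 56 mK (int _ dc)) (RintegralZl 168 mK (int _ ec)).
by rewrite (stokes hPhi hg hT hmu fc cK cz) mulr0 sub0r mulNr.
Qed.

End Variation.

Theorem proposition1p3 (R : realType) (M : manifold R)
    (Phi : tensor_field M 4) (hPhi : is_cayley_form Phi)
    (g : matrix_field M) (hg : is_metric_of Phi g)
    (mu : {measure set (borel M) -> \bar R})
    (hmu : is_riemannian_measure mu g)
    (T : tensor_field M 3) (hT : is_torsion Phi g T)
    (lambda : R)
    (C : tensor_field M 3) (hC : is_form C) :
  euler_lagrange_C mu Phi g lambda C <->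
  (forall i p a, chart_dom i p -> C i p a = T i p a).
Proof.
have [fT _] := hT.
(* Only the coefficient of [t] survives in the derivative at 0. *)
have D (u v b : R) : is_derive (0 : R) (1 : R) (fun t : R => u + t * b + t ^+ 2 * v) b.
  apply: is_derive_eq; rewrite !scaler0 !scale0r !addr0 scaler0 !add0r mul1r addr0.
  exact: mulr1.
split=> [EL i p a ip|CT c K fc cK cz].
- apply: contrapT => /eqP; rewrite -subr_eq0 => Ea.
  have fE : is_form (fun i p a => C i p a + - 1 * T i p a) by exact: is_formD.
  have Ea' : C i p a + - 1 * T i p a != 0 by rewrite mulN1r.
  have [c [K [fc cK cz]]] := contract_test_form hPhi hg hmu fE ip Ea'.
  have [u [v uvE]] := cayley_action_quadratic hPhi hg hmu hT lambda hC fc cK cz.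
  (* Criticality makes the linear coefficient zero, whereas the test form was chosen so that its
     integral is not. *)
  have := EL c K fc cK cz; rewrite (funext uvE) => -[_ d0].
  have [_] := D u v (- 168 * \int[mu]_(q in (K : set (borel M)))
    ratio_contract Phi g (fun i p a => C i p a + - 1 * T i p a) c q).
  rewrite d0 => /esym/eqP; rewrite mulf_eq0 oppr_eq0 pnatr_eq0 /= => /eqP ->.
  by rewrite eqxx.
- have [u [v uvE]] := cayley_action_quadratic hPhi hg hmu hT lambda hC fc cK cz.
  rewrite (funext uvE) (_ : \int[mu]_(p in _) _ = 0); first by rewrite mulr0; exact: D.
  rewrite (@eq_Rintegral _ (borel M) _ _ _ (cst 0)) ?Rintegral_cst ?mul0r //.
    exact: compact_measurable_borel.
  move=> p _; rewrite /ratio_contract /density_contract /top_sum big1 ?mul0r // => s _.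
  rewrite /contract big1 ?mulr0 // => r _; rewrite big1 // => q _.
  by rewrite CT ?mulN1r ?subrr ?mul0r //; exact: dom_chart_at.
Qed.
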